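(* Let $X$ be a subgaussian random Hermitian $m\times m$ matrix (with constants $b_0,b_1,b_2$) and let $\|\xi\|_{\psi_2}<\infty$. There exist constants $C>0$, $D>0$, $c>0$ (depending only on $b_0,b_1,b_2$) such that the following holds. For all $t>0$ with $\tau_n\le cn$, for all $\varepsilon\ge D\varepsilon_{n,m}$ and for all subspaces $L\subset\mathbb C^m$ with $\dim(L)=r$, with probability at least $1-e^{-t}$, $$\|\hat\rho^{\varepsilon}-\rho^{\varepsilon}\|_{L_2(\Pi)}^2+\varepsilon K(\hat\rho^{\varepsilon};\rho^{\varepsilon})\le C\max\Bigl\{\sigma_\xi^2\beta^2(L)\frac{mr+\tau_n}n,\ \sigma_\xi\|P_{L^\perp}\rho^{\varepsilon}P_{L^\perp}\|_1\sqrt{\frac{mt_m}n},\ \|\rho^{\varepsilon}-\rho\|_{L_2(\Pi)}\sqrt{\frac{mt_m}n},\ (c_\xi\vee\sqrt m)\frac{\sqrt m\,t_{n,m}}n\Bigr\}.$$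
   Context: Notation: $\mathbb M_m(\mathbb C)$ is the set of complex $m\times m$ matrices, $\langle A,B\rangle=\mathrm{tr}(AB^* )$, $\|\cdot\|_1$ is the nuclear norm, $\|A\|_2=\langle A,A\rangle^{1/2}$. $\mathcal S=\{S\in\mathbb M_m(\mathbb C):S=S^*,\ S\ge0,\ \mathrm{tr}(S)=1\}$. $a\vee b=\max(a,b)$. $P_L$ is the orthogonal projection onto $L$, $L^\perp$ the orthogonal complement. For a random variable $\eta$, $\|\eta\|_{\psi_2}=\inf\{C>0:\mathbb E(e^{|\eta|^2/C^2}-1)\le1\}$. Model: $\rho\in\mathcal S$ is unknown; $X,X_1,\dots,X_n$ are i.i.d. random Hermitian $m\times m$ matrices with distribution $\Pi$; $\xi,\xi_1,\dots,\xi_n$ are i.i.d. real random variables independent of the $X$'s with $\mathbb E\xi=0$, $\sigma_\xi^2=\mathbb E\xi^2$; $Y_j=\mathrm{tr}(\rho X_j)+\xi_j$. For $\varepsilon>0$, $$\hat\rho^{\varepsilon}=\operatorname{argmin}_{S\in\mathcal S}\Bigl[n^{-1}\sum_{j=1}^n(Y_j-\mathrm{tr}(SX_j))^2+\varepsilon\,\mathrm{tr}(S\log S)\Bigr],\qquad \rho^{\varepsilon}=\operatorname{argmin}_{S\in\mathcal S}\Bigl[\mathbb E\langle S-\rho,X\rangle^2+\varepsilon\,\mathrm{tr}(S\log S)\Bigr]$$ (with $0\log0=0$); both are of full rank. $\|A\|_{L_2(\Pi)}^2=\mathbb E|\langle A,X\rangle|^2$. $X$ is subgaussian if, for fixed constants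 $b_0,b_1,b_2>0$: for all Hermitian $A$, $\mathbb Ee^{s\langle A,X\rangle}\le e^{s^2b_0^2\|A\|_{L_2(\Pi)}^2/2}$ for all $s\in\mathbb R$ (hence $\mathbb EX=0$ and $\|\langle A,X\rangle\|_{\psi_2}\le b_1\|A\|_{L_2(\Pi)}$ for all $A\in\mathbb M_m(\mathbb C)$), and $\|A\|_{L_2(\Pi)}\le b_2\|A\|_2$ for all $A\in\mathbb M_m(\mathbb C)$. $K(S_1;S_2)=\mathrm{tr}((S_1-S_2)(\log S_1-\log S_2))$. $\mathcal P_L(x)=x-P_{L^\perp}xP_{L^\perp}$ and $\beta(L)=\sup_{\|A\|_{L_2(\Pi)}\le1}\|\mathcal P_LA\|_{L_2(\Pi)}$ (sup over $A\in\mathbb M_m(\mathbb C)$). $t_m=t+\log(2m)$, $\tau_n=t+\log\log_2(2n)$, $t_{n,m}=\tau_n\log n\vee t_m$, $c_\xi=\|\xi\|_{\psi_2}\log\frac{\|\xi\|_{\psi_2}}{\sigma_\xi}$, and $\varepsilon_{n,m}=\sigma_\xi\sqrt{\frac{mt_m}n}\vee c_\xi\frac{\sqrt m\,t_m}n$. *)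

(* Defs.v *)
(* Quantities that are real in the mathematics but complex-valued here (traces,
   inner products and eigenvalues of Hermitian matrices) are brought to R with
   [complex.Re]; every such use is on a number whose imaginary part is 0. *)
From HB Require Import structures.
From mathcomp Require Import all_boot all_order all_algebra.
From mathcomp Require Import complex.
From mathcomp Require Import all_classical all_reals all_analysis.

Set Implicit Arguments.
Unset Strict Implicit.
Unset Printing Implicit Defensive.

Import Order.TTheory GRing.Theory Num.Theory.

Local Open Scope classical_set_scope.
Local Open Scope ring_scope.
Local Open Scope sesquilinear_scope.

HB.instance Definition _ (R : realType) := isPointed.Build R[i] 0.

Section Matrices.
Variables (R : realType) (m : nat).
Implicit Types A B S : 'M[R[i]]_m.

Definition mxip A B : R[i] := \tr (A *m B^t*).

Definition frobnorm A : R := Num.sqrt (complex.Re (mxip A A)).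

(* Functional calculus, for A Hermitian (spectral_diag A is then real). *)
Definition mxfun (f : R -> R) A : 'M[R[i]]_m :=
  invmx (spectralmx A)
    *m diag_mx (map_mx (fun z : R[i] => (f (complex.Re z))%:C%C)
                       (spectral_diag A))
    *m spectralmx A.

(* [ln] is 0 on nonpositive reals, so that S *m mxlog S below follows the
   convention 0 log 0 = 0. *)
Definition mxlog A := mxfun (@ln R) A.

(* tr |A| with |A| = (A^* A)^{1/2}. *)
Definition nucnorm A : R :=
  complex.Re (\tr (mxfun (@Num.sqrt R) (A^t* *m A))).

(* The order on R[i] makes 0 <= z imply that z is real. *)
Definition psdmx A : Prop :=
  forall v : 'cV[R[i]]_m, 0 <= (v^t* *m A *m v) 0 0.

Definition density : set 'M[R[i]]_m :=
  [set S | [/\ S \is hermsymmx, psdmx S & \tr S = 1]].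

Definition negentropy S : R := complex.Re (\tr (S *m mxlog S)).

Definition symKL S1 S2 : R :=
  complex.Re (\tr ((S1 - S2) *m (mxlog S1 - mxlog S2))).

(* A subspace of C^m is the row space of a matrix L, a vector being written
   as a row; \rank L is its dimension. [proj_ortho L] acts on rows by
   u |-> u *m proj_ortho L, hence the transpose, which acts on columns. *)
Definition orthoproj (L : 'M[R[i]]_m) : 'M[R[i]]_m := (proj_ortho L)^T.

Definition orthocompl (L : 'M[R[i]]_m) : 'M[R[i]]_m :=
  orthomx Num.conj 1%:M L.

Definition calP (L : 'M[R[i]]_m) A : 'M[R[i]]_m :=
  A - orthoproj (orthocompl L) *m A *m orthoproj (orthocompl L).

(* Coordinate cylinders; they generate the Borel sigma-algebra of
   M_m(C) = R^(2 m^2). *)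
Definition mx_cylinders : set_system 'M[R[i]]_m :=
  [set C | exists (i j : 'I_m) (B : set R), measurable B /\
     (C = [set A : 'M[R[i]]_m | B (complex.Re (A i j))] \/
      C = [set A : 'M[R[i]]_m | B (complex.Im (A i j))])].

Definition mxspace := g_sigma_algebraType mx_cylinders.

End Matrices.

Arguments density : clear implicits.

Section Argmin.
Variables (R : realType) (U : Type).

Definition is_argmin (D : set U) (F : U -> R) (x : U) : Prop :=
  D x /\ forall y, D y -> F x <= F y.

End Argmin.

Section Probability.
Context d (T : measurableType d) (R : realType) (P : probability T R).

(* Equal to +oo when no C > 0 qualifies. *)
Definition psi2norm (eta : T -> R) : \bar R :=
  ereal_inf [set C%:E | C in
    [set C : R | 0 < C /\
       ('E_P[fun w => (expR (`|eta w| ^+ 2 / C ^+ 2) - 1)%R] <= 1)%E]].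

Definition identically_distributed d' (E : measurableType d')
    (U V : {RV P >-> E}) : Prop :=
  forall B : set E, measurable B ->
    distribution P U B = distribution P V B.

Definition sigma_of d' (E : measurableType d') (U : {RV P >-> E}) :
  set_system T := preimage_set_system setT U measurable.

Definition mutually_independent (I : finType) (F : I -> set_system T) : Prop :=
  forall (J : {set I}) (A : I -> set T), (forall i, i \in J -> F i (A i)) ->
    (P (\bigcap_(i in [set` J]) A i) = \prod_(i in J) P (A i))%E.

End Probability.

Section Design.
Context d (T : measurableType d) (R : realType) (P : probability T R).
Variables (m : nat) (X : {RV P >-> mxspace R m}).
Implicit Types A : 'M[R[i]]_m.

(* ||A||_{L_2(Pi)} = (E |<A, X>|^2)^(1/2), Pi being the law of X. *)
Definition eL2norm A : \bar R :=
  ('N[P]_2%:E[(fun w => (Normc.normc (mxip A (X w)))%:E)])%E.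

Definition L2norm A : R := fine (eL2norm A).

Definition subgaussian (b0 b1 b2 : R) : Prop :=
  [/\ forall A, A \is hermsymmx -> forall s : R,
        ('E_P[fun w => expR (s * complex.Re (mxip A (X w)))] <=
         (expR (s ^+ 2 * b0 ^+ 2 * L2norm A ^+ 2 / 2))%:E)%E,
      forall A,
        (psi2norm P (fun w => Normc.normc (mxip A (X w))) <=
         b1%:E * eL2norm A)%E
    & forall A, (eL2norm A <= (b2 * frobnorm A)%:E)%E].

(* May be +oo: the L_2(Pi)-seminorm can vanish at some A with
   ||P_L A||_{L_2(Pi)} > 0. *)
Definition beta (L : 'M[R[i]]_m) : \bar R :=
  ereal_sup [set eL2norm (calP L A) | A in
    [set A : 'M[R[i]]_m | (eL2norm A <= 1)%E]].

Definition population_risk (rho : 'M[R[i]]_m) (eps : R) (S : 'M[R[i]]_m) : R :=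
  fine ('E_P[fun w => (complex.Re (mxip (S - rho) (X w)) ^+ 2)%R])%E
  + eps * negentropy S.

End Design.

Section Model.
Variables (R : realType) (m n : nat).

Definition response (rho : 'M[R[i]]_m) (x : 'M[R[i]]_m) (noise : R) : R :=
  complex.Re (\tr (rho *m x)) + noise.

Definition empirical_risk (x : 'I_n -> 'M[R[i]]_m) (y : 'I_n -> R) (eps : R)
    (S : 'M[R[i]]_m) : R :=
  n%:R^-1 * (\sum_(j < n) (y j - complex.Re (\tr (S *m x j))) ^+ 2)
  + eps * negentropy S.

End Model.

(* X and xi are generic copies, of which only the laws matter; they need not be
   independent of the sample. *)
Record sampling_model d (T : measurableType d) (R : realType)
    (P : probability T R) (m n : nat)
    (X : {RV P >-> mxspace R m}) (Xs : 'I_n -> {RV P >-> mxspace R m})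
    (xi : {RV P >-> R}) (xis : 'I_n -> {RV P >-> R}) : Prop := {
  design_hermitian : forall w, (X w : 'M[R[i]]_m) \is hermsymmx;
  sample_hermitian : forall j w, (Xs j w : 'M[R[i]]_m) \is hermsymmx;
  sample_law : forall j, identically_distributed (Xs j) X;
  noise_law : forall j, identically_distributed (xis j) xi;
  sample_independent :
    mutually_independent P (fun k : 'I_n + 'I_n =>
      match k with inl j => sigma_of (Xs j) | inr j => sigma_of (xis j) end);
  noise_centered : ('E_P[xi] = 0)%E
}.

Section Rates.
Variables (R : realType).

Definition t_m (t : R) (m : nat) : R := t + ln (2 * m%:R).

Definition log2 (x : R) : R := ln x / ln 2.

Definition tau_n (t : R) (n : nat) : R := t + ln (log2 (2 * n%:R)).

Definition t_nm (t : R) (n m : nat) : R :=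
  Num.max (tau_n t n * ln n%:R) (t_m t m).

Context d (T : measurableType d) (P : probability T R).
Variable xi : T -> R.

Definition noise_sd : R := Num.sqrt (fine ('E_P[fun w => (xi w ^+ 2)%R])%E).

(* If xi = 0 almost surely, the formula 0 * log (0 / 0) evaluates to 0. *)
Definition c_noise : R :=
  fine (psi2norm P xi) * ln (fine (psi2norm P xi) / noise_sd).

Definition eps_nm (t : R) (n m : nat) : R :=
  Num.max (noise_sd * Num.sqrt (m%:R * t_m t m / n%:R))
          (c_noise * (Num.sqrt m%:R * t_m t m / n%:R)).

End Rates.

(* Main.v *)
Require Import Defs.
From HB Require Import structures.
From mathcomp Require Import all_boot all_order all_algebra.
From mathcomp Require Import complex.
From mathcomp Require Import all_classical all_reals all_analysis.
From mathcomp Require Import measurable_realfun ring lra.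

Set Implicit Arguments.
Unset Strict Implicit.
Unset Printing Implicit Defensive.

Import Order.TTheory GRing.Theory Num.Theory.

Local Open Scope classical_set_scope.
Local Open Scope ring_scope.
Local Open Scope sesquilinear_scope.

(* The first-order conditions for the two minimizers give, with Delta the
   difference of the minimizers, H = rho^eps - rho and Xi the average of
   xi_j X_j,
     eps K + 2 P_n <Delta, X>^2 <= 2 <Delta, Xi> - 2 (P_n - P) <H, X> <Delta, X>.
   Density matrices lie in the convex hull of e^{O(m)} Hermitian matrices of
   rank two and bounded norm, so that linear functionals of Delta are controlled
   by a union bound. The quadratic form P_n <Delta, X>^2 is bounded below by
   Maurey's method: Delta is an average of random frame matrices, and the lower
   bound holds for all averages of about n / (m + t) of them. The noise term is
   split by P_L: the range of P_L has real dimension at most 2 m r, which gives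
   the term with beta(L), while <P_{L^perp} Delta P_{L^perp}, Xi> is at most the
   norm of Xi times tr (P_{L^perp} (rhohat + rho^eps)), and tr (P_{L^perp} rhohat)
   is at most 2 tr (P_{L^perp} rho^eps) + K, where K is absorbed by eps K. *)

(** * Independence and expectations *)

(** A bound for a linear functional passes from the frames to their convex hull, but a lower bound
    for a quadratic form does not; this obstacle is why Maurey's averages appear. Averages of p
    frames cost an entropy of order m p, affordable for p of order n / (m + t), and they miss the
    form by a variance term of order n / p, that is m + t. Since log (2 m) >= 1/2, m + t is at most
    2 m t_m and fits into the last term of the maximum. Frames are bilinear in two real vectors, so
    that each vector can be rounded to a lattice separately. Given the noise, linear functionals of
    Xi are subgaussian with variance proportional to the sum of the xi_j^2, so the noise enters
    through this sum only. The estimator is an arbitrary function of the sample point, not assumed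
    measurable; hence all events are uniform over pairs of densities, and the exceptional sets do
    not involve the estimator. The bound for tr (P_{L^perp} rhohat) compares square roots of the two
    minimizers, since K dominates twice their squared Frobenius distance. *)

Section Weights.
Local Open Scope ereal_scope.
Import HBNNSimple.
Context d d' (T : measurableType d) (E : measurableType d') (R : realType).
Variable mu : {measure set T -> \bar R}.

(** Indicators, then simple functions, then monotone limits. In the application [g] is the product
    of the other factors of an independent family and [c] the product of their means. *)
Lemma ge0_integral_comp_weight (Z : T -> E) (g : T -> R) (c : R) :
  measurable_fun setT Z -> measurable_fun setT g -> (forall w, 0 <= g w)%R -> (0 <= c)%R ->
  (forall D, measurable D ->
     \int[mu]_w (\1_D (Z w) * g w)%:E = c%:E * \int[mu]_w (\1_D (Z w))%:E) ->
  forall h : E -> R, measurable_fun setT h -> (forall x, 0 <= h x)%R ->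
  \int[mu]_w (h (Z w) * g w)%:E = c%:E * \int[mu]_w (h (Z w))%:E.
Proof.
move=> mZ mg g0 c0 Hind h mh h0.
have meh : measurable_fun setT (EFin \o h) by exact/measurable_EFinP.
pose f_ := nnsfun_approx measurableT meh.
have mind (D : set E) : measurable D ->
    measurable_fun setT (fun w => \1_D (Z w) : R).
  by move=> mD; exact: (measurableT_comp (f := \1_D : E -> R)).
have mf_ n : measurable_fun setT (fun w => f_ n (Z w)).
  exact: measurableT_comp.
have step n : \int[mu]_w (f_ n (Z w) * g w)%:E =
    c%:E * \int[mu]_w (f_ n (Z w))%:E.
  have E1 w : f_ n (Z w) = (\sum_(k <- finmap.enum_fset (fset_set (range (f_ n))))
      (k * \1_(f_ n @^-1` [set k]) (Z w)))%R.
    by rewrite fimfunE fsbig_finite //=.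
  have k0 k w : (0 <= k * \1_(f_ n @^-1` [set k]) (Z w))%R.
    by rewrite -lee_fin EFinM; exact: nnfun_muleindic_ge0.
  have mk k : measurable_fun setT (fun w => k * \1_(f_ n @^-1` [set k]) (Z w))%R.
    by apply: measurable_funM => //; apply: mind.
  under eq_integral => w _ do rewrite E1 mulr_suml -sumEFin.
  under [in RHS]eq_integral => w _ do rewrite E1 -sumEFin.
  rewrite ge0_integral_sum//; last 2 first.
  - by move=> k; apply/measurable_EFinP/measurable_funM.
  - by move=> k w _; rewrite lee_fin mulr_ge0.
  rewrite ge0_integral_sum; [|by []|by move=> k; apply/measurable_EFinP|by move=> k w _; rewrite lee_fin].
  rewrite ge0_sume_distrr; last by move=> k _; apply: integral_ge0 => w _; rewrite lee_fin.
  apply: eq_bigr => k _.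
  have [kneg|k_ge0] := ltP k 0%R.
    have z w : \1_(f_ n @^-1` [set k]) (Z w) = 0%R :> R.
      by rewrite preimage_nnfun0// indic0.
    under eq_integral => w _ do rewrite z mulr0 mul0r.
    under [in RHS]eq_integral => w _ do rewrite z mulr0.
    by rewrite integral0 mule0.
  have mD : measurable (f_ n @^-1` [set k]) by [].
  under eq_integral => w _ do rewrite -mulrA EFinM.
  under [in RHS]eq_integral => w _ do rewrite EFinM.
  rewrite ge0_integralZl_EFin//; last 2 first.
  - by move=> w _; rewrite lee_fin mulr_ge0.
  - by apply/measurable_EFinP/measurable_funM => //; apply: mind.
  rewrite Hind// ge0_integralZl_EFin; [|by []| | |by []]; last 2 first.
  - by move=> w _; rewrite lee_fin.
  - by apply/measurable_EFinP; apply: mind.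
  by rewrite muleCA.
have f_cvg x : EFin \o f_ ^~ x @ \oo --> (h x)%:E.
  by apply: cvg_nnsfun_approx => // y _; rewrite lee_fin.
have nd x m n : (m <= n)%N -> (f_ m x <= f_ n x)%R.
  by move=> mn; exact/lefP/nd_nnsfun_approx.
transitivity (limn (fun n => \int[mu]_w (f_ n (Z w) * g w)%:E)).
  rewrite -monotone_convergence//.
  - apply: eq_integral => w _; apply/esym/cvg_lim => //.
    rewrite (_ : (fun n => (f_ n (Z w) * g w)%:E) = (fun n => (f_ n (Z w))%:E * (g w)%:E)) ?EFinM//.
    by apply: cvgeZr => //; exact: f_cvg.
  - by move=> n; apply/measurable_EFinP/measurable_funM.
  - by move=> n w _; rewrite lee_fin mulr_ge0.
  - by move=> w _ m n mn; rewrite lee_fin ler_wpM2r// nd.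
under eq_fun do rewrite step.
apply/cvg_lim => //; apply: cvgeZl => //.
rewrite (_ : \int[mu]_w (h (Z w))%:E = \int[mu]_w limn (fun n => (f_ n (Z w))%:E)); last first.
  by apply: eq_integral => w _; apply/esym/cvg_lim => //; exact: f_cvg.
apply: cvg_monotone_convergence => //.
- by move=> n; apply/measurable_EFinP.
- by move=> n w _; rewrite lee_fin.
- by move=> w _ m n mn; rewrite lee_fin nd.
Qed.
End Weights.

Section Independence.
Local Open Scope ereal_scope.
Context d d1 d2 (T : measurableType d) (E1 : measurableType d1)
  (E2 : measurableType d2) (R : realType) (P : probability T R).
Variables (K : finType) (U : K -> {RV P >-> E1}) (V : K -> {RV P >-> E2}).
Hypothesis indep : mutually_independent P (fun k : K + K =>
  match k with inl i => sigma_of (U i) | inr i => sigma_of (V i) end).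
Implicit Types (D : K -> set (E1 * E2)%type) (i : K).

Let Z i w := (U i w, V i w).

Let measurable_pair i : measurable_fun setT (Z i).
Proof. exact: measurable_fun_pair. Qed.

Let preZ_measurable i (D : set (E1 * E2)) : measurable D ->
  measurable (Z i @^-1` D).
Proof. by move=> mD; rewrite -[X in measurable X]setTI; exact: measurable_pair. Qed.

Let prob_rectangles (A : K -> set E1) (B : K -> set E2) :
  (forall i, measurable (A i)) -> (forall i, measurable (B i)) ->
  P (\bigcap_i (Z i @^-1` (A i `*` B i))) =
  \prod_i (P (U i @^-1` A i) * P (V i @^-1` B i)).
Proof.
move=> mA mB.
pose F (k : K + K) := match k with
  inl i => U i @^-1` A i | inr i => V i @^-1` B i end.
have : P (\bigcap_(k in [set` finset.setTfor (K + K)%type]) F k) =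
    \prod_(k in finset.setTfor (K + K)%type) P (F k).
  by apply: indep => -[] i _ /=; [exists (A i)|exists (B i)]; rewrite ?setTI.
rewrite [in X in _ = X -> _](eq_bigl xpredT); last by move=> k; rewrite finset.inE.
rewrite big_sumType /= -big_split /= => <-; congr (P _).
rewrite eqEsubset; split => w /= H.
  by case=> i _ /=; have [] := H i.
move=> i _; split => /=.
- by apply: (H (inl i)) => /=; rewrite finset.inE.
- by apply: (H (inr i)) => /=; rewrite finset.inE.
Qed.

Let prob_rectangle i (A : set E1) (B : set E2) :
  measurable A -> measurable B ->
  P (Z i @^-1` (A `*` B)) = P (U i @^-1` A) * P (V i @^-1` B).
Proof.
move=> mA mB.
have := @prob_rectangles (fun j => if j == i then A else setT)
  (fun j => if j == i then B else setT).
move=> H; have {}H := H (ltac:(by move=> j; case: ifP)) (ltac:(by move=> j; case: ifP)).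
move: H.
rewrite (bigD1 i)//= eqxx big1 ?mule1; last first.
  by move=> j /negPf ->; rewrite !preimage_setT probability_setT mule1.
move=> <-; congr (P _); rewrite eqEsubset; split => w /= H.
  by move=> j _; case: eqP => [->|].
by have := H i I; rewrite /= eqxx.
Qed.

(** Independence is given on rectangles only. They are replaced by general sets one index at a time:
    as functions of the set at a single index both sides are finite measures, so agreement on the
    pi-system of rectangles suffices. *)
Lemma indep_pairs (D : K -> set (E1 * E2)) : (forall i, measurable (D i)) ->
  P (\bigcap_i (Z i @^-1` D i)) = \prod_i P (Z i @^-1` D i).
Proof.
move=> mD.
(* [s] lists the indices whose set may be arbitrary; the others still carry rectangles. *)
suff H (s : seq K) : forall D : K -> set (E1 * E2), (forall i, measurable (D i)) ->
    (forall i, i \notin s -> exists A B, [/\ measurable A, measurable B & D i = A `*` B]) ->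
    P (\bigcap_i (Z i @^-1` D i)) = \prod_i P (Z i @^-1` D i).
  by apply: (H (enum K)) => // i; rewrite mem_enum.
elim: s => [|i0 s IH] {mD}D mD rect.
  have /choice[A /choice[B AB]] : forall i, exists A B,
    [/\ measurable A, measurable B & D i = A `*` B] by move=> i; exact: rect.
  under eq_bigcapr => i _ do have [_ _ ->] := AB i.
  rewrite prob_rectangles; try by move=> i; have [] := AB i.
  by apply: eq_bigr => i _; have [? ? ->] := AB i; rewrite prob_rectangle.
pose W := \bigcap_(i in [set i | i != i0]) (Z i @^-1` D i).
have mW : measurable W.
  by apply: fin_bigcap_measurable => //= i _; exact: preZ_measurable.
pose q := \prod_(i | i != i0) P (Z i @^-1` D i).
have q0 : 0 <= q by apply: prode_ge0.
have qfin : q \is a fin_num.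
  by apply: prode_fin_num => i _; apply: fin_num_measure; exact: preZ_measurable.
have WE (G0 : set (E1 * E2)) :
    \bigcap_i (Z i @^-1` (if i == i0 then G0 else D i)) = Z i0 @^-1` G0 `&` W.
  rewrite eqEsubset; split => w /=.
    move=> H; split; first by have := H i0 Logic.I; rewrite eqxx.
    by move=> i /= /negPf ii0; have := H i Logic.I; rewrite /= ii0.
  by move=> [H0 H] i _ /=; case: eqP => [->//|/eqP ii0]; exact: (H i).
have rectE (G0 : set (E1 * E2)) : measurable G0 ->
    (exists A B, [/\ measurable A, measurable B & G0 = A `*` B]) ->
    P (Z i0 @^-1` G0 `&` W) = P (Z i0 @^-1` G0) * q.
  move=> mG0 G0rect; rewrite -WE IH.
  - rewrite (bigD1 i0)//= eqxx; congr (_ * _).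
    by apply: eq_bigr => i /negPf ->.
  - by move=> i; case: ifP.
  - move=> i; case: eqP => [_ _//|/eqP ii0 iN]; apply: rect.
    by rewrite inE negb_or ii0.
pose m1 : {measure set (E1 * E2)%type -> \bar R} :=
  measure_function_pushforward__canonical__measure_function_Measure
    (mrestr P mW) (measurable_pair i0).
pose m2 : {measure set (E1 * E2)%type -> \bar R} :=
  mscale (NngNum (fine_ge0 q0))
    (measure_function_pushforward__canonical__measure_function_Measure
      P (measurable_pair i0)).
have m12 : forall G0 : set (E1 * E2), measurable G0 -> m1 G0 = m2 G0.
  move=> G0; rewrite measurable_prod_measurableType.
  apply: (@g_sigma_algebra_measure_unique _ _ _ _ _ (fun=> setT)).
  - by move=> _ [A mA [B mB <-]]; exact: measurableX.
  - by move=> _; exists setT => //; exists setT => //; rewrite setXTT.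
  - by rewrite bigcup_const.
  - move=> _ _ [A mA [B mB <-]] [A' mA' [B' mB' <-]].
    exists (A `&` A'); first exact: measurableI.
    by exists (B `&` B'); [exact: measurableI|rewrite setXI].
  - move=> _ [A mA [B mB <-]]; rewrite /m1 /m2 /=/pushforward /mrestr /mscale/=.
    rewrite rectE; [|exact: measurableX|by exists A, B].
    by rewrite fineK// muleC.
  - move=> _; rewrite /m1 /= /pushforward /mrestr preimage_setT setTI.
    by rewrite (le_lt_trans (probability_le1 P _))// ltry.
have := m12 _ (mD i0); rewrite /m1 /m2 /=/pushforward /mrestr /mscale/= -WE fineK// muleC.
rewrite (bigD1 i0)//= => <-; congr (P _).
by apply: eq_bigcapr => i _; case: eqP => [->|].
Qed.

(** The same replacement of one index at a time, from indicators to nonnegative functions. Finite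
    means make the constant of [ge0_integral_comp_weight] a real number. *)
Lemma integral_prod_indep (phi : K -> E1 * E2 -> R) :
  (forall i, measurable_fun setT (phi i)) -> (forall i x, 0 <= phi i x)%R ->
  (forall i, \int[P]_w (phi i (Z i w))%:E < +oo) ->
  \int[P]_w (\prod_i phi i (Z i w))%:E = \prod_i \int[P]_w (phi i (Z i w))%:E.
Proof.
suff H (s : seq K) : forall phi : K -> E1 * E2 -> R,
  (forall i, measurable_fun setT (phi i)) -> (forall i x, 0 <= phi i x)%R ->
  (forall i, \int[P]_w (phi i (Z i w))%:E < +oo) ->
  (forall i, i \notin s -> exists2 G : set (E1 * E2), measurable G & phi i = \1_G) ->
  \int[P]_w (\prod_i phi i (Z i w))%:E = \prod_i \int[P]_w (phi i (Z i w))%:E.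
  by move=> mphi phi0 phioo; apply: (H (enum K)) => // i; rewrite mem_enum.
elim: s => [|i0 s IH] {}phi mphi phi0 phioo ind.
  have /choice[D DE] : forall i, exists G : set (E1 * E2), measurable G /\ phi i = \1_G.
    by move=> i; have [//|G ? ?] := ind i; exists G.
  have phiE i w : phi i (Z i w) = \1_(Z i @^-1` D i) w.
    by have [_ ->] := DE i; rewrite !indicE.
  under eq_integral => w _.
    rewrite (_ : (\prod_i _)%R = \1_(\bigcap_i (Z i @^-1` D i)) w :> R); last first.
      under eq_bigr do rewrite phiE indicE.
      rewrite indicE; case: (boolP (w \in _)) => [|/negP].
        rewrite inE => H; rewrite big1// => i _.
        by rewrite mem_set//; exact: H.
      rewrite inE => /existsNP[i /not_implyP[_ H]].
      by rewrite (bigD1 i)//= memNset// mul0r.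
    over.
  have mZD i : measurable (Z i @^-1` D i).
    by apply: preZ_measurable; have [] := DE i.
  rewrite integral_indic//; last by apply: fin_bigcap_measurable.
  rewrite setIT; transitivity (\prod_i P (Z i @^-1` D i)).
    by apply: indep_pairs => i; have [] := DE i.
  apply: eq_bigr => i _; under eq_integral do rewrite phiE.
  by rewrite integral_indic// setIT.
pose c := (\prod_(i | i != i0) \int[P]_w (phi i (Z i w))%:E)%E.
have int0 i : 0 <= \int[P]_w (phi i (Z i w))%:E.
  by apply: integral_ge0 => w _; rewrite lee_fin.
have c0 : 0 <= c by apply: prode_ge0.
have cfin : c \is a fin_num.
  by apply: prode_fin_num => i _; rewrite ge0_fin_numE.
have mphiZ i : measurable_fun setT (fun w => phi i (Z i w)).
  exact: measurableT_comp.
have W := @ge0_integral_comp_weight _ _ _ _ _ P (Z i0)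
  (fun w => \prod_(i | i != i0) phi i (Z i w))%R (fine c) (measurable_pair i0).
have {}W := W (ltac:(by under eq_fun do rewrite -big_filter; apply: measurable_prod => i _; exact: mphiZ))
  (ltac:(by move=> w; exact: prodr_ge0)) (ltac:(exact: fine_ge0)).
have {W} : \int[P]_w (phi i0 (Z i0 w) * \prod_(i | i != i0) phi i (Z i w))%:E =
    (fine c)%:E * \int[P]_w (phi i0 (Z i0 w))%:E.
  apply: W => // G mG; rewrite fineK//.
  have mGZ : measurable (Z i0 @^-1` G) by exact: preZ_measurable.
  have GE w : \1_G (Z i0 w) = \1_(Z i0 @^-1` G) w :> R by rewrite !indicE.
  pose psi i := if i == i0 then (\1_G : E1 * E2 -> R) else phi i.
  have : \int[P]_w (\prod_i psi i (Z i w))%:E = \prod_i \int[P]_w (psi i (Z i w))%:E.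
    apply: IH => i; rewrite /psi.
    - by case: ifP.
    - by move=> x; case: ifP.
    - case: eqP => // ->; under eq_integral do rewrite GE.
      by rewrite integral_indic// setIT (le_lt_trans (probability_le1 P _))// ltry.
    - case: eqP => [_ _|/eqP ii0 iN]; first by exists G.
      by apply: ind; rewrite inE negb_or ii0.
  rewrite (bigD1 i0)//= {2}/psi eqxx muleC => H.
  transitivity (\int[P]_w (\prod_i psi i (Z i w))%:E).
    apply: eq_integral => w _; rewrite [in RHS](bigD1 i0)//= [in RHS]/psi eqxx /=.
    by congr (EFin (_ * _)%R); apply: eq_bigr => i /negPf ->.
  by rewrite H; congr (_ * _); apply: eq_bigr => i /negPf; rewrite /psi => ->.
rewrite fineK// => W; rewrite [in RHS](bigD1 i0)//= muleC -W.
by apply: eq_integral => w _; rewrite (bigD1 i0).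
Qed.

(** The law of the pair is the product measure, so Tonelli applies; this is the form in which one
    conditions on the noise. *)
Lemma ge0_integral_indep_pair i (h : E1 * E2 -> \bar R) :
  measurable_fun setT h -> (forall x, 0 <= h x) ->
  \int[P]_w h (Z i w) =
  \int[distribution P (V i)]_y \int[distribution P (U i)]_x h (x, y).
Proof.
move=> mh h0.
rewrite -(fubini_tonelli2 h)//.
pose m1 : {measure set (E1 * E2)%type -> \bar R} :=
  measure_function_pushforward__canonical__measure_function_Measure
    P (measurable_pair i).
rewrite (eq_measure_integral m1); last first.
  move=> A mA _; apply: product_measure_unique => // B C mB mC.
  by rewrite /m1 /= /pushforward prob_rectangle.
by rewrite /m1 ge0_integral_pushforward.
Qed.

End Independence.

(** * Moment generating functions and tails *)

Section Scalar.
Variable R : realType.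
Implicit Types x y : R.

Lemma expR_ge1DxDx2 x : 0 <= x -> 1 + x + x ^+ 2 / 4 <= expR x.
Proof.
move=> x0; have h : 1 + x / 2 <= expR (x / 2) by exact: expR_ge1Dx.
have -> : expR x = expR (x / 2) ^+ 2 by rewrite expr2 -expRD -splitr.
have : (1 + x / 2) ^+ 2 <= expR (x / 2) ^+ 2.
  by rewrite ler_sqr ?nnegrE ?expR_ge0//; lra.
by apply: le_trans; rewrite le_eqVlt; apply/orP; left; apply/eqP; field.
Qed.

Lemma sqr_le_expR x : 0 <= x -> x ^+ 2 <= 2 * (expR x - 1).
Proof.
move=> /(@expR_ge1Dxn _ x 1); rewrite (_ : 2`!%:R = 2 :> R)//; lra.
Qed.

Lemma expRN_le x : 0 <= x -> expR (- x) <= 1 - x + x ^+ 2.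
Proof.
move=> x0; have h : 1 + x <= expR x by exact: expR_ge1Dx.
have e0 : 0 < expR x by exact: expR_gt0.
rewrite expRN -[_^-1]mul1r ler_pdivrMr//.
apply: (@le_trans _ _ ((1 - x + x ^+ 2) * (1 + x))); last first.
  by rewrite ler_wpM2l//; nra.
have : 0 <= x ^+ 3 by exact: exprn_ge0.
by rewrite (_ : (1 - x + x ^+ 2) * (1 + x) = 1 + x ^+ 3); [lra|ring].
Qed.

Lemma expR_le_taylor2 x : expR x <= 1 + x + x ^+ 2 * expR `|x|.
Proof.
have h1 : expR x - 1 <= x * expR x.
  have : 1 - x <= expR (- x) by exact: expR_ge1Dx.
  rewrite -(ler_pM2r (expR_gt0 x)) -expRD addNr expR0; lra.
have h2 : 1 + x <= expR x by exact: expR_ge1Dx.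
have [x0|x0] := leP 0 x.
  rewrite ger0_norm//.
  have : x * (expR x - 1) <= x * (x * expR x) by rewrite ler_wpM2l.
  rewrite expr2; lra.
have e1 : 1 <= expR `|x|.
  by apply: le_trans (expR_ge1Dx _); rewrite lerDl.
have : x ^+ 2 * 1 <= x ^+ 2 * expR `|x| by rewrite ler_wpM2l// sqr_ge0.
have : x * (expR x - 1) <= x * x by rewrite ler_wnM2l; lra.
rewrite expr2; lra.
Qed.

Lemma expR_le_inv1B x : 0 <= x <= 2^-1 -> expR x <= 1 + 2 * x.
Proof.
move=> /andP[x0 x2].
have : 1 - x <= expR (- x) by exact: expR_ge1Dx.
rewrite -(ler_pM2r (expR_gt0 x)) -expRD addNr expR0 => h.
have e0 : 0 < expR x by exact: expR_gt0.
suff : (1 - x) * expR x <= (1 - x) * (1 + 2 * x) by rewrite ler_pM2l//; lra.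
nra.
Qed.

End Scalar.

Section Mgf.
Local Open Scope ereal_scope.
Context d (T : measurableType d) (R : realType) (P : probability T R).

(** Integrates a pointwise inequality whose terms have been distributed over the two sides so that
    all are nonnegative: no integrability has to be shown and no infinite values are subtracted. *)
Lemma le_integral_linear (f g h k : T -> R) (a b c e : R) :
  measurable_fun setT f -> measurable_fun setT g ->
  measurable_fun setT h -> measurable_fun setT k ->
  (forall w, 0 <= f w)%R -> (forall w, 0 <= g w)%R ->
  (forall w, 0 <= h w)%R -> (forall w, 0 <= k w)%R ->
  (0 <= a)%R -> (0 <= b)%R -> (0 <= c)%R -> (0 <= e)%R ->
  (forall w, f w + b * g w <= a + c * h w + e * k w)%R ->
  \int[P]_w (f w)%:E + b%:E * \int[P]_w (g w)%:E <=
  a%:E + c%:E * \int[P]_w (h w)%:E + e%:E * \int[P]_w (k w)%:E.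
Proof.
move=> mf mg mh mk f0 g0 h0 k0 a0 b0 c0 e0 H.
have mE (u : T -> R) : measurable_fun setT u -> measurable_fun setT (fun w => (u w)%:E).
  by move=> mu; exact/measurable_EFinP.
have -> : a%:E = \int[P]_w a%:E.
  by rewrite integral_cst//= probability_setT mule1.
have Zl (u : T -> R) (r : R) : measurable_fun setT u -> (forall w, 0 <= u w)%R ->
    (0 <= r)%R -> r%:E * \int[P]_w (u w)%:E = \int[P]_w (r * u w)%:E.
  move=> mu u0 r0; under [RHS]eq_integral do rewrite EFinM.
  by rewrite ge0_integralZl_EFin// => [w _|]; [rewrite lee_fin|exact: mE].
have Dl (u v : T -> R) : measurable_fun setT u -> (forall w, 0 <= u w)%R ->
    measurable_fun setT v -> (forall w, 0 <= v w)%R ->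
    \int[P]_w (u w)%:E + \int[P]_w (v w)%:E = \int[P]_w (u w + v w)%:E.
  move=> mu u0 mv v0; under [RHS]eq_integral do rewrite EFinD.
  by rewrite ge0_integralD// => [w _||w _|]; rewrite ?lee_fin//; exact: mE.
have mZ (u : T -> R) (r : R) : measurable_fun setT u -> measurable_fun setT (fun w => r * u w)%R.
  by move=> mu; exact: measurable_funM.
have pZ (u : T -> R) (r : R) : (forall w, 0 <= u w)%R -> (0 <= r)%R -> forall w, (0 <= r * u w)%R.
  by move=> u0 r0 w; rewrite mulr_ge0.
rewrite !Zl// Dl//; [|exact: mZ|exact: pZ].
rewrite Dl//; [|exact: mZ|exact: pZ].
rewrite Dl//; [|by apply: measurable_funD => //; exact: mZ|by move=> w; rewrite addr_ge0 ?pZ|exact: mZ|exact: pZ].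
have pl w : [set: T] w -> 0 <= (f w + b * g w)%:E by rewrite lee_fin addr_ge0 ?pZ.
have ml := mE _ (measurable_funD mf (mZ _ b mg)).
have mr : measurable_fun setT (fun w => (a + c * h w + e * k w)%:E).
  by apply: mE; apply: measurable_funD; [apply: measurable_funD => //|]; exact: mZ.
by apply: ge0_le_integral => // w _; rewrite lee_fin.
Qed.

(** The inequality is strict because the norm is an infimum: any [K] above it dominates an
    admissible constant. *)
Lemma psi2norm_lt_mgf (eta : T -> R) (K : R) : measurable_fun setT eta ->
  psi2norm P eta < K%:E -> \int[P]_w (expR (eta w ^+ 2 / K ^+ 2))%:E <= 2%:E.
Proof.
move=> meta /ereal_inf_lt[_ [C [C0 EC] <-]]; rewrite lte_fin => CK.
have K0 : (0 < K)%R by rewrite (lt_trans C0).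
have mexp (k : R) : measurable_fun setT (fun w => expR (eta w ^+ 2 / k ^+ 2)).
  apply: measurableT_comp => //; apply: measurable_funM => //.
  exact: measurable_funX.
move: EC; rewrite unlock => EC.
have mg : measurable_fun setT (fun w => expR (`|eta w| ^+ 2 / C ^+ 2) - 1)%R.
  apply: measurable_funB => //; under eq_fun do rewrite real_normK ?num_real//.
  exact: mexp.
have h0 w : (0 <= expR (`|eta w| ^+ 2 / C ^+ 2) - 1)%R.
  rewrite subr_ge0 -expR0 ler_expR divr_ge0// ?sqr_ge0//.
have k0 : measurable_fun setT (cst 0%R : T -> R) by [].
have := @le_integral_linear _ _ _ _ 1 0 1 0 (mexp K) k0 mg k0 (fun=> expR_ge0 _)
  (fun=> lexx _) h0 (fun=> lexx _) ler01 (lexx _) ler01 (lexx _).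
rewrite !mul0e !adde0 !mul1e => H; apply: le_trans (H _) _; last first.
  by rewrite (_ : 2 = 1 + 1)%R// EFinD leeD2l.
move=> w; rewrite /= mul0r mul1r !addr0 addrCA subrr addr0.
rewrite real_normK ?num_real// ler_expR ler_wpM2l ?sqr_ge0//.
by rewrite lef_pV2 ?posrE ?exprn_gt0// ler_sqr ?nnegrE ltW.
Qed.

Let k0 : measurable_fun setT (cst 0%R : T -> R). Proof. by []. Qed.

Lemma integral_sub1_le1 (f : T -> R) : measurable_fun setT f ->
  (forall w, 1 <= f w)%R -> \int[P]_w (f w)%:E <= 2%:E ->
  \int[P]_w (f w - 1)%:E <= 1.
Proof.
move=> mf f1 f2.
have mf1 : measurable_fun setT (fun w => f w - 1)%R by exact: measurable_funB.
have m1 : measurable_fun setT (cst 1%R : T -> R) by [].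
have f0 w : (0 <= f w)%R by rewrite (le_trans _ (f1 w)).
have f10 w : (0 <= f w - 1)%R by rewrite subr_ge0.
have := @le_integral_linear _ _ _ _ 0 1 1 0 mf1 m1 mf k0 f10 (fun=> ler01) f0
  (fun=> lexx _) (lexx _) ler01 ler01 (lexx _).
move=> /(_ _)/wrap[w|]; first by rewrite /=; lra.
have I1 : \int[P]_w (cst 1%R w : R)%:E = 1.
  transitivity (\int[P]_w (1 : \bar R)) => //.
  by rewrite integral_cst//= probability_setT mule1.
rewrite mul0e adde0 I1 !mul1e add0e.
move=> H; have {}H := le_trans H f2.
rewrite -leeBrDr// -EFinB in H; apply: (le_trans H).
by rewrite lee_fin; lra.
Qed.

(** Lower deviations of the nonnegative variable Y^2 need only its second moment, by e^{-x} <= 1 - x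
    + x^2; the fourth moment of Y is at most 2 K^4 because y^2 <= 2 (e^y - 1). *)
Lemma mgf_sqr_lower (Y : T -> R) (K v l : R) : measurable_fun setT Y ->
  (0 < K)%R -> (0 <= l)%R -> \int[P]_w (Y w ^+ 2)%:E = v%:E ->
  \int[P]_w (expR (Y w ^+ 2 / K ^+ 2))%:E <= 2%:E ->
  \int[P]_w (expR (- (l * Y w ^+ 2)))%:E <=
    (expR (- (l * v) + 2 * l ^+ 2 * K ^+ 4))%:E.
Proof.
move=> mY K0 l0 EY2 EeY.
have mY2 : measurable_fun setT (fun w => Y w ^+ 2)%R by exact: measurable_funX.
have m1 : measurable_fun setT (fun w => expR (- (l * Y w ^+ 2))).
  apply: measurableT_comp => //; apply: measurableT_comp => //; exact: measurable_funM.
have m2 : measurable_fun setT (fun w => expR (Y w ^+ 2 / K ^+ 2)).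
  by apply: measurableT_comp => //; exact: measurable_funM.
have p1 w : (0 <= Y w ^+ 2)%R by rewrite sqr_ge0.
set c := (2 * l ^+ 2 * K ^+ 4)%R.
have c0 : (0 <= c)%R by rewrite /c mulr_ge0 ?exprn_ge0 ?(ltW K0)// mulr_ge0 ?sqr_ge0.
have e0 w : (1 <= expR (Y w ^+ 2 / K ^+ 2))%R.
  by rewrite -expR0 ler_expR divr_ge0// sqr_ge0.
have e1 w : (0 <= expR (Y w ^+ 2 / K ^+ 2) - 1)%R by rewrite subr_ge0.
have m3 : measurable_fun setT (fun w => expR (Y w ^+ 2 / K ^+ 2) - 1)%R.
  exact: measurable_funB.
have := @le_integral_linear _ _ _ _ 1 l c 0 m1 mY2 m3 k0 (fun=> expR_ge0 _) p1 e1
  (fun=> lexx _) ler01 l0 c0 (lexx _).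
move=> /(_ _)/wrap[w|].
  rewrite /= mul0r addr0.
  have h1 := expRN_le (mulr_ge0 l0 (p1 w)).
  have h2 : (0 <= Y w ^+ 2 / K ^+ 2)%R by rewrite divr_ge0// sqr_ge0.
  have {h2} := sqr_le_expR h2.
  move=> /(ler_wpM2l (mulr_ge0 (sqr_ge0 l) (exprn_ge0 4 (ltW K0)))) h2.
  suff E : ((l * Y w ^+ 2) ^+ 2 = l ^+ 2 * K ^+ 4 * (Y w ^+ 2 / K ^+ 2) ^+ 2)%R.
    by move: h1; rewrite E /c; lra.
  by field; rewrite gt_eqF.
rewrite mul0e adde0 EY2 => H; rewrite -EFinM in H.
have {}H : \int[P]_w (expR (- (l * Y w ^+ 2)))%:E + (l * v)%:E <= (1 + c)%:E.
  apply: (le_trans H); rewrite EFinD leeD2l//.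
  by rewrite -[leRHS]mule1 lee_wpmul2l// integral_sub1_le1.
rewrite -leeBrDr// -EFinB in H; apply: (le_trans H).
by rewrite lee_fin (le_trans _ (expR_ge1Dx _))// addrAC addrA.
Qed.

(** Uses e^x <= 1 + x + x^2 e^{|x|}. With 2 l K <= 1, one half of the exponent |Z| / K pays for Z^2
    and the other for e^{|l Z|}. *)
Lemma mgf_bernstein (Z : T -> R) (K z l : R) : P.-integrable setT (EFin \o Z) ->
  \int[P]_w (Z w)%:E = z%:E ->
  (0 < K)%R -> (0 <= l)%R -> (2 * l * K <= 1)%R ->
  \int[P]_w (expR (`|Z w| / K))%:E <= 2%:E ->
  \int[P]_w (expR (l * Z w))%:E <= (expR (l * z + 16 * l ^+ 2 * K ^+ 2))%:E.
Proof.
move=> iZ EZ K0 l0 lK EeZ.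
have mZ : measurable_fun setT Z by apply/measurable_EFinP; case/integrableP: iZ.
(* Splitting into positive and negative parts lets the signed linear term go through
   [le_integral_linear]. *)
pose Zp w : R := Num.max (Z w) 0%R; pose Zn w : R := Num.max (- Z w)%R 0%R.
have mp : measurable_fun setT Zp by exact: measurable_maxr.
have mn : measurable_fun setT Zn by apply: measurable_maxr => //; exact: measurableT_comp.
have p0 w : (0 <= Zp w)%R by rewrite le_max lexx orbT.
have n0 w : (0 <= Zn w)%R by rewrite le_max lexx orbT.
have m1 : measurable_fun setT (fun w => expR (l * Z w)).
  by apply: measurableT_comp => //; exact: measurable_funM.
have m2 : measurable_fun setT (fun w => expR (`|Z w| / K)).
  by apply: measurableT_comp => //; apply: measurable_funM => //; exact: measurableT_comp.
have c0 : (0 <= 8 * l ^+ 2 * K ^+ 2)%R by rewrite mulr_ge0 ?sqr_ge0// mulr_ge0 ?sqr_ge0.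
have := @le_integral_linear _ _ _ _ 1 l l (8 * l ^+ 2 * K ^+ 2) m1 mn mp m2 (fun=> expR_ge0 _) n0 p0
  (fun=> expR_ge0 _) ler01 l0 l0 c0.
move=> /(_ _)/wrap[w|].
  have -> : (1 + l * Zp w = 1 + l * Z w + l * Zn w)%R.
    rewrite -addrA -mulrDr; congr (_ + _ * _)%R.
    by rewrite /Zp /Zn; case: (leP (Z w) 0%R); case: (leP (- Z w)%R 0%R) => *; lra.
  rewrite addrAC lerD2r; apply: (le_trans (expR_le_taylor2 _)).
  rewrite lerD2l.
  set s := (`|Z w| / (2 * K))%R.
  have s0 : (0 <= s)%R by rewrite divr_ge0// mulr_ge0// ltW.
  have h1 : (Z w ^+ 2 <= 8 * K ^+ 2 * expR s)%R.
    have -> : (Z w ^+ 2 = 4 * K ^+ 2 * s ^+ 2)%R.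
      by rewrite -(real_normK (num_real (Z w))) /s; field; rewrite gt_eqF.
    have := sqr_le_expR s0; move=> /(ler_wpM2l (mulr_ge0 (ler0n R 4) (sqr_ge0 K))).
    move=> /le_trans; apply; have := sqr_ge0 K; lra.
  have -> : (expR (`|Z w| / K) = expR s * expR s)%R.
    by rewrite -expRD; congr expR; rewrite /s; field; rewrite gt_eqF.
  have h2 : (expR `|l * Z w| <= expR s)%R.
    rewrite ler_expR normrM (ger0_norm l0) /s ler_pdivlMr ?mulr_gt0//.
    have := ler_wpM2r (normr_ge0 (Z w)) lK; lra.
  have h3 : ((l * Z w) ^+ 2 <= l ^+ 2 * (8 * K ^+ 2 * expR s))%R.
    by rewrite exprMn ler_wpM2l ?sqr_ge0.
  apply: (le_trans (ler_pM (sqr_ge0 _) (expR_ge0 _) h3 h2)).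
  by rewrite le_eqVlt; apply/orP; left; apply/eqP; ring.
have Ep : \int[P]_w (Zp w)%:E \is a fin_num.
  have := integrable_pos_fin_num measurableT iZ.
  by congr (_ \is a fin_num); apply: eq_integral => w _; rewrite funeposE -EFin_max.
have En : \int[P]_w (Zn w)%:E \is a fin_num.
  have := integrable_neg_fin_num measurableT iZ.
  by congr (_ \is a fin_num); apply: eq_integral => w _; rewrite funenegE -EFin_max.
have Ez : \int[P]_w (Zp w)%:E - \int[P]_w (Zn w)%:E = z%:E.
  rewrite -EZ [RHS]integralE; congr (_ - _); apply: eq_integral => w _.
    by rewrite funeposE -EFin_max.
  by rewrite funenegE -EFin_max.
have EZp := fineK Ep; have EZn := fineK En.
move: Ez => /(congr1 fine); rewrite -EZp -EZn -EFinB /= => Ez.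
rewrite -EZp -EZn -!EFinM => H.
have {}H : \int[P]_w (expR (l * Z w))%:E + (l * fine (\int[P]_w (Zn w)%:E))%:E <=
   (1 + l * fine (\int[P]_w (Zp w)%:E) + 8 * l ^+ 2 * K ^+ 2 * 2)%:E.
  by apply: (le_trans H); rewrite !EFinD leeD2l// [leRHS]EFinM lee_wpmul2l.
rewrite -leeBrDr// -EFinB in H; apply: (le_trans H).
by rewrite lee_fin (le_trans _ (expR_ge1Dx _))// -Ez; lra.
Qed.

(* The exponent is cut at xi^2 = 8 V^2 L: below the cut e^x <= 1 + 2 x, above it
   a factor e^{-4 L} = (s / V)^4 is gained; this is why the logarithm of V / s
   enters the noise level. *)
Lemma mgf_sqr_upper (xi : T -> R) (V s L : R) : measurable_fun setT xi ->
  (0 < V)%R -> (0 < s)%R -> L = ln (V / s) -> (8^-1 <= L)%R ->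
  \int[P]_w (xi w ^+ 2)%:E = (s ^+ 2)%:E ->
  \int[P]_w (expR (xi w ^+ 2 / V ^+ 2))%:E <= 2%:E ->
  \int[P]_w (expR (xi w ^+ 2 / (16 * V ^+ 2 * L)))%:E <=
    (expR (18 * s ^+ 2 / (16 * V ^+ 2 * L)))%:E.
Proof.
move=> mxi V0 s0 LE L8 Exi Ee.
have L0 : (0 < L)%R by rewrite (lt_le_trans _ L8)// invr_gt0.
set l := (16 * V ^+ 2 * L)^-1%R.
have l0 : (0 < l)%R by rewrite invr_gt0 !mulr_gt0// exprn_gt0.
have mx2 : measurable_fun setT (fun w => xi w ^+ 2)%R by exact: measurable_funX.
have m1 : measurable_fun setT (fun w => expR (xi w ^+ 2 * l)).
  by apply: measurableT_comp => //; exact: measurable_funM.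
have m2 : measurable_fun setT (fun w => expR (xi w ^+ 2 / V ^+ 2)).
  by apply: measurableT_comp => //; exact: measurable_funM.
have p1 w : (0 <= xi w ^+ 2)%R by rewrite sqr_ge0.
have := @le_integral_linear _ _ _ _ 1 0 (2 * l) (expR (- (4 * L))) m1 k0 mx2 m2 (fun=> expR_ge0 _)
  (fun=> lexx _) p1 (fun=> expR_ge0 _) ler01 (lexx _) (mulr_ge0 (ler0n _ 2) (ltW l0)) (expR_ge0 _).
move=> /(_ _)/wrap[w|].
  rewrite /= mul0r addr0; have [h|h] := leP (xi w ^+ 2 * l)%R (2^-1)%R.
    have : (expR (xi w ^+ 2 * l) <= 1 + 2 * (xi w ^+ 2 * l))%R.
      by apply: expR_le_inv1B; rewrite h mulr_ge0// ltW.
    have : (0 <= expR (- (4 * L)) * expR (xi w ^+ 2 / V ^+ 2))%R.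
      by rewrite mulr_ge0// expR_ge0.
    lra.
  have : (expR (xi w ^+ 2 * l) <= expR (- (4 * L)) * expR (xi w ^+ 2 / V ^+ 2))%R.
    rewrite -expRD ler_expR.
    have V2 : (0 < V ^+ 2)%R by rewrite exprn_gt0.
    set x := (xi w ^+ 2 / V ^+ 2)%R.
    have E : (xi w ^+ 2 * l = x / (16 * L))%R.
      by rewrite /x /l; field; rewrite !gt_eqF.
    move: h; rewrite E ltr_pdivlMr ?mulr_gt0// => h.
    rewrite ler_pdivrMr ?mulr_gt0//.
    (* For x >= 8 L the goal x <= 16 L (x - 4 L) follows once 64 L^2 >= 8 L: here [8^-1 <= L] is
       used. *)
    have : (0 <= (16 * L - 1) * (x - 8 * L))%R by rewrite mulr_ge0//; lra.
    nra.
  have : (0 <= 2 * l * xi w ^+ 2)%R by rewrite mulr_ge0// mulr_ge0// ltW.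
  lra.
rewrite mul0e adde0 Exi => /le_trans; apply.
have : (1 + (2 * l)%:E * (s ^+ 2)%:E + (expR (- (4 * L)))%:E * \int[P]_w (expR (xi w ^+ 2 / V ^+ 2))%:E
   <= (1 + 2 * l * s ^+ 2 + expR (- (4 * L)) * 2)%:E).
  by rewrite !EFinD -EFinM leeD2l// [leRHS]EFinM lee_wpmul2l// lee_fin expR_ge0.
move=> /le_trans; apply; rewrite lee_fin (le_trans _ (expR_ge1Dx _))//.
rewrite -addrA lerD2l.
suff : (expR (- (4 * L)) <= 8 * (l * s ^+ 2))%R by rewrite -mulrA; lra.
have EL : (expR (- L) = s / V)%R.
  by rewrite LE expRN lnK ?posrE ?divr_gt0// invf_div.
(* Of the factor (s / V)^4, one half is kept as (s / V)^2; the other half, e^{-2 L}, is at most 1 /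
   (2 L) and supplies the denominator L. *)
have -> : (expR (- (4 * L)) = (s / V) ^+ 2 * expR (- (2 * L)))%R.
  by rewrite -EL expr2 -!expRD; congr expR; lra.
have h1 : (2 * L * expR (- (2 * L)) <= 1)%R.
  rewrite expRN ler_pdivrMr ?expR_gt0// mul1r.
  by apply: le_trans (expR_ge1Dx _); lra.
have -> : (8 * (l * s ^+ 2) = (s / V) ^+ 2 * (2 * L)^-1)%R.
  by rewrite /l; field; rewrite !gt_eqF.
rewrite ler_wpM2l ?sqr_ge0//.
by rewrite -[leRHS]mul1r ler_pdivlMr ?mulr_gt0// mulrC.
Qed.

End Mgf.

Section Tail.
Local Open Scope ereal_scope.
Context d (T : measurableType d) (R : realType) (P : probability T R).

Lemma union_bound (I : finType) (B : I -> set T) (p : R) :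
  (forall i, measurable (B i)) -> (forall i, P (B i) <= p%:E) ->
  P (\bigcup_i B i) <= (#|I|%:R * p)%:E.
Proof.
move=> mB PB.
have -> : \bigcup_i B i = \big[setU/set0]_(i <- enum I) B i.
  rewrite -bigcup_seq; apply: eq_bigcupl; split => // i _ /=.
  by rewrite mem_enum.
rewrite cardE; elim: (enum I) => [|i s IH]; first by rewrite big_nil measure0 mul0r.
rewrite big_cons /=; apply: (le_trans (measureU2 _ _ _)) => //.
  exact: bigsetU_measurable.
by rewrite -[(size s).+1%:R]natr1 mulrDl mul1r EFinD [leRHS]addeC; apply: leeD; [exact: PB|exact: IH].
Qed.

Section Chernoff.
Context d1 d2 (E1 : measurableType d1) (E2 : measurableType d2).
Variables (n : nat) (U : 'I_n -> {RV P >-> E1}) (V : 'I_n -> {RV P >-> E2}).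
Hypothesis indep : mutually_independent P (fun k : 'I_n + 'I_n =>
  match k with inl i => sigma_of (U i) | inr i => sigma_of (V i) end).

Lemma measurable_sum_gt (f : E1 * E2 -> R) (a : R) : measurable_fun setT f ->
  measurable [set w | (a < \sum_j f (U j w, V j w))%R].
Proof.
move=> mf; rewrite -[X in measurable X]setTI.
have mfj j : measurable_fun setT (fun w => f (U j w, V j w)).
  by apply: measurableT_comp => //; exact: measurable_fun_pair.
have m1 : measurable_fun setT (fun w => \sum_j f (U j w, V j w))%R.
  exact: measurable_sum.
by have := measurable_fun_ltr (measurable_cst a) m1 => /(_ measurableT [set true] I).
Qed.

Lemma chernoff_sum (f : E1 * E2 -> R) (k u : R) : measurable_fun setT f ->
  (forall j, \int[P]_w (expR (f (U j w, V j w)))%:E <= (expR k)%:E) ->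
  P [set w | (n%:R * k + u < \sum_j f (U j w, V j w))%R] <= (expR (- u))%:E.
Proof.
move=> mf Hk.
set A := [set w | _]; set a := (n%:R * k + u)%R.
have mfj j : measurable_fun setT (fun w => f (U j w, V j w)).
  by apply: measurableT_comp => //; exact: measurable_fun_pair.
have mA : measurable A.
  exact: measurable_sum_gt.
have EA : \int[P]_w (expR (\sum_j f (U j w, V j w)))%:E <= (expR (n%:R * k))%:E.
  under eq_integral do rewrite expR_sum.
  rewrite (integral_prod_indep indep (phi := fun=> expR \o f)).
  - apply: (@le_trans _ _ (\prod_(j < n) (expR k)%:E)).
      suff /andP[] : 0 <= \prod_(j < n) \int[P]_w (expR (f (U j w, V j w)))%:E
          <= \prod_(j < n) (expR k)%:E by [].
      elim/big_rec2: _ => [|j y1 y2 _ /andP[y20 y21]]; first by rewrite lee01/=.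
      have I0 : 0 <= \int[P]_w (expR (f (U j w, V j w)))%:E.
        by apply: integral_ge0 => w _; rewrite lee_fin expR_ge0.
      by rewrite mule_ge0//= lee_pmul.
    by rewrite prodEFin prodr_const card_ord expRM_natl.
  - by move=> _; exact: measurableT_comp.
  - by move=> _ x; exact: expR_ge0.
  - by move=> j; rewrite (le_lt_trans (Hk j))// ltry.
have mS : measurable_fun setT (fun w => expR (\sum_j f (U j w, V j w)))%R.
  by apply: measurableT_comp => //; exact: measurable_sum.
have : (expR a)%:E * P A <= (expR (n%:R * k))%:E.
  apply: le_trans EA; rewrite -(setIT A) -integral_indic// -ge0_integralZl_EFin ?expR_ge0//.
    have pl w : [set: T] w -> 0 <= (expR a)%:E * (\1_A w)%:E.
      by rewrite mule_ge0// lee_fin expR_ge0.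
    have ml : measurable_fun setT (fun w => (expR a)%:E * (\1_A w)%:E).
      by apply: measurable_funeM; apply/measurable_EFinP.
    have mr : measurable_fun setT (fun w => (expR (\sum_j f (U j w, V j w)))%:E).
      exact/measurable_EFinP.
    apply: ge0_le_integral => // w _; rewrite indicE.
    case: (boolP (w \in A)) => [|_].
      by rewrite inE /A /= mule1 lee_fin ler_expR => /ltW.
    by rewrite mule0 lee_fin expR_ge0.
  exact/measurable_EFinP.
rewrite muleC -lee_pdivlMr ?expR_gt0// => /le_trans; apply.
by rewrite -EFinM lee_fin -expRN -expRD ler_expR /a; lra.
Qed.
End Chernoff.
End Tail.

(** * Spectral calculus and relative entropy *)

Section ComplexRe.
Variable R : realType.
Implicit Types (z w : R[i]) (a : R).

Lemma ReD z w : complex.Re (z + w) = complex.Re z + complex.Re w.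
Proof. by case: z; case: w. Qed.

Lemma ImD z w : complex.Im (z + w) = complex.Im z + complex.Im w.
Proof. by case: z; case: w. Qed.

Lemma ReN z : complex.Re (- z) = - complex.Re z.
Proof. by case: z. Qed.

Lemma ReB z w : complex.Re (z - w) = complex.Re z - complex.Re w.
Proof. by rewrite ReD ReN. Qed.

Lemma Re0 : complex.Re (0 : R[i]) = 0.
Proof. by []. Qed.

Lemma Re_sum (I : Type) (s : seq I) (Q : pred I) (F : I -> R[i]) :
  complex.Re (\sum_(i <- s | Q i) F i) = \sum_(i <- s | Q i) complex.Re (F i).
Proof. by elim/big_rec2: _ => [//|i y x _ <-]; rewrite ReD. Qed.

Lemma ReZ a z : complex.Re (a%:C%C * z) = a * complex.Re z.
Proof. by case: z => x y /=; rewrite mul0r subr0. Qed.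

Lemma ReC a : complex.Re (a%:C%C) = a.
Proof. by []. Qed.

Lemma conj_conjc z : Num.conj z = conjc z.
Proof. by []. Qed.

Lemma conj_real a : Num.conj (a%:C%C) = a%:C%C :> R[i].
Proof. by rewrite conj_conjc; apply/eqP; rewrite eq_complex /= oppr0 !eqxx. Qed.

Definition sqnormc z : R := complex.Re z ^+ 2 + complex.Im z ^+ 2.

Lemma sqnormc_ge0 z : 0 <= sqnormc z.
Proof. by rewrite addr_ge0 ?sqr_ge0. Qed.

Lemma mul_conj_sqnormc z : z * Num.conj z = (sqnormc z)%:C%C.
Proof.
rewrite conj_conjc /sqnormc; case: z => x y; apply/eqP; rewrite eq_complex /=.
by apply/andP; split; apply/eqP; ring.
Qed.

Lemma sqnormc_conj z : sqnormc (Num.conj z) = sqnormc z.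
Proof. by rewrite conj_conjc /sqnormc; case: z => x y /=; rewrite sqrrN. Qed.

End ComplexRe.

Lemma mxtrace_cycle (K : comPzRingType) n (U D U' V E V' : 'M[K]_n) :
  \tr (U' *m D *m U *m (V' *m E *m V)) =
  \tr (D *m (U *m V') *m (E *m (V *m U'))).
Proof. by rewrite -!mulmxA mxtrace_mulC !mulmxA. Qed.

Lemma mulmx_conjD (K : pzRingType) n (U D E U' : 'M[K]_n) :
  U' *m D *m U + U' *m E *m U = U' *m (D + E) *m U.
Proof. by rewrite -mulmxDl -mulmxDr. Qed.

Lemma mulmx_conjN (K : pzRingType) n (U D U' : 'M[K]_n) :
  - (U' *m D *m U) = U' *m (- D) *m U.
Proof. by rewrite mulmxN mulNmx. Qed.

Lemma mulmx_conjM (K : pzRingType) n (U D E U' : 'M[K]_n) : U *m U' = 1%:M ->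
  (U' *m D *m U) *m (U' *m E *m U) = U' *m (D *m E) *m U.
Proof. by move=> UU; rewrite -!mulmxA (mulmxA U U') UU mul1mx. Qed.

Lemma mxtraceB (K : pzRingType) n (A B : 'M[K]_n) : \tr (A - B) = \tr A - \tr B.
Proof. exact: raddfB. Qed.

Lemma Re_tr_mulBB (R : realType) n (A B C D : 'M[R[i]]_n) :
  complex.Re (\tr ((A - B) *m (C - D))) =
  complex.Re (\tr (A *m C)) - complex.Re (\tr (A *m D)) -
  complex.Re (\tr (C *m B)) + complex.Re (\tr (B *m D)).
Proof.
rewrite [\tr (C *m B)]mxtrace_mulC mulmxBl !mulmxBr !mxtraceB !ReB.
by ring.
Qed.

Lemma mulmx_conjZ (K : comPzRingType) n (a : K) (U D U' : 'M[K]_n) :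
  a *: (U' *m D *m U) = U' *m (a *: D) *m U.
Proof. by rewrite -scalemxAr scalemxAl. Qed.

Lemma trmxC_scale (R : realType) n (a : R) (A : 'M[R[i]]_n) :
  (a%:C%C *: A)^t* = a%:C%C *: A^t*.
Proof. by apply/matrixP => i j; rewrite !mxE rmorphM /= conj_real. Qed.

Lemma trmxCD (R : realType) n (A B : 'M[R[i]]_n) : (A + B)^t* = A^t* + B^t*.
Proof. by rewrite linearD /= map_mxD. Qed.

Lemma trmxCB (R : realType) n (A B : 'M[R[i]]_n) : (A - B)^t* = A^t* - B^t*.
Proof. by rewrite linearB /= map_mxB. Qed.

Lemma trmxCM (R : realType) n (A B : 'M[R[i]]_n) : (A *m B)^t* = B^t* *m A^t*.
Proof. by rewrite trmx_mul map_mxM. Qed.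

#[local] Opaque spectralmx spectral_diag.

Section Spectral.
Variables (R : realType) (m : nat).
Implicit Types (A B S M : 'M[R[i]]_m) (f g h k : R -> R).

Definition evals A (i : 'I_m) : R := complex.Re (spectral_diag A 0 i).

(** Squared moduli of the scalar products between the eigenvectors of [A] and those of [B], a doubly
    stochastic matrix. *)
Definition overlap A B (i j : 'I_m) : R :=
  sqnormc ((spectralmx A *m (spectralmx B)^t*) i j).

Lemma overlap_ge0 A B i j : 0 <= overlap A B i j.
Proof. exact: sqnormc_ge0. Qed.

Let diagf f A := diag_mx (\row_i (f (evals A i))%:C%C : 'rV[R[i]]_m).

Lemma mxfunE f A :
  mxfun f A = (spectralmx A)^t* *m diagf f A *m spectralmx A.
Proof.
rewrite /mxfun (invmx_unitary (spectral_unitarymx A)) /diagf.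
have -> : map_mx (fun z : R[i] => (f (complex.Re z))%:C%C) (spectral_diag A) =
    \row_i (f (evals A i))%:C%C by apply/rowP => i; rewrite !mxE.
by [].
Qed.

Lemma unitary_sqnormc_row n (U : 'M[R[i]]_n) : U \is unitarymx ->
  forall i, \sum_j sqnormc (U i j) = 1.
Proof.
move=> /unitarymxP UU i; have /(congr1 (fun M : 'M[R[i]]_n => complex.Re (M i i))) := UU.
rewrite [X in _ = complex.Re X -> _]mxE eqxx => E.
transitivity (complex.Re (true%:R : R[i])) => //; rewrite -E mxE Re_sum.
by apply: eq_bigr => j _; rewrite !mxE mul_conj_sqnormc.
Qed.

Let overlap_unitary A B : (spectralmx A *m (spectralmx B)^t*) \is unitarymx.
Proof. by rewrite mul_unitarymx ?trmxC_unitary ?spectral_unitarymx. Qed.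

Lemma sum_overlapl A B i : \sum_j overlap A B i j = 1.
Proof. exact: unitary_sqnormc_row. Qed.

Lemma sum_overlapr A B j : \sum_i overlap A B i j = 1.
Proof.
rewrite -(unitary_sqnormc_row (overlap_unitary B A) j); apply: eq_bigr => i _.
rewrite /overlap.
have -> : spectralmx B *m (spectralmx A)^t* = ((spectralmx A *m (spectralmx B)^t*))^t*.
  by rewrite trmx_mul map_mxM trmxCK.
by rewrite [in RHS]mxE [in RHS]mxE sqnormc_conj.
Qed.

Lemma tr_mxfunM f g A B :
  complex.Re (\tr (mxfun f A *m mxfun g B)) =
  \sum_i \sum_j overlap A B i j * (f (evals A i) * g (evals B j)).
Proof.
set W := spectralmx A *m (spectralmx B)^t*.
have -> : \tr (mxfun f A *m mxfun g B) = \tr (diagf f A *m W *m (diagf g B *m W^t*)).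
  have -> : W^t* = spectralmx B *m (spectralmx A)^t*.
    by rewrite trmx_mul map_mxM trmxCK.
  by rewrite !mxfunE; exact: mxtrace_cycle.
rewrite /mxtrace Re_sum; apply: eq_bigr => i _.
rewrite mxE Re_sum; apply: eq_bigr => j _.
rewrite mul_diag_mx mul_diag_mx !mxE.
set z := (X in _ * X * (_ * Num.conj X)); rewrite /overlap.
have -> : (spectralmx A *m (spectralmx B)^t*) i j = z by rewrite mxE.
rewrite mulrACA mul_conj_sqnormc -!rmorphM ReC; ring.
Qed.

Lemma hermsymmxP A : reflect (A^t* = A) (A \is hermsymmx).
Proof.
apply: (iffP (is_hermitianmxP _ _ _)); rewrite expr0 scale1r => E; exact: esym.
Qed.

Lemma mxfunD f g A : mxfun f A + mxfun g A = mxfun (fun x => f x + g x) A.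
Proof.
rewrite !mxfunE mulmx_conjD.
have -> : diagf f A + diagf g A = diagf (fun x => f x + g x) A; last by [].
apply/matrixP => i j; rewrite !mxE -mulrnDl; congr (_ *+ _).
by rewrite -rmorphD.
Qed.

Lemma mxfunN f A : - mxfun f A = mxfun (fun x => - f x) A.
Proof.
rewrite !mxfunE mulmx_conjN.
have -> : - diagf f A = diagf (fun x => - f x) A; last by [].
by apply/matrixP => i j; rewrite !mxE -mulNrn -rmorphN.
Qed.

Lemma mxfunZ (a : R) f A : a%:C%C *: mxfun f A = mxfun (fun x => a * f x) A.
Proof.
rewrite !mxfunE mulmx_conjZ.
have -> : a%:C%C *: diagf f A = diagf (fun x => a * f x) A; last by [].
by apply/matrixP => i j; rewrite !mxE mulrnAr -rmorphM.
Qed.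

Lemma mxfunM f g A : mxfun f A *m mxfun g A = mxfun (fun x => f x * g x) A.
Proof.
rewrite !mxfunE (mulmx_conjM _ _ (unitarymxP (spectral_unitarymx A))).
have -> : diagf f A *m diagf g A = diagf (fun x => f x * g x) A; last by [].
rewrite mulmx_diag; congr diag_mx.
by apply/rowP => i; rewrite !mxE -rmorphM.
Qed.

Lemma mxfun_trmxC f A : (mxfun f A)^t* = mxfun f A.
Proof.
have hD : (diagf f A)^t* = diagf f A.
  rewrite /diagf tr_diag_mx map_diag_mx; congr diag_mx.
  by apply/rowP => i; rewrite !mxE; exact: conj_real.
by rewrite mxfunE !trmx_mul !map_mxM trmxCK hD mulmxA.
Qed.

Lemma mxfun1 A : mxfun (fun=> 1) A = 1%:M.
Proof.
rewrite mxfunE; have -> : diagf (fun=> 1) A = 1%:M.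
  by apply/matrixP => i j; rewrite !mxE.
rewrite mulmx1; have := spectral_unitarymx A; rewrite -trmxC_unitary.
by move=> /unitarymxP; rewrite trmxCK.
Qed.

Lemma mxfun_id A : A \is hermsymmx -> mxfun id A = A.
Proof.
move=> hA; have /hermitian_normalmx /orthomx_spectralP E := hA.
rewrite [RHS]E /mxfun.
have -> : map_mx (fun z : R[i] => (id (complex.Re z))%:C%C) (spectral_diag A) = spectral_diag A.
  apply/rowP => i; rewrite mxE RRe_real//.
  by have /mxOverP := hermitian_spectral_diag_real hA; apply.
by [].
Qed.

#[local] Opaque mxfun.

Lemma eq_mxfun f g A : (forall i, f (evals A i) = g (evals A i)) ->
  mxfun f A = mxfun g A.
Proof.
move=> fg; rewrite !mxfunE.
have -> : diagf f A = diagf g A; last by [].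
by congr diag_mx; apply/rowP => i; rewrite !mxE fg.
Qed.

Lemma sum_overlap_l (u : 'I_m -> R) A B :
  \sum_i \sum_j overlap A B i j * u i = \sum_i u i.
Proof. by apply: eq_bigr => i _; rewrite -mulr_suml sum_overlapl mul1r. Qed.

Lemma sum_overlap_r (u : 'I_m -> R) A B :
  \sum_i \sum_j overlap A B i j * u j = \sum_j u j.
Proof.
rewrite exchange_big /=; apply: eq_bigr => j _.
by rewrite -mulr_suml sum_overlapr mul1r.
Qed.

Lemma tr_mxfun f A : complex.Re (\tr (mxfun f A)) = \sum_i f (evals A i).
Proof.
rewrite -[mxfun f A]mulmx1 -(mxfun1 A) tr_mxfunM.
under eq_bigr do under eq_bigr do rewrite mulr1.
exact: (sum_overlap_l (fun i => f (evals A i))).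
Qed.

(** The weights are nonnegative, so a scalar inequality between eigenvalues becomes a trace
    inequality although [A] and [B] need not commute. *)
Lemma tr_mxfun_diff f g h k A B :
  complex.Re (\tr ((mxfun f A - mxfun g B) *m (mxfun h A - mxfun k B))) =
  \sum_i \sum_j overlap A B i j *
    ((f (evals A i) - g (evals B j)) * (h (evals A i) - k (evals B j))).
Proof.
pose u i j := overlap A B i j.
transitivity (\sum_i \sum_j u i j * (f (evals A i) * h (evals A i)) -
  \sum_i \sum_j u i j * (f (evals A i) * k (evals B j)) -
  \sum_i \sum_j u i j * (h (evals A i) * g (evals B j)) +
  \sum_i \sum_j u i j * (g (evals B j) * k (evals B j))).
  rewrite Re_tr_mulBB; congr (_ - _ - _ + _).
  - rewrite mxfunM tr_mxfun; exact/esym/sum_overlap_l.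
  - exact: tr_mxfunM.
  - exact: tr_mxfunM.
  - rewrite mxfunM tr_mxfun.
    exact/esym/(sum_overlap_r (fun j => g (evals B j) * k (evals B j))).
rewrite -!sumrB -big_split; apply: eq_bigr => i _ /=.
by rewrite -!sumrB -big_split; apply: eq_bigr => j _ /=; rewrite /u; ring.
Qed.

Definition sqfrob M : R := \sum_i \sum_j sqnormc (M i j).

Lemma sqfrob_ge0 M : 0 <= sqfrob M.
Proof. by apply: sumr_ge0 => i _; apply: sumr_ge0 => j _; exact: sqnormc_ge0. Qed.

Lemma sqfrobE M : sqfrob M = complex.Re (\tr (M *m M^t*)).
Proof.
rewrite /mxtrace Re_sum; apply: eq_bigr => i _; rewrite mxE Re_sum.
by apply: eq_bigr => j _; rewrite !mxE mul_conj_sqnormc.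
Qed.

Lemma sqfrob_eq0 M : sqfrob M = 0 -> M = 0.
Proof.
move/eqP; rewrite psumr_eq0 => [/allP H|i _]; last first.
  by apply: sumr_ge0 => j _; exact: sqnormc_ge0.
apply/matrixP => i j; have := H i (mem_index_enum _).
rewrite psumr_eq0 => [/allP /(_ j (mem_index_enum _))|k _]; last exact: sqnormc_ge0.
rewrite /sqnormc paddr_eq0 ?sqr_ge0// !sqrf_eq0 mxE => /andP[/eqP x0 /eqP y0].
by apply/eqP; rewrite eq_complex x0 y0 !eqxx.
Qed.

(** The chosen diagonalizations of [A] and [S] may differ. But A - g(S) = 0 forces the overlap of
    two eigenvectors to vanish unless the eigenvalue of [A] is the image under [g] of that of [S],
    and then f(A) - (f o g)(S) has Frobenius norm 0. *)
Lemma mxfun_comp f g A S : A \is hermsymmx -> A = mxfun g S ->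
  mxfun f A = mxfun (f \o g) S.
Proof.
move=> hA AE; have Z : A - mxfun g S = 0 by rewrite -AE subrr.
have H (i j : 'I_m) : overlap A S i j * (evals A i - g (evals S j)) ^+ 2 = 0.
  have := tr_mxfun_diff id g id g A S; rewrite mxfun_id// Z mulmx0 mxtrace0 Re0.
  move/esym/eqP; rewrite psumr_eq0 => [/allP /(_ i (mem_index_enum _))|i' _]; last first.
    by apply: sumr_ge0 => j' _; rewrite mulr_ge0 ?overlap_ge0// -expr2 sqr_ge0.
  rewrite psumr_eq0 => [/allP /(_ j (mem_index_enum _))/eqP//|j' _].
  by rewrite mulr_ge0 ?overlap_ge0// -expr2 sqr_ge0.
apply/eqP; rewrite -subr_eq0; apply/eqP/sqfrob_eq0; rewrite sqfrobE.
have -> : (mxfun f A - mxfun (f \o g) S)^t* = mxfun f A - mxfun (f \o g) S.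
  by rewrite trmxCB; congr (_ - _); exact: mxfun_trmxC.
rewrite tr_mxfun_diff big1// => i _; rewrite big1// => j _.
have /eqP := H i j; rewrite mulf_eq0 => /orP[/eqP ->|]; first by rewrite mul0r.
by rewrite sqrf_eq0 subr_eq0 /= => /eqP ->; rewrite subrr mul0r mulr0.
Qed.

Lemma psdmx_evals S i : S \is hermsymmx -> psdmx S -> 0 <= evals S i.
Proof.
move=> hS /(_ ((row i (spectralmx S))^t*)); rewrite trmxCK => H.
suff -> : evals S i = complex.Re ((row i (spectralmx S) *m S *m (row i (spectralmx S))^t*) 0 0).
  by move: H; rewrite lecE => /andP[].
have -> : (row i (spectralmx S) *m S *m (row i (spectralmx S))^t*) 0 0 =
    (spectralmx S *m S *m (spectralmx S)^t*) i i.
  by rewrite -row_mul !mxE; apply: eq_bigr => j _; rewrite !mxE.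
have UU := unitarymxP (spectral_unitarymx S).
rewrite -[X in _ *m X *m _](mxfun_id hS) mxfunE !mulmxA UU mul1mx -mulmxA UU mulmx1.
by rewrite !mxE eqxx.
Qed.

Lemma negentropyE S : S \is hermsymmx ->
  negentropy S = \sum_i evals S i * ln (evals S i).
Proof.
by move=> hS; rewrite /negentropy -{1}(mxfun_id hS) mxfunM tr_mxfun.
Qed.

Lemma tr_evals S : S \is hermsymmx -> complex.Re (\tr S) = \sum_i evals S i.
Proof. by move=> hS; rewrite -{1}(mxfun_id hS) tr_mxfun. Qed.

Lemma mxfun0 A : mxfun (fun=> 0) A = 0.
Proof.
rewrite mxfunE; have -> : diagf (fun=> 0) A = 0.
  by apply/matrixP => i j; rewrite !mxE mul0rn.
by rewrite mulmx0 mul0mx.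
Qed.

Lemma ln_le_subr1 (x : R) : 0 < x -> ln x <= x - 1.
Proof.
move=> x0; have := @le_ln1Dx R (x - 1).
by rewrite (_ : 1 + (x - 1) = x); [apply; lra|ring].
Qed.

(** The left side minus (a - b) ln b is a ln (a / b), and ln (a / b) <= a / b - 1 gives exactly the
    remaining terms. *)
Lemma xlnx_le (a b : R) : 0 <= a -> 0 < b ->
  a * ln a - b * ln b <= (a - b) * ln b + (a - b) + (a - b) ^+ 2 / b.
Proof.
move=> a0 b0; have [->|aN0] := eqVneq a 0.
  rewrite mul0r !sub0r sqrrN expr2 mulfK ?gt_eqF//; lra.
have ap : 0 < a by rewrite lt_neqAle eq_sym aN0.
have : ln (a / b) <= a / b - 1.
  by apply: ln_le_subr1; rewrite divr_gt0.
rewrite ln_div ?posrE// => /(ler_wpM2l a0) H.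
have E : (a - b) ^+ 2 / b = a * (a / b - 1) - (a - b).
  by field; rewrite gt_eqF.
rewrite E; lra.
Qed.

(** Stands in for differentiating the matrix entropy: at a positive definite [B] its expansion holds
    from above with an explicit quadratic error, [c] being a lower bound of the spectrum of [B]. *)
Lemma negentropy_le A B (c : R) : A \is hermsymmx -> B \is hermsymmx ->
  (forall i, 0 <= evals A i) -> 0 < c -> (forall j, c <= evals B j) ->
  negentropy A - negentropy B <= complex.Re (\tr ((A - B) *m mxlog B)) +
    complex.Re (\tr (A - B)) + c^-1 * complex.Re (\tr ((A - B) *m (A - B))).
Proof.
move=> hA hB a0 c0 cB.
have E1 : complex.Re (\tr ((A - B) *m mxlog B)) =
    \sum_i \sum_j overlap A B i j * ((evals A i - evals B j) * ln (evals B j)).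
  have := tr_mxfun_diff id id (fun=> 0) (fun x => - ln x) A B.
  rewrite mxfun0 sub0r !mxfun_id// [- mxfun _ B]mxfunN /mxlog.
  rewrite (@eq_mxfun (fun x => - - ln x) (@ln R)) => [->|i]; last by rewrite opprK.
  by apply: eq_bigr => i _; apply: eq_bigr => j _; rewrite sub0r opprK.
have E2 := tr_mxfun_diff id id id id A B; rewrite !mxfun_id// in E2.
rewrite E1 E2 mxtraceB ReB !tr_evals// !negentropyE//.
rewrite -(sum_overlap_l (fun i => evals A i * ln (evals A i)) A B).
rewrite -(sum_overlap_r (fun j => evals B j * ln (evals B j)) A B).
rewrite -(sum_overlap_l (evals A) A B) -(sum_overlap_r (evals B) A B).
rewrite mulr_sumr -!sumrB -!big_split /=; apply: ler_sum => i _.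
rewrite mulr_sumr -!sumrB -!big_split /=; apply: ler_sum => j _.
rewrite [c^-1 * _]mulrCA -!mulrBr -!mulrDr ler_wpM2l ?overlap_ge0//.
apply: (le_trans (xlnx_le (a0 i) (lt_le_trans c0 (cB j)))).
rewrite lerD2l -expr2 [c^-1 * _]mulrC ler_wpM2l ?sqr_ge0//.
by rewrite lef_pV2 ?posrE// (lt_le_trans c0).
Qed.

(** For a = u^2, b = v^2 and u >= v it follows from ln u - ln v >= 1 - v / u. Its matrix form says
    that the symmetrized relative entropy dominates a squared Hellinger distance. *)
Lemma sqrt_sub_sqr_le (a b : R) : 0 < a -> 0 < b ->
  2 * (Num.sqrt a - Num.sqrt b) ^+ 2 <= (a - b) * (ln a - ln b).
Proof.
wlog ba : a b / b <= a => [hw a0 b0|a0 b0].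
  have [|/ltW ab] := leP b a; first by move=> ba; exact: hw.
  by have := hw b a ab b0 a0; rewrite -sqrrN opprB -[X in _ <= X]mulrNN !opprB.
set u := Num.sqrt a; set v := Num.sqrt b.
have u0 : 0 < u by rewrite sqrtr_gt0.
have v0 : 0 < v by rewrite sqrtr_gt0.
have vu : v <= u by rewrite ler_wsqrtr.
have aE : a = u * u by rewrite -expr2 sqr_sqrtr// ltW.
have bE : b = v * v by rewrite -expr2 sqr_sqrtr// ltW.
rewrite aE bE !lnM ?posrE//.
have : ln (v / u) <= v / u - 1.
  by apply: ln_le_subr1; rewrite divr_gt0.
rewrite ln_div ?posrE// => h.
have h1 : (u - v) / u <= ln u - ln v.
  have -> : (u - v) / u = 1 - v / u by field; rewrite gt_eqF.
  lra.
have h2 : (u * u - v * v) * ((u - v) / u) <= (u * u - v * v) * (ln u - ln v).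
  rewrite ler_wpM2l//; nra.
have h3 : (u - v) ^+ 2 <= (u * u - v * v) * ((u - v) / u).
  have -> : (u * u - v * v) * ((u - v) / u) = (u - v) ^+ 2 * ((u + v) / u).
    by field; rewrite gt_eqF.
  rewrite -[leLHS]mulr1 ler_wpM2l ?sqr_ge0// ler_pdivlMr//; lra.
lra.
Qed.

Lemma sqrt_sub_le_symKL A B : A \is hermsymmx -> B \is hermsymmx ->
  (forall i, 0 < evals A i) -> (forall i, 0 < evals B i) ->
  2 * sqfrob (mxfun Num.sqrt A - mxfun Num.sqrt B) <= symKL A B.
Proof.
move=> hA hB a0 b0.
rewrite sqfrobE.
have -> : (mxfun Num.sqrt A - mxfun Num.sqrt B)^t* = mxfun Num.sqrt A - mxfun Num.sqrt B.
  by rewrite trmxCB; congr (_ - _); exact: mxfun_trmxC.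
rewrite tr_mxfun_diff.
have := tr_mxfun_diff id id (@ln R) (@ln R) A B.
rewrite (mxfun_id hA) (mxfun_id hB) /symKL /mxlog => ->; rewrite mulr_sumr.
apply: ler_sum => i _; rewrite mulr_sumr; apply: ler_sum => j _.
by rewrite mulrCA ler_wpM2l ?overlap_ge0// -expr2 sqrt_sub_sqr_le.
Qed.

Lemma sqfrobD_le A B : sqfrob (A + B) <= 2 * sqfrob A + 2 * sqfrob B.
Proof.
rewrite !mulr_sumr -big_split /=; apply: ler_sum => i _.
rewrite !mulr_sumr -big_split /=; apply: ler_sum => j _.
rewrite mxE /sqnormc ReD ImD.
have := sqr_ge0 (complex.Re (A i j) - complex.Re (B i j)).
have := sqr_ge0 (complex.Im (A i j) - complex.Im (B i j)).
rewrite !sqrrB !sqrrD; lra.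
Qed.

Lemma sqfrob_mul_proj M Q : Q^t* = Q -> Q *m Q = Q -> sqfrob (M *m Q) <= sqfrob M.
Proof.
move=> hQ QQ.
have -> : sqfrob M = sqfrob (M *m Q) + sqfrob (M *m (1%:M - Q)).
  rewrite !sqfrobE -ReD -mxtraceD !trmxCM trmxCB trmx1 map_mx1 hQ.
  congr (complex.Re (\tr _)).
  have PP : (1%:M - Q) *m (1%:M - Q) = 1%:M - Q.
    by rewrite mulmxBl mul1mx mulmxBr mulmx1 QQ subrr subr0.
  rewrite !mulmxA -(mulmxA M Q Q) QQ -(mulmxA M (1%:M - Q) (1%:M - Q)) PP.
  by rewrite -mulmxDl -mulmxDr addrC subrK mulmx1.
by rewrite lerDl sqfrob_ge0.
Qed.

(* tr (Q A) = |sqrt A Q|_F^2, and 2 |sqrt A - sqrt B|_F^2 <= symKL A B. *)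
Lemma tr_proj_le_symKL Q A B : Q^t* = Q -> Q *m Q = Q ->
  A \is hermsymmx -> B \is hermsymmx ->
  (forall i, 0 < evals A i) -> (forall i, 0 < evals B i) ->
  complex.Re (\tr (Q *m A)) <= 2 * complex.Re (\tr (Q *m B)) + symKL A B.
Proof.
move=> hQ QQ hA hB a0 b0.
have trE S : S \is hermsymmx -> (forall i, 0 < evals S i) ->
    complex.Re (\tr (Q *m S)) = sqfrob (mxfun Num.sqrt S *m Q).
  move=> hS s0; rewrite sqfrobE trmxCM mxfun_trmxC hQ.
  have : mxfun Num.sqrt S *m mxfun Num.sqrt S = S.
    rewrite mxfunM -[RHS](mxfun_id hS); apply: eq_mxfun => i.
    by rewrite -expr2 sqr_sqrtr// ltW.
  move: (mxfun Num.sqrt S) => W WW.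
  rewrite mulmxA -(mulmxA W Q Q) QQ [\tr (W *m Q *m W)]mxtrace_mulC mulmxA WW.
  by rewrite mxtrace_mulC.
rewrite (trE A)// (trE B)//.
have := sqrt_sub_le_symKL hA hB a0 b0.
move: (mxfun Num.sqrt A) (mxfun Num.sqrt B) => W V.
have := sqfrob_mul_proj (W - V) hQ QQ.
have := sqfrobD_le ((W - V) *m Q) (V *m Q); rewrite -mulmxDl subrK; lra.
Qed.

End Spectral.

(** * Minimizers of entropy-penalized quadratic risks *)

Section Argmin.
Variables (R : realType) (m : nat).
Implicit Types (A B S : 'M[R[i]]_m).

Lemma Re_trZ (a : R) A : complex.Re (\tr (a%:C%C *: A)) = a * complex.Re (\tr A).
Proof. by rewrite mxtraceZ ReZ. Qed.

Lemma Re_tr_scaleM (a : R) A B :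
  complex.Re (\tr ((a%:C%C *: A) *m B)) = a * complex.Re (\tr (A *m B)).
Proof. by rewrite -scalemxAl Re_trZ. Qed.

Lemma Re_tr_scaleM2 (a : R) A :
  complex.Re (\tr ((a%:C%C *: A) *m (a%:C%C *: A))) = a ^+ 2 * complex.Re (\tr (A *m A)).
Proof. by rewrite Re_tr_scaleM -scalemxAr Re_trZ mulrA. Qed.

Definition mixmx (t : R) A B : 'M[R[i]]_m := A + t%:C%C *: (B - A).

Lemma mixmxE t A B : mixmx t A B = (1 - t)%:C%C *: A + t%:C%C *: B.
Proof. by rewrite /mixmx rmorphB rmorph1 scalerBr scalerBl scale1r addrA addrAC. Qed.

Lemma density_mix (t : R) A B : 0 <= t <= 1 -> density R m A -> density R m B ->
  density R m (mixmx t A B).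
Proof.
move=> /andP[t0 t1] [/hermsymmxP hA pA tA] [/hermsymmxP hB pB tB]; rewrite mixmxE; split.
- by apply/hermsymmxP; rewrite trmxCD !trmxC_scale hA hB.
- move=> v; rewrite mulmxDr mulmxDl -!scalemxAr -!scalemxAl mxE [X in X + _]mxE [X in _ + X]mxE.
  by rewrite addr_ge0// mulr_ge0 ?pA ?pB// ler0c// subr_ge0.
- by rewrite mxtraceD !mxtraceZ tA tB !mulr1 -rmorphD subrK rmorph1.
Qed.

Lemma density_evals_ge0 S i : density R m S -> 0 <= evals S i.
Proof. by case=> hS pS _; exact: psdmx_evals. Qed.

Lemma density_sum_evals S : density R m S -> \sum_i evals S i = 1.
Proof. by case=> hS _ tS; rewrite -tr_evals// tS. Qed.

Lemma density_dim_gt0 S : density R m S -> (0 < m)%N.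
Proof.
move=> /density_sum_evals; case: (m) S => // S /eqP; rewrite big_ord0.
by rewrite eq_sym oner_eq0.
Qed.

Lemma linear_quadratic_ge0 (x y : R) :
  (forall t, 0 < t <= 1 -> 0 <= t * x + t ^+ 2 * y) -> 0 <= x.
Proof.
move=> H; rewrite leNgt; apply/negP => x0.
pose t := Num.min 1 (- x / (2 * (`|y| + 1))).
have y1 : 0 < 2 * (`|y| + 1) by rewrite mulr_gt0// ltr_pwDr.
have t0 : 0 < t by rewrite lt_min ltr01/= divr_gt0// oppr_gt0.
have t1 : t <= 1 by rewrite ge_min lexx.
have := H t; rewrite t0 t1 => /(_ isT).
have -> : t * x + t ^+ 2 * y = t * (x + t * y) by ring.
rewrite pmulr_rge0// => h.
have : t * (2 * (`|y| + 1)) <= - x by rewrite -ler_pdivlMr// ge_min lexx orbT.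
have : t * y <= t * `|y| by rewrite ler_wpM2l ?ler_norm// ltW.
have := normr_ge0 y; nra.
Qed.

(** The risk is used only through its restrictions to segments, so that the empirical and the
    population problem are covered together. *)
Variables (q : 'M[R[i]]_m -> R) (eps : R).
Hypothesis eps0 : 0 < eps.
Hypothesis quadq : forall A B, exists a b : R, forall t,
  q (mixmx t A B) = q A + t * a + t ^+ 2 * b.
Let F S := q S + eps * negentropy S.

(** Mixing [S] with the multiple I / m of the identity acts on the eigenvalues alone. If one of them
    is 0, the entropy changes by a term of order t ln t, which for small t beats the changes of
    order t of everything else. *)
Lemma argmin_posdef S : is_argmin (density R m) F S -> forall i, 0 < evals S i.
Proof.
move=> [dS minS] k; rewrite lt_neqAle density_evals_ge0// andbT eq_sym.
apply/eqP => sk0; have m0 := density_dim_gt0 dS.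
have hS : S \is hermsymmx by case: dS.
have mr0 : 0 < m%:R :> R by rewrite ltr0n.
pose U : 'M[R[i]]_m := (m%:R^-1 : R)%:C%C *: 1%:M.
have dU : density R m U.
  split.
  - by apply/hermsymmxP; rewrite trmxC_scale trmx1 map_mx1.
  - move=> v; rewrite -scalemxAr mulmx1 -scalemxAl mxE mulr_ge0 ?ler0c ?invr_ge0 ?ler0n//.
    rewrite mxE sumr_ge0// => i _; rewrite !mxE mulrC mul_conj_sqnormc ler0c.
    exact: sqnormc_ge0.
  - rewrite mxtraceZ mxtrace1 -(rmorph_nat (real_complex R)) -rmorphM mulVf ?gt_eqF//.
pose g t (x : R) := (1 - t) * x + t * m%:R^-1.
have mixE t : mixmx t S U = mxfun (g t) S.
  rewrite mixmxE /U scalerA -rmorphM -{1}(mxfun_id hS) -(mxfun1 S).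
  rewrite mxfunZ mxfunZ mxfunD; apply: eq_mxfun => i.
  by rewrite mulr1.
pose phi (x : R) := x * ln x.
have negmix t : 0 <= t <= 1 ->
    negentropy (mixmx t S U) = \sum_i phi (g t (evals S i)).
  move=> t01; have [hM _ _] := density_mix t01 dS dU.
  rewrite /negentropy /mxlog (mxfun_comp _ hM (mixE t)) mixE mxfunM.
  by rewrite tr_mxfun.
(* Bound for the growth rate at each eigenvalue; a zero eigenvalue moves to t / m <= 1, where x ln x
   is nonpositive. *)
pose C i := if evals S i == 0 then 0 else
  (m%:R^-1 - evals S i) * (ln (evals S i) + 1) +
  `|(m%:R^-1 - evals S i) ^+ 2 / evals S i|.
have step t i : 0 < t <= 1 -> phi (g t (evals S i)) - phi (evals S i) <= t * C i.
  move=> /andP[t0 t1]; rewrite /C; case: eqP => [->|/eqP si0].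
    rewrite /phi /g mulr0 add0r mul0r subr0 mulr0 mulr_ge0_le0//.
      by rewrite mulr_ge0 ?invr_ge0 ?ler0n// ltW.
    apply: ln_le0; rewrite mulr_ile1 ?invr_ge0 ?ler0n ?(ltW t0)//.
    by rewrite invf_le1// ler1n.
  have sp : 0 < evals S i by rewrite lt_neqAle eq_sym si0 density_evals_ge0.
  have g0 : 0 <= g t (evals S i).
    by rewrite addr_ge0// mulr_ge0 ?invr_ge0 ?ler0n ?subr_ge0// ltW.
  apply: (le_trans (xlnx_le g0 sp)).
  have -> : g t (evals S i) - evals S i = t * (m%:R^-1 - evals S i).
    by rewrite /g; ring.
  rewrite exprMn -[t ^+ 2 * _ / _]mulrA.
  set d := m%:R^-1 - _; set e := d ^+ 2 / _.
  have : t ^+ 2 * e <= t * `|e|.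
    rewrite expr2 -mulrA ler_wpM2l ?(ltW t0)// -[leRHS]mul1r.
    apply: (@le_trans _ _ (t * `|e|)); first by rewrite ler_wpM2l ?ler_norm// ltW.
    by rewrite ler_wpM2r.
  lra.
have stepk t : 0 < t <= 1 -> phi (g t (evals S k)) - phi (evals S k) =
    t / m%:R * (ln t - ln m%:R).
  move=> /andP[t0 t1]; rewrite /phi /g sk0 mulr0 add0r mul0r subr0.
  by rewrite ln_div ?posrE.
have [a [b qE]] := quadq S U.
pose Ct := `|a| + `|b| + eps * \sum_(i | i != k) `|C i| + eps * `|ln m%:R|.
have main t : 0 < t <= 1 -> 0 <= Ct + eps / m%:R * ln t.
  move=> /andP[t0 t1].
  have t01 : 0 <= t <= 1 by rewrite ltW.
  have := minS _ (density_mix t01 dS dU); rewrite /F qE negmix// negentropyE// => H.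
  have {}H : 0 <= t * a + t ^+ 2 * b + eps * (\sum_i (phi (g t (evals S i)) - phi (evals S i))).
    rewrite sumrB mulrBr; lra.
  rewrite (bigD1 k)//= stepk ?t0// in H.
  have H2 : \sum_(i | i != k) (phi (g t (evals S i)) - phi (evals S i)) <=
      t * \sum_(i | i != k) `|C i|.
    rewrite mulr_sumr; apply: ler_sum => i _.
    by rewrite (le_trans (step _ _ _)) ?t0// ler_wpM2l ?ler_norm// ltW.
  have H3 : t ^+ 2 * b <= t * `|b|.
    apply: (@le_trans _ _ (t ^+ 2 * `|b|)); first by rewrite ler_wpM2l ?ler_norm// sqr_ge0.
    by rewrite ler_wpM2r// expr2 ger_pMl.
  have H4 : t * a <= t * `|a| by rewrite ler_wpM2l ?ler_norm// ltW.
  have H5 : t / m%:R * (ln t - ln m%:R) <= t * (m%:R^-1 * ln t + `|ln m%:R|).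
    have h1 : - ln (m%:R : R) <= `|ln m%:R| by rewrite -normrN ler_norm.
    have h2 : m%:R^-1 * `|ln m%:R| <= `|ln (m%:R : R)| :> R.
      by rewrite -[leRHS]mul1r ler_wpM2r// invf_le1// ler1n.
    rewrite -mulrA ler_wpM2l ?(ltW t0)// mulrBr lerD2l.
    apply: le_trans h2; rewrite -mulrN ler_wpM2l// invr_ge0 ler0n.
  have H6 : 0 <= t * (Ct + eps / m%:R * ln t).
    apply: (le_trans H); rewrite /Ct.
    apply: (@le_trans _ _ (t * `|a| + t * `|b| + eps * (t * (m%:R^-1 * ln t + `|ln m%:R|) +
       t * \sum_(i | i != k) `|C i|))); last first.
      by rewrite le_eqVlt; apply/orP; left; apply/eqP; ring.
    apply: lerD; first exact: lerD.
    by rewrite ler_wpM2l ?(ltW eps0)//; exact: lerD.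
  by move: H6; rewrite pmulr_rge0.
have Ct0 : 0 <= Ct.
  by rewrite !addr_ge0// mulr_ge0 ?(ltW eps0)// sumr_ge0.
(* Chosen so that (eps / m) ln t = - (Ct + 1), which contradicts [main]. *)
pose t := expR (- ((Ct + 1) * m%:R / eps)).
have t01 : 0 < t <= 1.
  by rewrite expR_gt0 expR_le1 oppr_le0 divr_ge0 ?(ltW eps0)// mulr_ge0 ?ler0n// addr_ge0.
have := main _ t01; rewrite /t expRK.
have -> : eps / m%:R * - ((Ct + 1) * m%:R / eps) = - (Ct + 1).
  by field; rewrite !gt_eqF.
lra.
Qed.

(** One-sided derivative along the segment towards [S1]: the risk contributes [a], the entropy is
    bounded by [negentropy_le], and the trace term there vanishes between densities. *)
Lemma argmin_first_order S S1 (a b : R) :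
  (forall t, q (mixmx t S S1) = q S + t * a + t ^+ 2 * b) ->
  is_argmin (density R m) F S -> density R m S1 ->
  0 <= a + eps * complex.Re (\tr ((S1 - S) *m mxlog S)).
Proof.
move=> qE argS dS1; have [dS minS] := argS.
have spos := argmin_posdef argS.
have [c c0 cS] : exists2 c, 0 < c & forall j, c <= evals S j.
  have [j0|no] := pselect (exists j : 'I_m, True); last first.
    by exists 1 => // j; exfalso; apply: no; exists j.
  have [j _] := j0; pose jm := [arg min_(i < j) evals S i]%O.
  exists (evals S jm) => // i; rewrite /jm; case: arg_minP => // i0 _; exact.
have [hS _ trS] := dS; have [hS1 _ trS1] := dS1.
set G := complex.Re (\tr ((S1 - S) *m mxlog S)).
set N := complex.Re (\tr ((S1 - S) *m (S1 - S))).
apply: (@linear_quadratic_ge0 _ (b + eps * (c^-1 * N))) => t /andP[t0 t1].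
have t01 : 0 <= t <= 1 by rewrite ltW.
have dM := density_mix t01 dS dS1; have [hM _ trM] := dM.
have := minS _ dM; rewrite /F qE => H.
have := negentropy_le hM hS (fun i => density_evals_ge0 i dM) c0 cS.
have E : mixmx t S S1 - S = t%:C%C *: (S1 - S) by rewrite /mixmx addrAC subrr add0r.
have -> : complex.Re (\tr ((mixmx t S S1 - S) *m mxlog S)) = t * G.
  by rewrite E Re_tr_scaleM.
have -> : complex.Re (\tr ((mixmx t S S1 - S) *m (mixmx t S S1 - S))) = t ^+ 2 * N.
  by rewrite E Re_tr_scaleM2.
have -> : complex.Re (\tr (mixmx t S S1 - S)) = 0.
  by rewrite E Re_trZ mxtraceB trS trS1 subrr Re0 mulr0.
move: H; move: (negentropy _) (negentropy _) (q S) => n1 n2 qS.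
move: G N => G N H /(ler_wpM2l (ltW eps0)) H2; lra.
Qed.

End Argmin.

(** * Finite sets with large convex hulls *)

Section Lattice.
Variable R : realType.

Definition convexf d (C : set ('I_d -> R)) := forall t x y, 0 <= t <= 1 ->
  C x -> C y -> C (fun i => (1 - t) * x i + t * y i).

(* Sign-magnitude encoding of the points of norm at most 2 in (Z / sqrt d)^d. *)
Definition lattice_pt d :=
  {k : {ffun 'I_d -> bool * 'I_(4 * d).+1} | (\sum_i (k i).2 ^ 2 <= 4 * d)%N}.

Definition lattice_coord d (k : lattice_pt d) (i : 'I_d) : R :=
  (-1) ^+ (val k i).1 * (val k i).2%:R / Num.sqrt d%:R.

Lemma lattice_coord_sqr d (k : lattice_pt d) : \sum_i lattice_coord k i ^+ 2 <= 4.
Proof.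
have [d0|d0] := posnP d.
  rewrite big1// => -[j jd]; exfalso.
  by have : (j < 0)%N by rewrite -[X in (_ < X)%N]d0.
have dR : 0 < d%:R :> R by rewrite ltr0n.
have -> : \sum_i lattice_coord k i ^+ 2 = (\sum_i (val k i).2 ^ 2)%N%:R / d%:R.
  rewrite natr_sum mulr_suml; apply: eq_bigr => i _.
  by rewrite /lattice_coord !exprMn sqrr_sign mul1r exprVn sqr_sqrtr ?(ltW dR)// natrX.
by rewrite ler_pdivrMr// -natrM ler_nat; exact: (valP k).
Qed.

Lemma sum_half_pow n : \sum_(j < n) (2^-1 : R) ^+ j <= 2.
Proof.
suff -> : \sum_(j < n) (2^-1 : R) ^+ j = 2 - 2 * 2^-1 ^+ n.
  by rewrite gerBl mulr_ge0// exprn_ge0// invr_ge0.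
elim: n => [|n IH]; first by rewrite big_ord0 expr0; lra.
by rewrite big_ord_recr /= IH exprS; field.
Qed.

(** A generating function bound: a point whose magnitudes k_i sum to at most 4 d has weight prod_i
    16 * 2^{- k_i} >= 1, and the weights of all sign-magnitude vectors sum to at most 64^d <= e^{6
    d}. *)
Lemma card_lattice_pt d : #|{: lattice_pt d}|%:R <= expR (6 * d%:R) :> R.
Proof.
have -> : #|{: lattice_pt d}|%:R =
   \sum_(k : {ffun 'I_d -> bool * 'I_(4 * d).+1} | (\sum_i (k i).2 ^ 2 <= 4 * d)%N) (1 : R).
  by rewrite sumr_const card_sig.
pose w (a : bool * 'I_(4 * d).+1) : R := 16 * 2^-1 ^+ a.2.
have w0 a : 0 <= w a by rewrite mulr_ge0// exprn_ge0// invr_ge0.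
apply: (@le_trans _ _ (\sum_(k : {ffun 'I_d -> bool * 'I_(4 * d).+1}) \prod_i w (k i))).
  rewrite big_mkcond; apply: ler_sum => k _; case: ifP => [kd|_]; last exact: prodr_ge0.
  rewrite big_split /= prodr_const card_ord -expr_sum.
  have le : (\sum_i (k i).2 <= 4 * d)%N.
    apply: leq_trans kd; apply: leq_sum => i _.
    by rewrite -mulnn; case: (val (k i).2) => // n; rewrite leq_pmull.
  rewrite -ler_pdivrMr ?exprn_gt0 ?invr_gt0// div1r -exprVn invrK.
  have -> : (16 : R) = 2 ^+ 4 by ring.
  by rewrite -exprM ler_weXn2l// ler1n.
rewrite -(bigA_distr_bigA (fun=> w)) /= prodr_const card_ord expRM_natr.
apply: lerXn2r; rewrite ?nnegrE ?sumr_ge0 ?expR_ge0//.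
have -> : \sum_(a : bool * 'I_(4 * d).+1) w a =
    \sum_(b : bool) \sum_(j < (4 * d).+1) 16 * 2^-1 ^+ j.
  by rewrite pair_big.
rewrite big_bool /= -mulr_sumr.
have e2 : 2 <= expR 1 :> R by apply: le_trans (expR_ge1Dx _); lra.
have -> : expR 6 = expR 1 ^+ 6 :> R by rewrite -expRM_natl mulr1.
have : 2 ^+ 6 <= expR 1 ^+ 6 :> R by apply: lerXn2r; rewrite ?nnegrE ?expR_ge0.
by have := sum_half_pow (4 * d).+1; lra.
Qed.

Lemma lattice_pt_of_int d (z : 'I_d -> int) : (\sum_i `|z i| ^ 2 <= 4 * d)%N ->
  exists k : lattice_pt d, forall i, lattice_coord k i = (z i)%:~R / Num.sqrt d%:R.
Proof.
move=> zd.
have zi i : (`|z i| < (4 * d).+1)%N.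
  rewrite ltnS; apply: leq_trans zd; rewrite (bigD1 i)//=.
  apply: leq_trans (leq_addr _ _).
  by rewrite -mulnn; case: (`|z i|)%N => // n; rewrite leq_pmull.
pose k := [ffun i => (z i < 0, Ordinal (zi i))].
have kd : (\sum_i (k i).2 ^ 2 <= 4 * d)%N.
  by apply: leq_trans zd; rewrite leq_eqVlt; apply/orP; left; apply/eqP;
    apply: eq_bigr => i _; rewrite ffunE.
exists (exist _ k kd) => i; rewrite /lattice_coord /= ffunE /=; congr (_ / _).
rewrite -[X in _ * X]/((`|z i|)%N%:R : R) pmulrn [in RHS](intEsign (z i)).
by rewrite rmorphM rmorph_sign.
Qed.

(* Rounding each coordinate up or down writes x as an average of lattice points. *)
Lemma lattice_hull d (C : set ('I_d -> R)) : convexf C ->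
  (forall k : lattice_pt d, C (lattice_coord k)) ->
  forall x, \sum_i x i ^+ 2 <= 1 -> C x.
Proof.
move=> cC Ck x x1.
have [d0|d0] := posnP d.
  have [k _] := @lattice_pt_of_int d (fun=> 0) ltac:(by rewrite big1).
  by rewrite (_ : x = lattice_coord k)//; apply/funext => -[j jd]; exfalso;
    have : (j < 0)%N by rewrite -[X in (_ < X)%N]d0.
have dR : 0 < d%:R :> R by rewrite ltr0n.
have sd : 0 < Num.sqrt d%:R :> R by rewrite sqrtr_gt0.
pose y i := Num.sqrt d%:R * x i.
(* [s] lists the coordinates that are not rounded yet. *)
suff H (s : seq 'I_d) : forall u : 'I_d -> R,
    (forall i, i \notin s -> exists2 b : bool, True & u i = (Num.floor (y i) + b)%:~R) ->
    (forall i, i \in s -> u i = y i) -> C (fun i => u i / Num.sqrt d%:R).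
  have := H (enum 'I_d) y; rewrite (_ : (fun i => _) = x).
    by apply => i; rewrite mem_enum.
  by apply/funext => i; rewrite /y mulrAC divff ?mul1r// gt_eqF.
elim: s => [|i0 s IH] u uN us.
  have /choice[b bE] : forall i, exists b : bool, u i = (Num.floor (y i) + b)%:~R.
    by move=> i; have [//|b _ ?] := uN i; exists b.
  have [|k kE] := @lattice_pt_of_int d (fun i => Num.floor (y i) + b i).
    rewrite -(ler_nat R) natr_sum.
    (* A rounded coordinate is within 1 of y_i, so its square is at most 2 y_i^2 + 2; the sum is at
       most 2 d + 2 d. This is why the lattice points have radius 2. *)
    apply: (@le_trans _ _ (\sum_i (2 * y i ^+ 2 + 2))).
      apply: ler_sum => i _.
      rewrite natrX -[(`|_|)%N%:R]/((`|_|%N : int)%:~R) abszE intr_norm real_normK ?num_real//.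
      have := ge_floor (y i); have := lt_succ_floor (y i); rewrite !intrD.
      have [/=|/=] : ((b i : int)%:~R = 0 :> R) \/ ((b i : int)%:~R = 1 :> R).
          by case: (b i); [right|left].
        move=> ->; move: ((Num.floor (y i))%:~R : R) => f h1 h2.
        have h3 : 0 <= (1 - (f - y i)) * (1 + (f - y i)) by rewrite mulr_ge0//; lra.
        have := sqr_ge0 (f - 2 * y i); rewrite !expr2 => h4; lra.
      move=> ->; move: ((Num.floor (y i))%:~R : R) => f h1 h2.
      have h3 : 0 <= (1 - (f + 1 - y i)) * (1 + (f + 1 - y i)) by rewrite mulr_ge0//; lra.
      have := sqr_ge0 (f + 1 - 2 * y i); rewrite !expr2 => h4; lra.
    rewrite big_split /= sumr_const card_ord -mulr_sumr.
    have -> : \sum_i y i ^+ 2 = d%:R * \sum_i x i ^+ 2.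
      by rewrite mulr_sumr; apply: eq_bigr => i _; rewrite exprMn sqr_sqrtr// ltW.
    have := ler_wpM2l (ltW dR) x1; rewrite natrM -mulr_natr; lra.
  rewrite (_ : (fun i => _) = lattice_coord k)//.
  by apply/funext => i; rewrite kE bE.
have [i0s|i0s] := boolP (i0 \in s).
  apply: IH => i iN; last by apply: us; rewrite inE iN orbT.
  by apply: uN; rewrite inE negb_or iN andbT; apply: contraNneq iN => ->.
pose th := y i0 - (Num.floor (y i0))%:~R.
have th01 : 0 <= th <= 1.
  by have := ge_floor (y i0); have := lt_succ_floor (y i0); rewrite intrD /th; lra.
pose v (b : bool) i := if i == i0 then (Num.floor (y i0) + b)%:~R else u i.
have Cv b : C (fun i => v b i / Num.sqrt d%:R).
  apply: IH => i; rewrite /v.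
    case: eqP => [-> _|/eqP ii0 iN]; first by exists b.
    by apply: uN; rewrite inE negb_or ii0.
  case: eqP => [->|_ iin]; first by rewrite (negPf i0s).
  by apply: us; rewrite inE iin orbT.
have := cC _ _ _ th01 (Cv false) (Cv true).
rewrite (_ : (fun i => _) = (fun i => u i / Num.sqrt d%:R))//.
apply/funext => i; rewrite /v; case: eqP => [->|_]; last by ring.
rewrite us ?mem_head// !intrD /th /=; ring.
Qed.

End Lattice.

#[local] Opaque spectralmx spectral_diag.

Lemma scaler_lincomb2 (K : comPzRingType) (V : lmodType K) (a b c : K) (p q r s : V) :
  c *: (a *: p + b *: q + (a *: r + b *: s)) =
  a *: (c *: (p + r)) + b *: (c *: (q + s)).
Proof.
rewrite addrACA -!scalerDr (scalerDr c (a *: _)) (scalerA c a) (scalerA c b).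
by rewrite (mulrC c a) (mulrC c b) -!scalerA.
Qed.

(** * Rank-two frames and the densities in their hull *)

Section Frames.
Variables (R : realType) (m : nat).
Implicit Types (A B S : 'M[R[i]]_m) (v w : 'rV[R[i]]_m) (x y : 'I_(m + m) -> R).

Definition convexmx (C : set 'M[R[i]]_m) := forall t A B, 0 <= t <= 1 ->
  C A -> C B -> C (mixmx t A B).

Lemma convexmx_sum (C : set 'M[R[i]]_m) : convexmx C ->
  forall n (p : 'I_n -> R) (F : 'I_n -> 'M[R[i]]_m), (forall i, 0 <= p i) ->
  \sum_i p i = 1 -> (forall i, C (F i)) -> C (\sum_i (p i)%:C%C *: F i).
Proof.
move=> cC; elim=> [|n IH] p F p0 p1 CF.
  by move: p1 => /eqP; rewrite big_ord0 eq_sym oner_eq0.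
rewrite big_ord_recr /=; rewrite big_ord_recr /= in p1.
set t := p ord_max in p1 *.
have t0 : 0 <= t by exact: p0.
have s0 : 0 <= \sum_(i < n) p (widen_ord (leqnSn n) i) by exact: sumr_ge0.
have [t1|t1] := eqVneq t 1.
  have /eqP : \sum_(i < n) p (widen_ord (leqnSn n) i) = 0 by lra.
  rewrite psumr_eq0// => /allP pz.
  rewrite big1 ?add0r ?t1 ?scale1r// => i _.
  by have /eqP -> := pz i (mem_index_enum _); rewrite scale0r.
have t1' : 0 < 1 - t by rewrite subr_gt0 lt_neqAle t1; lra.
have := IH (fun i => p (widen_ord (leqnSn n) i) / (1 - t)) (fun i => F (widen_ord (leqnSn n) i)).
move=> /(_ _ _ _)/wrap[||| CA].
- by move=> i; rewrite divr_ge0// ltW.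
- by rewrite -mulr_suml (_ : \sum_i _ = 1 - t) ?divff ?gt_eqF//; lra.
- by [].
have t01 : 0 <= t <= 1 by lra.
have := cC _ _ _ t01 CA (CF ord_max); rewrite mixmxE scaler_sumr.
congr (C (_ + _)); apply: eq_bigr => i _.
by rewrite scalerA -rmorphM mulrC divfK// gt_eqF.
Qed.

(** Symmetrized so as to be Hermitian for all [v], [w] and real bilinear in them: the two vectors
    can then be replaced by lattice points independently. *)
Definition outer v w : 'M[R[i]]_m := (2^-1 : R)%:C%C *: (v^t* *m w + w^t* *m v).

Lemma outer_herm v w : outer v w \is hermsymmx.
Proof.
apply/hermsymmxP; rewrite trmxC_scale trmxCD !trmx_mul !map_mxM !trmxCK.
by rewrite addrC.
Qed.

Lemma outerC v w : outer v w = outer w v.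
Proof. by rewrite /outer addrC. Qed.

Lemma outer_linear a b v v' w :
  outer (a%:C%C *: v + b%:C%C *: v') w = a%:C%C *: outer v w + b%:C%C *: outer v' w.
Proof.
have E : (a%:C%C *: v + b%:C%C *: v')^t* = a%:C%C *: v^t* + b%:C%C *: v'^t*.
  by apply/matrixP => i j; rewrite !mxE rmorphD !rmorphM /= !conj_real.
rewrite /outer E mulmxDl mulmxDr -!scalemxAl -!scalemxAr.
exact: scaler_lincomb2.
Qed.

Lemma outer_self v : outer v v = v^t* *m v.
Proof.
rewrite /outer -{1 2}(scale1r (v^t* *m v)) -scalerDl scalerA.
have -> : (2^-1 : R)%:C%C * (1 + 1) = 1 :> R[i].
  rewrite -(rmorph1 (real_complex R)) -rmorphD -rmorphM /=; congr (_%:C%C); lra.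
by rewrite scale1r.
Qed.

Lemma sqfrob_outer v w :
  sqfrob (outer v w) <= (\sum_j sqnormc (v 0 j)) * (\sum_j sqnormc (w 0 j)).
Proof.
pose a j := sqnormc (v 0 j); pose b j := sqnormc (w 0 j).
have le (i j : 'I_m) : sqnormc (outer v w i j) <= 2^-1 * (a i * b j) + 2^-1 * (b i * a j).
  rewrite /a /b !mxE !big_ord1 !mxE !conj_conjc.
  case: (v 0 i) => v1 v2; case: (w 0 i) => w1 w2; case: (v 0 j) => v3 v4.
  case: (w 0 j) => w3 w4; rewrite /sqnormc /=.
  set e1 := v1 * w3 - _; set e2 := w1 * v3 - _; set e3 := v1 * w4 + _; set e4 := w1 * v4 + _.
  have -> : (v1 ^+ 2 + v2 ^+ 2) * (w3 ^+ 2 + w4 ^+ 2) = e1 ^+ 2 + e3 ^+ 2.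
    by rewrite /e1 /e3; ring.
  have -> : (w1 ^+ 2 + w2 ^+ 2) * (v3 ^+ 2 + v4 ^+ 2) = e2 ^+ 2 + e4 ^+ 2.
    by rewrite /e2 /e4; ring.
  rewrite !mul0r subr0 addr0.
  have := sqr_ge0 (e1 - e2); have := sqr_ge0 (e3 - e4); rewrite !exprMn !sqrrB !sqrrD; lra.
apply: (@le_trans _ _ (\sum_i \sum_j (2^-1 * (a i * b j) + 2^-1 * (b i * a j)))).
  by apply: ler_sum => i _; apply: ler_sum.
rewrite le_eqVlt; apply/orP; left; apply/eqP.
under eq_bigr do rewrite big_split /= -!mulr_sumr.
rewrite big_split /= -!mulr_sumr -!mulr_suml -/a -/b.
by move: (\sum_i a i) (\sum_i b i) => x y; field.
Qed.

(** Identifies C^m with R^{2 m}, where the lattice lives. *)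
Definition cvec x : 'rV[R[i]]_m := \row_j (x (lshift m j) +i* x (rshift m j))%C.

Lemma cvec_linear a b x y :
  cvec (fun i => a * x i + b * y i) = a%:C%C *: cvec x + b%:C%C *: cvec y.
Proof.
apply/rowP => j; rewrite !mxE; apply/eqP; rewrite eq_complex /=.
by apply/andP; split; apply/eqP; ring.
Qed.

Lemma sum_sqnormc_cvec x : \sum_j sqnormc (cvec x 0 j) = \sum_i x i ^+ 2.
Proof.
by rewrite big_split_ord /= -big_split /=; apply: eq_bigr => j _; rewrite mxE.
Qed.

Lemma cvec_surj v : exists x, v = cvec x.
Proof.
exists (fun i : 'I_(m + m) => match fintype.split i with
  inl j => complex.Re (v 0 j) | inr j => complex.Im (v 0 j) end).
apply/rowP => j; rewrite mxE.
rewrite -[lshift m j]/(unsplit (inl j)) -[rshift m j]/(unsplit (inr j)) !unsplitK.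
by case: (v 0 j).
Qed.

Definition frame (k l : lattice_pt (m + m)) : 'M[R[i]]_m :=
  outer (cvec (lattice_coord R k)) (cvec (lattice_coord R l)).

Lemma frame_herm k l : frame k l \is hermsymmx.
Proof. exact: outer_herm. Qed.

Lemma sqfrob_frame k l : sqfrob (frame k l) <= 16.
Proof.
apply: (le_trans (sqfrob_outer _ _)); rewrite !sum_sqnormc_cvec.
have -> : (16 : R) = 4 * 4 by ring.
by apply: ler_pM; rewrite ?sumr_ge0 ?lattice_coord_sqr// => i _; exact: sqr_ge0.
Qed.

(** The sign bit of the encoding makes the set of frames symmetric; a one-sided bound of a linear
    functional on all frames is thus two-sided. *)
Lemma frameN k l : exists k', - frame k l = frame k' l.
Proof.
pose f := [ffun i => (~~ (val k i).1, (val k i).2)].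
have fk : (\sum_i (f i).2 ^ 2 <= 4 * (m + m))%N.
  by have := valP k; congr (_ <= _)%N; apply: eq_bigr => i _; rewrite ffunE.
exists (exist _ f fk).
have E : lattice_coord R (exist _ f fk) = (fun i => -1 * lattice_coord R k i + 0 * 0).
  apply/funext => i; rewrite /lattice_coord /= ffunE /= signrN; ring.
rewrite /frame E cvec_linear outer_linear rmorph0 scale0r addr0 rmorphN rmorph1.
by rewrite scaleN1r.
Qed.

(** For one vector fixed, the other ranges over a convex set of R^{2 m}; [lattice_hull] is applied
    to each vector in turn. *)
Lemma unit_outer_hull (C : set 'M[R[i]]_m) : convexmx C ->
  (forall k l, C (frame k l)) ->
  forall x y, \sum_i x i ^+ 2 <= 1 -> \sum_i y i ^+ 2 <= 1 ->
  C (outer (cvec x) (cvec y)).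
Proof.
move=> cC CF x y x1 y1.
have mixE t u u' w : outer (cvec (fun i => (1 - t) * u i + t * u' i)) w =
    mixmx t (outer (cvec u) w) (outer (cvec u') w).
  by rewrite cvec_linear outer_linear mixmxE.
pose D1 k : set ('I_(m + m) -> R) := fun u => C (outer (cvec u) (cvec (lattice_coord R k))).
have cD1 k : convexf (D1 k).
  move=> t u u' t01 Cu Cu'; rewrite /D1.
 rewrite (mixE t u u' (cvec (lattice_coord R k))).
 exact: (cC t _ _ t01 Cu Cu').
pose D2 : set ('I_(m + m) -> R) := fun u => C (outer (cvec u) (cvec y)).
have cD2 : convexf D2.
  move=> t u u' t01 Cu Cu'; rewrite /D2.
 rewrite (mixE t u u' (cvec y)). exact: (cC t _ _ t01 Cu Cu').
suff : D2 x by [].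
apply: (lattice_hull cD2) => // k.
suff : D1 k y by rewrite /D1 /D2 outerC.
by apply: (lattice_hull (cD1 k)) => // l; exact: CF.
Qed.

Lemma herm_rank1_sum S : S \is hermsymmx ->
  S = \sum_i (evals S i)%:C%C *: outer (row i (spectralmx S)) (row i (spectralmx S)).
Proof.
move=> hS; rewrite -{1}(mxfun_id hS) mxfunE.
move: (spectralmx S) (evals S) => U e.
apply/matrixP => a b; rewrite mul_mx_diag mxE summxE; apply: eq_bigr => i _.
by rewrite outer_self !mxE big_ord1 !mxE mulrAC mulrC.
Qed.

Lemma eigen_outer_hull (C : set 'M[R[i]]_m) : convexmx C -> (forall k l, C (frame k l)) ->
  forall S i, C (outer (row i (spectralmx S)) (row i (spectralmx S))).
Proof.
move=> cC CF S i; have [x xE] := cvec_surj (row i (spectralmx S)); rewrite xE.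
have x1 : \sum_i x i ^+ 2 <= 1.
  rewrite -sum_sqnormc_cvec -xE -(unitary_sqnormc_row (spectral_unitarymx S) i).
  by rewrite le_eqVlt; apply/orP; left; apply/eqP; apply: eq_bigr => j _; rewrite mxE.
exact: unit_outer_hull.
Qed.

Lemma density_hull (C : set 'M[R[i]]_m) : convexmx C ->
  (forall k l, C (frame k l)) -> density R m `<=` C.
Proof.
move=> cC CF S dS; have [hS _ _] := dS; rewrite (herm_rank1_sum hS).
apply: convexmx_sum => //.
- by move=> i; exact: density_evals_ge0.
- exact: density_sum_evals.
- by move=> i; exact: eigen_outer_hull.
Qed.

(** Half the difference is the midpoint of [A] and [- B], and the hull contains both because the
    frames are symmetric. *)
Lemma density_diff_hull (C : set 'M[R[i]]_m) : convexmx C ->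
  (forall k l, C (frame k l)) ->
  forall A B, density R m A -> density R m B -> C ((2^-1 : R)%:C%C *: (A - B)).
Proof.
move=> cC CF A B dA dB.
have CB : C (- B).
  apply: (@density_hull [set B | C (- B)]) => // [t B1 B2 t01 /= C1 C2|k l /=].
    have := cC _ _ _ t01 C1 C2; rewrite /mixmx.
    by rewrite opprD -scalerN opprB opprK [- B2 + _]addrC.
  by have [k' ->] := frameN k l.
have h2 : 0 <= (2^-1 : R) <= 1 by lra.
have := cC _ _ _ h2 (density_hull cC CF dA) CB; rewrite mixmxE.
have -> : 1 - 2^-1 = 2^-1 :> R by lra.
by rewrite -scalerDr.
Qed.

End Frames.

(** * Maurey's averaging and Gram-Schmidt *)

Section Maurey.
Variables (R : realType) (V : zmodType) (J : finType).
Variables (q : V -> R) (b : V -> V -> R) (p : J -> R) (F : J -> V) (A : V).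
Hypothesis p0 : forall j, 0 <= p j.
Hypothesis p1 : \sum_j p j = 1.
Hypothesis qD : forall B C, q (B + C) = q B + 2 * b B C + q C.
Hypothesis bA : forall B, \sum_j p j * b B (F j) = b B A.

(** The expectation over independent indices is taken one index at a time, with [B] carrying the
    part of the sum that is already fixed; no product space is involved. *)
Lemma maurey_iter n B :
  (forall s : seq J, size s = n -> 0 <= q (B + \sum_(j <- s) F j)) ->
  0 <= q (B + A *+ n) + n%:R * (\sum_j p j * q (F j) - q A).
Proof.
elim: n B => [|n IH] B H.
  by have := H [::] erefl; rewrite big_nil addr0 mulr0n mul0r !addr0.
have {}IH j : 0 <= p j * (q (B + F j + A *+ n) + n%:R * (\sum_j p j * q (F j) - q A)).
  rewrite mulr_ge0//; apply: IH => s sn; have := H (j :: s).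
  by rewrite /= sn big_cons addrA; exact.
have : 0 <= \sum_j p j * (q (B + F j + A *+ n) + n%:R * (\sum_j p j * q (F j) - q A)).
  by apply: sumr_ge0 => j _; exact: IH.
have -> : \sum_j p j * (q (B + F j + A *+ n) + n%:R * (\sum_j p j * q (F j) - q A)) =
    \sum_j (p j * q (B + A *+ n) + 2 * (p j * b (B + A *+ n) (F j)) + p j * q (F j)
      + p j * (n%:R * (\sum_j p j * q (F j) - q A))).
  by apply: eq_bigr => j _; rewrite addrAC qD; ring.
rewrite !big_split /= -!mulr_suml -mulr_sumr bA p1 !mul1r.
by rewrite [A *+ n.+1]mulrSr addrA (qD _ A) -natr1; lra.
Qed.

(* For independent j_1, ..., j_N of law p, the mean of q (F j_1 + ... + F j_N)
   is N sum_j p j q (F j) + N (N - 1) q A. *)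
Lemma maurey_lower n (M : R) : q (A *+ n.+2) = n.+2%:R ^+ 2 * q A ->
  (forall s : seq J, size s = n.+2 -> 0 <= q (\sum_(j <- s) F j)) ->
  (forall j, q (F j) <= M) -> - M <= n.+1%:R * q A.
Proof.
move=> qn H qM.
have := @maurey_iter n.+2 0; rewrite add0r qn => /(_ _)/wrap[s sn|].
  by rewrite add0r; exact: H.
have : \sum_j p j * q (F j) <= M.
  rewrite -[leRHS]mul1r -p1 mulr_suml; apply: ler_sum => j _.
  by rewrite ler_wpM2l.
move: (\sum_j p j * q (F j)) => S SM.
have n0 : 0 < n.+2%:R :> R by rewrite ltr0n.
have -> : n.+2%:R ^+ 2 * q A + n.+2%:R * (S - q A) = n.+2%:R * (n.+1%:R * q A + S).
  by rewrite -[n.+2%:R]natr1; ring.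
rewrite pmulr_rge0//; lra.
Qed.

End Maurey.

Section GramSchmidt.
Variables (R : realType) (V : zmodType) (sc : R -> V -> V) (b : V -> V -> R).
Hypothesis bC : forall A B, b A B = b B A.
Hypothesis bD : forall A B C, b (A + B) C = b A C + b B C.
Hypothesis bZ : forall t A B, b (sc t A) B = t * b A B.
Hypothesis b0 : forall A, 0 <= b A A.

Let bB A B C : b (A - B) C = b A C - b B C.
Proof. by apply/eqP; rewrite eq_sym subr_eq -bD subrK. Qed.

Let b_sum (I : Type) (s : seq I) (F : I -> V) C :
  b (\sum_(i <- s) F i) C = \sum_(i <- s) b (F i) C.
Proof.
elim: s => [|i s IH]; last by rewrite !big_cons bD IH.
by rewrite !big_nil -(subrr (0 : V)) bB subrr.
Qed.

(** The degenerate case of Cauchy-Schwarz: otherwise b (t u + x) (t u + x) would be affine and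
    nonconstant in t, hence negative somewhere. *)
Lemma null_orth u x : b u u = 0 -> b u x = 0.
Proof.
move=> uu; apply/eqP/negP => /negP ux.
have H t : 0 <= 2 * t * b u x + t ^+ 2 * 0 + b x x.
  have := b0 (sc t u + x); rewrite bD bZ (bC u) (bC x (_ + _)) !bD !bZ uu (bC x u); lra.
have := H (- (b x x + 1) / (2 * b u x)).
have -> : 2 * (- (b x x + 1) / (2 * b u x)) * b u x = - (b x x + 1) by field.
lra.
Qed.

Variable H : set V.
Hypothesis H0 : H 0.
Hypothesis HB : forall A B, H A -> H B -> H (A - B).
Hypothesis HZ : forall t A, H A -> H (sc t A).

Let HD A B : H A -> H B -> H (A + B).
Proof. by move=> hA hB; have := HB hA (HB H0 hB); rewrite sub0r opprK. Qed.

(** The form is only semidefinite, so vectors with null residual are skipped, and the part of [v]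
    missed by the basis has norm 0 without being 0. [H] is a real subspace to which the basis stays
    confined; it will be that of the Hermitian matrices. *)
Lemma gram_schmidt (s : seq V) : exists (e : seq V),
  [/\ (size e <= size s)%N,
      (forall i j, (i < size e)%N -> (j < size e)%N ->
         b (nth 0 e i) (nth 0 e j) = (i == j)%:R),
      (forall v, v \in s -> let w := v - \sum_(u <- e) sc (b v u) u in b w w = 0) &
      (forall v, v \in s -> H v) -> forall u, u \in e -> H u].
Proof.
elim: s => [|v s [e [se eo es eH]]]; first by exists [::].
pose w := v - \sum_(u <- e) sc (b v u) u.
have we i : (i < size e)%N -> b w (nth 0 e i) = 0.
  move=> ie; rewrite /w bB b_sum (big_nth 0) big_mkord (bigD1 (Ordinal ie))//=.
  rewrite bZ eo// eqxx mulr1 big1 ?addr0 ?subrr// => j ji.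
  rewrite bZ eo//; move: ji; rewrite -(inj_eq val_inj) /= => /negPf ->.
  by rewrite mulr0.
have [w0|wN0] := eqVneq (b w w) 0.
  exists e; split => //; first exact: leqW.
  - by move=> u; rewrite inE => /orP[/eqP ->//|]; exact: es.
  - by move=> sH; apply: eH => u us; apply: sH; rewrite inE us orbT.
have wp : 0 < b w w by rewrite lt_neqAle eq_sym wN0 b0.
pose f := sc (Num.sqrt (b w w))^-1 w.
have sp : 0 < Num.sqrt (b w w) by rewrite sqrtr_gt0.
have fe i : (i < size e)%N -> b f (nth 0 e i) = 0.
  by move=> ie; rewrite bZ we// mulr0.
have ff : b f f = 1.
  by rewrite bZ bC bZ mulrA -expr2 exprVn sqr_sqrtr ?(ltW wp)// mulVf.
exists (rcons e f); split.
- by rewrite size_rcons ltnS.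
- move=> i j; rewrite size_rcons !ltnS [(i <= _)%N]leq_eqVlt [(j <= _)%N]leq_eqVlt !nth_rcons.
  case/orP => [/eqP ->|ie]; case/orP => [/eqP ->|je].
  + by rewrite ltnn eqxx.
  + by rewrite ltnn eqxx je fe// gt_eqF.
  + by rewrite ltnn eqxx ie bC fe// lt_eqF.
  + by rewrite ie je eo.
- move=> u us /=; rewrite -cats1 big_cat big_seq1 /=.
  have [uE|/eqP uv] := eqVneq u v.
    rewrite uE opprD addrA -/w.
    have bvf : b v f = Num.sqrt (b w w).
      have -> : v = w + \sum_(u <- e) sc (b v u) u by rewrite /w subrK.
      rewrite bD b_sum big_seq big1 ?addr0.
        by rewrite bC bZ -{2}(sqr_sqrtr (ltW wp)) expr2 mulrA mulVf ?mul1r// gt_eqF.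
      move=> x /(nthP 0)[i ie <-]; by rewrite bZ (bC _ f) fe// mulr0.
    have bfw : b f w = Num.sqrt (b w w).
      by rewrite bZ -{2}(sqr_sqrtr (ltW wp)) expr2 mulrA mulVf ?mul1r// gt_eqF.
    clearbody f; clearbody w; rewrite bvf bB bZ (bC w) (bC f (_ - _)) !bB !bZ ff (bC w f) bfw.
    by rewrite -{1}(sqr_sqrtr (ltW wp)); ring.
  have {us} us : u \in s by move: us; rewrite inE => /orP[/eqP|].
  have := es u us => /=; set w' := u - \sum_(x <- e) _ => w'0.
  rewrite opprD addrA -/w'.
  have buf : b u f = 0.
    have -> : u = w' + \sum_(x <- e) sc (b u x) x by rewrite /w' subrK.
    rewrite bD null_orth// add0r b_sum big_seq big1// => x /(nthP 0)[i ie <-].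
    by rewrite bZ (bC _ f) fe// mulr0.
  by rewrite buf bB null_orth// bZ mul0r subrr.
- move=> sH; have {}eH : forall u, u \in e -> H u.
    by apply: eH => u us; apply: sH; rewrite inE us orbT.
  move=> u; rewrite mem_rcons inE => /orP[/eqP ->|]; last exact: eH.
  apply: HZ; apply: HB; first by apply: sH; rewrite mem_head.
  by rewrite big_seq; apply: (big_ind H) => // x xe; apply/HZ/eH.
Qed.

End GramSchmidt.

(** * Covariance of the design *)

Section InnerProduct.
Variables (R : realType) (m : nat).
Implicit Types A B x : 'M[R[i]]_m.

Definition ipR A (x : mxspace R m) : R := complex.Re (mxip A x).

Lemma ipRE A (x : mxspace R m) : ipR A x = \sum_i \sum_j
  (complex.Re (A i j) * complex.Re (x i j) + complex.Im (A i j) * complex.Im (x i j)).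
Proof.
rewrite /ipR /mxip /mxtrace Re_sum; apply: eq_bigr => i _.
rewrite mxE Re_sum; apply: eq_bigr => j _; rewrite !mxE conj_conjc.
by case: (A i j) => a b; case: (x i j) => c e /=; rewrite mulrN opprK.
Qed.

Lemma ipRD A B x : ipR (A + B) x = ipR A x + ipR B x.
Proof. by rewrite /ipR /mxip mulmxDl mxtraceD ReD. Qed.

Lemma ipRZ (t : R) A x : ipR (t%:C%C *: A) x = t * ipR A x.
Proof. by rewrite /ipR /mxip -scalemxAl mxtraceZ ReZ. Qed.

Lemma ipRB A B x : ipR (A - B) x = ipR A x - ipR B x.
Proof. by rewrite /ipR /mxip mulmxBl mxtraceB ReB. Qed.

Lemma ipR0 x : ipR 0 x = 0.
Proof. by rewrite /ipR /mxip mul0mx mxtrace0. Qed.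

Lemma ipR_sum (I : Type) (s : seq I) (F : I -> 'M[R[i]]_m) x :
  ipR (\sum_(i <- s) F i) x = \sum_(i <- s) ipR (F i) x.
Proof.
by elim: s => [|i s IH]; rewrite ?big_nil ?ipR0// !big_cons ipRD IH.
Qed.

Lemma ipR_tr A x : x \is hermsymmx -> ipR A x = complex.Re (\tr (A *m x)).
Proof. by move=> /hermsymmxP hx; rewrite /ipR /mxip hx. Qed.

Lemma normc_mxip A x : A \is hermsymmx -> x \is hermsymmx ->
  Normc.normc (mxip A x) = `|ipR A x|.
Proof.
move=> /hermsymmxP hA /hermsymmxP hx.
have : Num.conj (mxip A x) = mxip A x.
  rewrite /mxip hx -[in RHS]mxtrace_mulC -{2}hA -{2}hx -trmxCM.
  by rewrite /mxtrace rmorph_sum; apply: eq_bigr => i _; rewrite [in RHS]mxE [in RHS]mxE.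
rewrite /ipR conj_conjc; case: (mxip A x) => a b [] /eqP.
rewrite eq_sym -subr_eq0 opprK -mulr2n mulrn_eq0 /= => /eqP ->.
by rewrite expr0n /= addr0 sqrtr_sqr.
Qed.

(** The imaginary part of <A, x> is the real part for - i A, which reduces moduli to [ipR]. *)
Lemma sqr_normc_mxip A x : Normc.normc (mxip A x) ^+ 2 =
  ipR A x ^+ 2 + ipR ((0 -i* 1)%C *: A) x ^+ 2.
Proof.
rewrite /ipR {3}/mxip -scalemxAl mxtraceZ -/(mxip A x) /Normc.normc.
case: (mxip A x) => a b /=; rewrite sqr_sqrtr ?addr_ge0 ?sqr_ge0//.
by rewrite mul0r sub0r mulN1r opprK.
Qed.

Lemma measurable_Re_entry i j :
  measurable_fun setT (fun x : mxspace R m => complex.Re ((x : 'M[R[i]]_m) i j)).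
Proof.
move=> _ B mB; rewrite setTI; apply: sub_sigma_algebra.
by exists i, j, B; split => //; left.
Qed.

Lemma measurable_Im_entry i j :
  measurable_fun setT (fun x : mxspace R m => complex.Im ((x : 'M[R[i]]_m) i j)).
Proof.
move=> _ B mB; rewrite setTI; apply: sub_sigma_algebra.
by exists i, j, B; split => //; right.
Qed.

Lemma measurable_ipR A : measurable_fun setT (ipR A).
Proof.
have -> : ipR A = (fun x => \sum_i \sum_j
  (complex.Re (A i j) * complex.Re ((x : 'M[R[i]]_m) i j) +
   complex.Im (A i j) * complex.Im ((x : 'M[R[i]]_m) i j))).
  by apply/funext => x; exact: ipRE.
apply: measurable_sum => i; apply: measurable_sum => j.
apply: measurable_funD; apply: measurable_funM => //.
- exact: measurable_Re_entry.
- exact: measurable_Im_entry.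
Qed.

End InnerProduct.

Lemma integrable_mul_sqr d (T : measurableType d) (R : realType)
    (P : probability T R) (f g : T -> R) :
  measurable_fun setT f -> measurable_fun setT g ->
  (\int[P]_w (f w ^+ 2)%:E < +oo)%E -> (\int[P]_w (g w ^+ 2)%:E < +oo)%E ->
  P.-integrable setT (EFin \o (fun w => f w * g w)).
Proof.
move=> mf mg fA fB; have mA := measurable_funX 2 mf; have mB := measurable_funX 2 mg.
have mAB : measurable_fun setT (fun w => f w * g w) by exact: measurable_funM.
apply/integrableP; split; first exact/measurable_EFinP.
have mz : measurable_fun setT (cst 0 : T -> R) by [].
have mAB' : measurable_fun setT (fun w => `|f w * g w|) by exact: measurableT_comp.
have := @le_integral_linear _ _ _ P _ _ _ _ 0 0 1 1 mAB' mz mA mB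
  (fun=> normr_ge0 _) (fun=> lexx _) (fun=> sqr_ge0 _) (fun=> sqr_ge0 _)
  (lexx _) (lexx _) ler01 ler01.
rewrite mul0e adde0 add0e 2!mul1e => H; apply: (le_lt_trans (H _)).
  move=> w /=; rewrite mulr0 addr0 add0r !mul1r normrM.
  rewrite -(real_normK (num_real (f w))) -(real_normK (num_real (g w))).
  have := sqr_ge0 (`|f w| - `|g w|).
  have := mulr_ge0 (normr_ge0 (f w)) (normr_ge0 (g w)).
  rewrite sqrrB; lra.
by rewrite lte_add_pinfty.
Qed.

Section Covariance.
Context d (T : measurableType d) (R : realType) (P : probability T R) (m : nat).
Variable X : {RV P >-> mxspace R m}.
Variables b0 b1 b2 : R.
Hypothesis b1_gt0 : 0 < b1.
Hypothesis hX : forall w, (X w : 'M[R[i]]_m) \is hermsymmx.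
Hypothesis subX : subgaussian X b0 b1 b2.
Implicit Types A B C : 'M[R[i]]_m.

Lemma measurable_ipRX A : measurable_fun setT (fun w => ipR A (X w)).
Proof. by apply: measurableT_comp => //; exact: measurable_ipR. Qed.

Lemma L2norm_ge0 A : 0 <= L2norm X A.
Proof. by rewrite /L2norm fine_ge0// Lnorm_ge0. Qed.

Lemma eL2normE A : eL2norm X A = (L2norm X A)%:E.
Proof.
have [_ _ /(_ A) H] := subX.
rewrite /L2norm fineK// ge0_fin_numE ?Lnorm_ge0//.
by rewrite (le_lt_trans H)// ltry.
Qed.

Lemma L2norm_le A : L2norm X A <= b2 * frobnorm A.
Proof. by have [_ _ /(_ A)] := subX; rewrite eL2normE lee_fin. Qed.

Lemma integral_sqnorm A :
  (\int[P]_w (Normc.normc (mxip A (X w)) ^+ 2)%:E = (L2norm X A ^+ 2)%:E)%E.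
Proof.
have := @poweR_Lnorm _ _ _ P (fun w => (Normc.normc (mxip A (X w)))%:E) 2 ltac:(by []).
rewrite -/(eL2norm X A) eL2normE poweR_EFin -powR_mulrn ?L2norm_ge0// => ->.
apply: eq_integral => w _ /=; rewrite -powR_mulrn ?normr_ge0//; last first.
  by rewrite /Normc.normc; case: (mxip _ _) => a b; rewrite sqrtr_ge0.
by rewrite ger0_norm// /Normc.normc; case: (mxip _ _) => a b; rewrite sqrtr_ge0.
Qed.

Lemma sqr_ipR_le A w : ipR A (X w) ^+ 2 <= Normc.normc (mxip A (X w)) ^+ 2.
Proof.
by rewrite sqr_normc_mxip lerDl sqr_ge0.
Qed.

Lemma integral_sqr_ipR A : A \is hermsymmx ->
  (\int[P]_w (ipR A (X w) ^+ 2)%:E = (L2norm X A ^+ 2)%:E)%E.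
Proof.
move=> hA; rewrite -integral_sqnorm; apply: eq_integral => w _.
by rewrite normc_mxip// real_normK// num_real.
Qed.

Lemma integral_sqr_ipR_lty A : (\int[P]_w (ipR A (X w) ^+ 2)%:E < +oo)%E.
Proof.
apply: (@le_lt_trans _ _ (L2norm X A ^+ 2)%:E); last exact: ltry.
have m1 : measurable_fun setT (fun w => (ipR A (X w) ^+ 2)%:E).
  apply/measurable_EFinP; apply: measurable_funX; exact: measurable_ipRX.
have m2 : measurable_fun setT (fun w => (Normc.normc (mxip A (X w)) ^+ 2)%:E).
  apply/measurable_EFinP; under eq_fun do rewrite sqr_normc_mxip.
  by apply: measurable_funD; apply: measurable_funX; exact: measurable_ipRX.
rewrite -integral_sqnorm; apply: ge0_le_integral => //.
  by move=> w _; rewrite lee_fin sqr_ge0.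
by move=> w _; rewrite lee_fin sqr_ipR_le.
Qed.

Lemma integrable_ipRM A B :
  P.-integrable setT (EFin \o (fun w => ipR A (X w) * ipR B (X w))).
Proof.
exact: (integrable_mul_sqr (measurable_ipRX A) (measurable_ipRX B)
  (integral_sqr_ipR_lty A) (integral_sqr_ipR_lty B)).
Qed.

(** A real bilinear form, positive semidefinite and possibly degenerate, which on Hermitian matrices
    induces the L_2(Pi) norm. *)
Definition cov A B : R := fine (\int[P]_w (ipR A (X w) * ipR B (X w))%:E)%E.

Lemma integral_ipRM A B :
  (\int[P]_w (ipR A (X w) * ipR B (X w))%:E = (cov A B)%:E)%E.
Proof. by rewrite /cov fineK//; exact: (integrable_fin_num _ (integrable_ipRM A B)). Qed.

Lemma covC A B : cov A B = cov B A.
Proof. by rewrite /cov; under eq_integral do rewrite mulrC. Qed.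

Lemma covD A B C : cov (A + B) C = cov A C + cov B C.
Proof.
apply: EFin_inj.
transitivity (\int[P]_w (ipR (A + B) (X w) * ipR C (X w))%:E)%E.
  exact/esym/integral_ipRM.
rewrite EFinD; transitivity (\int[P]_w (ipR A (X w) * ipR C (X w))%:E +
    \int[P]_w (ipR B (X w) * ipR C (X w))%:E)%E; last first.
  by congr (_ + _)%E; exact: integral_ipRM.
apply: etrans (integralD measurableT (integrable_ipRM A C) (integrable_ipRM B C)).
by apply: eq_integral => w _; rewrite /= -EFinD ipRD mulrDl.
Qed.

Lemma covZ (t : R) A B : cov (t%:C%C *: A) B = t * cov A B.
Proof.
apply: EFin_inj.
transitivity (\int[P]_w (ipR (t%:C%C *: A) (X w) * ipR B (X w))%:E)%E.
  exact/esym/integral_ipRM.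
rewrite EFinM; transitivity (t%:E * \int[P]_w (ipR A (X w) * ipR B (X w))%:E)%E; last first.
  by congr (_ * _)%E; exact: integral_ipRM.
apply: etrans (integralZl measurableT (integrable_ipRM A B) _).
by apply: eq_integral => w _; rewrite /= -EFinM ipRZ mulrA.
Qed.

Lemma cov_ge0 A : 0 <= cov A A.
Proof. by rewrite fine_ge0// integral_ge0// => w _; rewrite lee_fin -expr2 sqr_ge0. Qed.

Lemma cov_L2norm A : A \is hermsymmx -> cov A A = L2norm X A ^+ 2.
Proof.
move=> hA; apply: EFin_inj; rewrite -(integral_ipRM A A) -(integral_sqr_ipR hA).
by [].
Qed.

Lemma integral_expR_ipR A (s : R) : A \is hermsymmx ->
  (\int[P]_w (expR (s * ipR A (X w)))%:E <=
   (expR (s ^+ 2 * b0 ^+ 2 * cov A A / 2))%:E)%E.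
Proof.
by move=> hA; have [/(_ A hA s)] := subX; rewrite unlock cov_L2norm.
Qed.

Lemma integral_expR_sqr_ipR A (K : R) : A \is hermsymmx -> b1 * L2norm X A < K ->
  (\int[P]_w (expR (ipR A (X w) ^+ 2 / K ^+ 2))%:E <= 2%:E)%E.
Proof.
move=> hA AK; have [_ /(_ A) H _] := subX.
have mA := measurable_ipRX A.
have mn : measurable_fun setT (fun w => `|ipR A (X w)|) by exact: measurableT_comp.
have E : (fun w => Normc.normc (mxip A (X w))) = (fun w => `|ipR A (X w)|).
  by apply/funext => w; rewrite normc_mxip.
rewrite E eL2normE in H.
have := psi2norm_lt_mgf mn (le_lt_trans H _) => /(_ K).
rewrite -EFinM lte_fin => /(_ AK).
by under eq_integral do rewrite real_normK ?num_real//.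
Qed.

End Covariance.

(** * Deviation inequalities for the sample *)

Section SameLaw.
Context d d' (T : measurableType d) (E : measurableType d') (R : realType)
  (P : probability T R).

Lemma integral_same_law (U V : {RV P >-> E}) (g : E -> \bar R) :
  identically_distributed U V -> measurable_fun setT g -> (forall x, 0 <= g x)%E ->
  (\int[P]_w g (U w) = \int[P]_w g (V w))%E.
Proof.
move=> UV mg g0.
rewrite -[LHS]/(\int[P]_w (g \o U) w)%E -[RHS]/(\int[P]_w (g \o V) w)%E.
rewrite -!ge0_integral_distribution//.
by apply: eq_measure_integral => B mB _; exact: UV.
Qed.

(** The failure of [Q] is only required to lie in a small measurable set: [Q] may quantify over
    uncountably many matrices or concern an estimator that is not known to be measurable. *)
Definition whp (u : R) (Q : T -> Prop) := exists B : set T,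
  [/\ measurable B, (P B <= (expR (- u))%:E)%E & forall w, ~ B w -> Q w].

Lemma whp_weaken u Q (Q' : T -> Prop) : (forall w, Q w -> Q' w) -> whp u Q -> whp u Q'.
Proof. by move=> QQ' [B [mB PB BQ]]; exists B; split => // w /BQ/QQ'. Qed.

Lemma whp_true u (Q : T -> Prop) : (forall w, Q w) -> whp u Q.
Proof. by move=> HQ; exists set0; split => //; rewrite measure0 lee_fin expR_ge0. Qed.

Lemma whp_forall (I : finType) (l u : R) (Q : I -> T -> Prop) :
  #|I|%:R <= expR l -> (forall i, whp (u + l) (Q i)) ->
  whp u (fun w => forall i, Q i w).
Proof.
move=> Il /choice[B HB]; exists (\bigcup_i B i); split.
- by apply: fin_bigcup_measurable => // i _; have [] := HB i.
- apply: (le_trans (union_bound (p := expR (- (u + l))) _ _)).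
  + by move=> i; have [] := HB i.
  + by move=> i; have [] := HB i.
  rewrite lee_fin; apply: (@le_trans _ _ (expR l * expR (- (u + l)))).
    by rewrite ler_wpM2r// expR_ge0.
  by rewrite -expRD ler_expR; lra.
- by move=> w nB i; have [_ _] := HB i; apply => Bi; apply: nB; exists i.
Qed.

Lemma whp_and u v (Q1 Q2 : T -> Prop) : whp u Q1 -> whp v Q2 ->
  exists B, [/\ measurable B, (P B <= (expR (- u) + expR (- v))%:E)%E &
    forall w, ~ B w -> Q1 w /\ Q2 w].
Proof.
move=> [B [mB PB HB]] [C [mC PC HC]]; exists (B `|` C); split.
- exact: measurableU.
- by rewrite (le_trans (measureU2 _ mB mC))// EFinD leeD.
- by move=> w nBC; split; [apply: HB => Bw; apply: nBC; left|apply: HC => Cw; apply: nBC; right].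
Qed.

End SameLaw.

Section Events.
Context d (T : measurableType d) (R : realType) (P : probability T R) (m n : nat).
Variables (X : {RV P >-> mxspace R m}) (Xs : 'I_n -> {RV P >-> mxspace R m}).
Variables (xi : {RV P >-> R}) (xis : 'I_n -> {RV P >-> R}).
Variables b0 b1 b2 : R.
Hypotheses (b0_gt0 : 0 < b0) (b1_gt0 : 0 < b1).
Hypothesis model : sampling_model X Xs xi xis.
Hypothesis subX : subgaussian X b0 b1 b2.
Implicit Types A B H : 'M[R[i]]_m.

Let hX : forall w, (X w : 'M[R[i]]_m) \is hermsymmx := design_hermitian model.
Let indep := sample_independent model.

Lemma whp_sum (f : mxspace R m * R -> R) (k u : R) : measurable_fun setT f ->
  (forall j, \int[P]_w (expR (f (Xs j w, xis j w)))%:E <= (expR k)%:E)%E ->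
  whp P u (fun w => \sum_j f (Xs j w, xis j w) <= n%:R * k + u).
Proof.
move=> mf Hk; exists [set w | n%:R * k + u < \sum_j f (Xs j w, xis j w)]; split.
- exact: measurable_sum_gt.
- exact: (chernoff_sum indep).
- by move=> w /= /negP; rewrite -leNgt.
Qed.

Lemma whp_sum_X (g : mxspace R m -> R) (k u : R) : measurable_fun setT g ->
  (\int[P]_w (expR (g (X w)))%:E <= (expR k)%:E)%E ->
  whp P u (fun w => \sum_j g (Xs j w) <= n%:R * k + u).
Proof.
move=> mg Hk.
apply: (@whp_sum (g \o fst)) => [|j]; first exact: measurableT_comp.
rewrite (@integral_same_law _ _ _ _ _ P (Xs j) X (fun x => (expR (g x))%:E))//.
- exact: sample_law model j.
- by apply/measurable_EFinP; exact: measurableT_comp.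
Qed.

Lemma whp_sum_xi (g : R -> R) (k u : R) : measurable_fun setT g ->
  (\int[P]_w (expR (g (xi w)))%:E <= (expR k)%:E)%E ->
  whp P u (fun w => \sum_j g (xis j w) <= n%:R * k + u).
Proof.
move=> mg Hk.
apply: (@whp_sum (g \o snd)) => [|j]; first exact: measurableT_comp.
rewrite (@integral_same_law _ _ _ _ _ P (xis j) xi (fun x => (expR (g x))%:E))//.
- exact: noise_law model j.
- by apply/measurable_EFinP; exact: measurableT_comp.
Qed.

(** Under the condition on [u], the deviation consumes at most half of the exponent n / (128 b1^4)
    gained from [mgf_sqr_lower]. *)
Lemma whp_quadratic_lower A u : A \is hermsymmx ->
  256 * b1 ^+ 4 * u <= n%:R ->
  whp P u (fun w => n%:R * cov X A A / 4 <= \sum_j ipR A (Xs j w) ^+ 2).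
Proof.
move=> hA un.
have [v0|vN0] := eqVneq (cov X A A) 0.
  by apply: whp_true => w; rewrite v0 mulr0 mul0r sumr_ge0// => j _; exact: sqr_ge0.
set v := cov X A A in vN0 *.
have v_gt0 : 0 < v by rewrite lt_neqAle eq_sym vN0 cov_ge0.
set l := L2norm X A.
have vE : v = l ^+ 2 by rewrite /v (cov_L2norm hX subX).
have l_gt0 : 0 < l.
  by rewrite lt_neqAle L2norm_ge0 andbT eq_sym; apply: contra_neq vN0; rewrite vE => ->; rewrite expr0n.
have K0 : 0 < 2 * b1 * l by rewrite !mulr_gt0.
have mA := measurable_ipRX X A.
have Ee : (\int[P]_w (expR (ipR A (X w) ^+ 2 / (2 * b1 * l) ^+ 2))%:E <= 2%:E)%E.
  apply: (integral_expR_sqr_ipR hX subX hA).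
  by rewrite -/l; have := mulr_gt0 b1_gt0 l_gt0; lra.
(* The minimizer of - la v + 2 la^2 K^4 for K = 2 b1 l; the minimum is - 1 / (128 b1^4), free of
   [A]. *)
pose la := (64 * b1 ^+ 4 * v)^-1.
have b4 : 0 < b1 ^+ 4 by rewrite exprn_gt0.
have la_gt0 : 0 < la by rewrite invr_gt0 !mulr_gt0.
have E2 : (\int[P]_w (ipR A (X w) ^+ 2)%:E = v%:E)%E by rewrite vE (integral_sqr_ipR hX subX).
have mgf := mgf_sqr_lower mA K0 (ltW la_gt0) E2 Ee.
apply: whp_weaken (@whp_sum_X (fun x => - (la * ipR A x ^+ 2)) _ u _ mgf); last first.
  apply: measurableT_comp => //; apply: measurable_funM => //.
  by apply: measurable_funX; exact: measurable_ipR.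
move=> w; rewrite sumrN -mulr_sumr => H.
have kE : - (la * v) + 2 * la ^+ 2 * (2 * b1 * l) ^+ 4 = - (128 * b1 ^+ 4)^-1.
  have -> : (2 * b1 * l) ^+ 4 = 16 * b1 ^+ 4 * v ^+ 2 by rewrite vE; ring.
  by rewrite /la; field; rewrite !gt_eqF.
rewrite kE in H.
have {}un : u <= n%:R * (256 * b1 ^+ 4)^-1.
  have b256 : 0 < 256 * b1 ^+ 4 by apply: mulr_gt0; [rewrite ltr0n|exact: b4].
  by rewrite (ler_pdivlMr _ _ b256) mulrC.
have e : n%:R * - (128 * b1 ^+ 4)^-1 = - 2 * (n%:R * (256 * b1 ^+ 4)^-1).
  by field; rewrite gt_eqF.
rewrite {}e in H.
have {un}H : n%:R * (256 * b1 ^+ 4)^-1 <= la * \sum_j ipR A (Xs j w) ^+ 2 by lra.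
move: H; rewrite -ler_pdivrMl//; apply: le_trans.
by rewrite le_eqVlt; apply/orP; left; apply/eqP; rewrite /la; field; rewrite !gt_eqF.
Qed.

Lemma whp_quadratic_upper A K u : A \is hermsymmx -> 0 < K -> b1 * L2norm X A < K ->
  whp P u (fun w => \sum_j ipR A (Xs j w) ^+ 2 <= K ^+ 2 * (n%:R + u)).
Proof.
move=> hA K0 AK.
have mgf : (\int[P]_w (expR (ipR A (X w) ^+ 2 / K ^+ 2))%:E <= (expR 1)%:E)%E.
  apply: (le_trans (integral_expR_sqr_ipR hX subX hA AK)).
  by rewrite lee_fin; apply: le_trans (expR_ge1Dx _); lra.
apply: whp_weaken (@whp_sum_X (fun x => ipR A x ^+ 2 / K ^+ 2) _ u _ mgf); last first.
  by apply: measurable_funM => //; apply: measurable_funX; exact: measurable_ipR.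
by move=> w; rewrite -mulr_suml ler_pdivrMr ?exprn_gt0// mulr1 mulrC.
Qed.

(** A product of two subgaussian variables is subexponential with parameter [K1 * K2], by 2 x y <=
    x^2 + y^2 in the exponent. The bounds by [K1] and [K2] are strict since the psi_2 norm is an
    infimum. *)
Lemma whp_bernstein H A K1 K2 u : H \is hermsymmx -> A \is hermsymmx ->
  0 < K1 -> 0 < K2 -> b1 * L2norm X H < K1 -> b1 * L2norm X A < K2 ->
  (0 < n)%N -> 0 < u ->
  whp P u (fun w => \sum_j ipR H (Xs j w) * ipR A (Xs j w) - n%:R * cov X H A <=
    10 * (K1 * K2) * Num.sqrt (u * (n%:R + u))).
Proof.
move=> hH hA K10 K20 HK AK n0 u0.
have nR : 0 < n%:R :> R by rewrite ltr0n.
set K := K1 * K2; have K0 : 0 < K by exact: mulr_gt0.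
pose Z x := ipR H x * ipR A x.
have mZ : measurable_fun setT Z by apply: measurable_funM; exact: measurable_ipR.
have EZ : (\int[P]_w (expR (`|Z (X w)| / K))%:E <= 2%:E)%E.
  have e1 := integral_expR_sqr_ipR hX subX hH HK.
  have e2 := integral_expR_sqr_ipR hX subX hA AK.
  have m1 : measurable_fun setT (fun w => expR (ipR H (X w) ^+ 2 / K1 ^+ 2)).
    apply: measurableT_comp => //; apply: measurable_funM => //.
    by apply: measurable_funX; exact: measurable_ipRX.
  have m2 : measurable_fun setT (fun w => expR (ipR A (X w) ^+ 2 / K2 ^+ 2)).
    apply: measurableT_comp => //; apply: measurable_funM => //.
    by apply: measurable_funX; exact: measurable_ipRX.
  have m3 : measurable_fun setT (fun w => expR (`|Z (X w)| / K)).
    apply: measurableT_comp => //; apply: measurable_funM => //.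
    by apply: measurableT_comp => //; exact: measurableT_comp.
  have mz : measurable_fun setT (cst 0 : T -> R) by [].
  have h0 : 0 <= 2^-1 :> R by lra.
  have := @le_integral_linear _ _ _ P _ _ _ _ 0 0 2^-1 2^-1 m3 mz m1 m2
    (fun=> expR_ge0 _) (fun=> lexx _) (fun=> expR_ge0 _) (fun=> expR_ge0 _)
    (lexx _) (lexx _) h0 h0.
  rewrite mul0e adde0 add0e => Hle; apply: (le_trans (Hle _)).
    move=> w /=; rewrite mulr0 addr0 add0r.
    set a := ipR H (X w) ^+ 2 / K1 ^+ 2; set b := ipR A (X w) ^+ 2 / K2 ^+ 2.
    have le : `|Z (X w)| / K <= a / 2 + b / 2.
      rewrite /a /b /Z /K normrM -(real_normK (num_real (ipR H _))) -(real_normK (num_real (ipR A _))).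
      set x := `|_|; set y := `|_|.
      have := sqr_ge0 (x / K1 - y / K2).
      have -> : (x / K1 - y / K2) ^+ 2 = x ^+ 2 / K1 ^+ 2 + y ^+ 2 / K2 ^+ 2 - 2 * (x * y / (K1 * K2)).
        by field; rewrite !gt_eqF.
      lra.
    have : expR (`|Z (X w)| / K) <= expR (a / 2) * expR (b / 2) by rewrite -expRD ler_expR.
    have -> : expR a = expR (a / 2) ^+ 2 by rewrite expr2 -expRD -splitr.
    have -> : expR b = expR (b / 2) ^+ 2 by rewrite expr2 -expRD -splitr.
    have := sqr_ge0 (expR (a / 2) - expR (b / 2)); rewrite sqrrB; lra.
  have -> : (2%:E = (2^-1)%:E * 2%:E + (2^-1)%:E * 2%:E :> \bar R)%E.
    by rewrite -!EFinM -!EFinD; congr EFin; lra.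
  by apply: leeD; apply: lee_wpmul2l; rewrite ?lee_fin.
(* Being at most 1 for every [u], it keeps [la] in the range allowed by [mgf_bernstein], so small
   and large deviations are treated at once. *)
pose th := Num.sqrt (u / (n%:R + u)).
have nu0 : 0 < n%:R + u by rewrite addr_gt0.
have th0 : 0 < th by rewrite sqrtr_gt0 divr_gt0.
have th1 : th <= 1.
  by rewrite -[leRHS]sqrtr1 ler_wsqrtr// ler_pdivrMr// mul1r lerDr ltW.
pose la := th / (2 * K).
have la0 : 0 < la by rewrite divr_gt0// mulr_gt0.
have laK : 2 * la * K <= 1.
  have -> : 2 * la * K = th by rewrite /la; field; rewrite gt_eqF.
  by [].
have mgf := mgf_bernstein (integrable_ipRM subX H A) (integral_ipRM subX H A) K0 (ltW la0) laK EZ.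
apply: whp_weaken (@whp_sum_X (fun x => la * Z x) _ u _ mgf); last exact: measurable_funM.
move=> w; rewrite -mulr_sumr -/(cov X H A) => Hw.
have {}Hw : \sum_j Z (Xs j w) - n%:R * cov X H A <= 16 * n%:R * la * K ^+ 2 + u / la.
  rewrite -(ler_pM2l la0); apply: (@le_trans _ _ (16 * n%:R * la ^+ 2 * K ^+ 2 + u)); first by lra.
  by rewrite le_eqVlt; apply/orP; left; apply/eqP; field; rewrite gt_eqF.
apply: (le_trans Hw).
set sq := Num.sqrt (u * (n%:R + u)).
have E1 : u / la = 2 * K * sq.
  have -> : u = sq * th.
    rewrite /sq /th -sqrtrM ?mulr_ge0 ?(ltW u0) ?(ltW nu0)//.
    rewrite (_ : u * (n%:R + u) * (u / (n%:R + u)) = u ^+ 2); last by field; rewrite gt_eqF.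
    by rewrite sqrtr_sqr ger0_norm// ltW.
  by rewrite /la; field; rewrite !gt_eqF.
have E2 : n%:R * th <= sq.
  have -> : sq = (n%:R + u) * th.
    rewrite /sq /th (_ : u * (n%:R + u) = (n%:R + u) ^+ 2 * (u / (n%:R + u))).
      by rewrite sqrtrM ?sqr_ge0// sqrtr_sqr (ger0_norm (ltW nu0)).
    by field; rewrite gt_eqF.
  by rewrite ler_wpM2r ?(ltW th0)// lerDl ltW.
have E3 : 16 * n%:R * la * K ^+ 2 = 8 * K * (n%:R * th) by rewrite /la; field; rewrite gt_eqF.
rewrite E1 E3.
have : 8 * K * (n%:R * th) <= 8 * K * sq by rewrite ler_wpM2l// mulr_ge0// ltW.
lra.
Qed.

(* Given the noise y, the moment generating function of s y <A, X> - c y^2 is at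
   most 1 as soon as c = s^2 b0^2 l^2 / 2. *)
Lemma whp_linear A l v u : A \is hermsymmx -> cov X A A <= l ^+ 2 ->
  0 < l -> 0 < v -> 0 < u ->
  whp P u (fun w => \sum_j xis j w ^+ 2 <= v ->
    \sum_j xis j w * ipR A (Xs j w) <= 2 * b0 * l * Num.sqrt (u * v)).
Proof.
move=> hA Al l0 v0 u0.
(* Balances the two terms of the Chernoff bound u + c v: here c v = u / 2. *)
pose s := Num.sqrt (u / v) / (b0 * l).
have s0 : 0 < s by rewrite divr_gt0 ?sqrtr_gt0 ?divr_gt0// mulr_gt0.
pose c := s ^+ 2 * b0 ^+ 2 * l ^+ 2 / 2.
pose f (z : mxspace R m * R) := s * (z.2 * ipR A z.1) - c * z.2 ^+ 2.
have mf : measurable_fun setT f.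
  apply: measurable_funB; apply: measurable_funM => //.
    apply: measurable_funM => //; apply: measurableT_comp => //; exact: measurable_ipR.
  exact: measurable_funX.
have Hk j : (\int[P]_w (expR (f (Xs j w, xis j w)))%:E <= (expR 0)%:E)%E.
  rewrite (ge0_integral_indep_pair indep j (h := fun z => (expR (f z))%:E)); first last.
  - by move=> x; rewrite lee_fin expR_ge0.
  - by apply/measurable_EFinP; exact: measurableT_comp.
  rewrite expR0.
  have in1 y : (\int[distribution P (Xs j)]_x (expR (f (x, y)))%:E <= 1)%E.
    have my : measurable_fun setT (fun x : mxspace R m => (expR (f (x, y)))%:E).
      apply/measurable_EFinP; apply: measurableT_comp => //; apply: measurableT_comp => //.
    rewrite ge0_integral_distribution//.
    rewrite -[leLHS]/(\int[P]_w ((fun x : mxspace R m => (expR (f (x, y)))%:E) (Xs j w)))%E.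
    rewrite (integral_same_law (sample_law model j) my)//.
    have e1 := integral_expR_ipR hX subX (s * y) hA.
    have -> : (\int[P]_w (expR (f (X w, y)))%:E =
        (expR (- (c * y ^+ 2)))%:E * \int[P]_w (expR (s * y * ipR A (X w)))%:E)%E.
      have me : measurable_fun setT (fun w => (expR (s * y * ipR A (X w)))%:E).
        apply/measurable_EFinP; apply: measurableT_comp => //; apply: measurable_funM => //.
        exact: measurable_ipRX.
      have e0 w : (0 <= (expR (s * y * ipR A (X w)))%:E)%E by rewrite lee_fin expR_ge0.
      rewrite -ge0_integralZl ?lee_fin ?expR_ge0//.
      by apply: eq_integral => w _; rewrite -EFinM -expRD /f /= mulrA addrC.
    apply: (@le_trans _ _ ((expR (- (c * y ^+ 2)))%:E *
      (expR ((s * y) ^+ 2 * b0 ^+ 2 * cov X A A / 2))%:E)%E).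
      by apply: lee_wpmul2l; rewrite ?lee_fin ?expR_ge0.
    rewrite -EFinM -expRD lee_fin -[leRHS]expR0 ler_expR addrC subr_le0 /c.
    have h : 0 <= s ^+ 2 * b0 ^+ 2 * y ^+ 2 / 2.
      by rewrite -!exprMn; apply: divr_ge0; [exact: sqr_ge0|].
    rewrite (_ : (s * y) ^+ 2 * _ * _ / _ = s ^+ 2 * b0 ^+ 2 * y ^+ 2 / 2 * cov X A A); last by field.
    rewrite [leRHS](_ : _ = s ^+ 2 * b0 ^+ 2 * y ^+ 2 / 2 * l ^+ 2); last by field.
    by apply: ler_wpM2l.
  apply: (@le_trans _ _ (\int[distribution P (xis j)]_y 1)%E); last first.
    by rewrite integral_cst//= mul1e /distribution /pushforward preimage_setT probability_setT.
  apply: ge0_le_integral => //.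
  - by move=> y _; apply: integral_ge0 => x _; rewrite lee_fin expR_ge0.
  - apply: (measurable_fun_fubini_tonelli_G (m1 := distribution P (Xs j)) (fun z => (expR (f z))%:E)).
      by apply/measurable_EFinP; exact: measurableT_comp.
    by move=> z; rewrite lee_fin expR_ge0.
apply: whp_weaken (whp_sum u mf Hk).
move=> w; rewrite mulr0 add0r => Hw xv.
have c0 : 0 < c.
  by apply: divr_gt0; [rewrite -!exprMn; apply: exprn_gt0; exact: mulr_gt0 (mulr_gt0 s0 b0_gt0) l0|].
have {}Hw : s * (\sum_j xis j w * ipR A (Xs j w)) <= u + c * v.
  move: Hw; rewrite /f /= sumrB -!mulr_sumr lerBlDr => /le_trans; apply.
  by rewrite lerD2l ler_wpM2l// ltW.
rewrite -(ler_pM2l s0); apply: (le_trans Hw).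
have uv : s * Num.sqrt (u * v) = u / (b0 * l).
  rewrite /s mulrAC -sqrtrM ?divr_ge0 ?ltW//.
  rewrite (_ : u / v * (u * v) = u ^+ 2); last by field; rewrite gt_eqF.
  by rewrite sqrtr_sqr ger0_norm// ltW.
have cv : c * v = u / 2.
  rewrite /c /s expr_div_n sqr_sqrtr ?divr_ge0 ?ltW//.
  by field; rewrite !gt_eqF.
have -> : s * (2 * b0 * l * Num.sqrt (u * v)) = 2 * u.
  rewrite mulrCA uv; field; rewrite !gt_eqF//.
rewrite cv; lra.
Qed.

End Events.

(** * The operator $\mathcal P_L$ *)

Section OrthoProj.
Variables (R : realType) (m : nat).
Implicit Types (L A S : 'M[R[i]]_m).

Lemma onemx_sub_eq (p1 p2 : 'M[R[i]]_m) :
  (forall W : 'M[R[i]]_m, W *m p1 + W *m p2 = W) -> 1%:M - p1 = p2.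
Proof. by move=> /(_ 1%:M); rewrite !mul1mx => <-; rewrite addrAC subrr add0r. Qed.

Lemma orthoproj_idem L : orthoproj L *m orthoproj L = orthoproj L.
Proof. by rewrite /orthoproj -trmx_mul proj_ortho_proj. Qed.

(** The ranges of P and 1 - P are orthogonal, so P = P P^*, which is self-adjoint. *)
Lemma proj_ortho_trmxC L : (proj_ortho L)^t* = proj_ortho L.
Proof.
have : proj_ortho L *m (1%:M - proj_ortho L)^t* = 0.
  apply/orthomx1P; rewrite orthomx_sym.
  have := proj_ortho_compl_sub L 1%:M; rewrite mul1mx => /submx_trans; apply.
  by rewrite (eqmx_ortho _ (proj_orthoE L)).
rewrite trmxCB mulmxBr => /eqP; rewrite subr_eq0 trmx1 map_mx1 mulmx1 => /eqP E.
by rewrite E trmxCM trmxCK.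
Qed.

Lemma orthoproj_herm L : (orthoproj L)^t* = orthoproj L.
Proof.
rewrite /orthoproj trmxK; apply: trmx_inj; rewrite trmxK -[RHS]proj_ortho_trmxC.
by rewrite map_trmx.
Qed.

(** The complement of the projection onto L^perp projects onto the double complement, that is L;
    transposition keeps the rank. *)
Lemma rank_orthoproj_compl L : \rank (1%:M - orthoproj (orthocompl L)) = \rank L.
Proof.
have -> : 1%:M - orthoproj (orthocompl L) =
    (1%:M - proj_ortho (orthocompl L))^T by rewrite linearB /= trmx1.
rewrite mxrank_tr.
have E : 1%:M - proj_ortho (orthocompl L) = proj_ortho (orthocompl (orthocompl L)).
  apply: onemx_sub_eq => W; exact: add_proj_ortho.
rewrite E; transitivity (\rank (orthocompl (orthocompl L))).
  by apply: eqmx_rank; apply/eqmxP; exact: proj_orthoE.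
by apply: eqmx_rank; apply/eqmxP; exact: ortho_id.
Qed.

Lemma nucnorm_psd A : A \is hermsymmx -> psdmx A -> nucnorm A = complex.Re (\tr A).
Proof.
move=> hA pA; rewrite /nucnorm; have /hermsymmxP -> := hA.
have E : A *m A = mxfun (fun x => x * x) A by rewrite -mxfunM mxfun_id.
have hAA : A *m A \is hermsymmx.
  by apply/hermsymmxP; rewrite trmxCM (hermsymmxP _ hA).
rewrite (mxfun_comp (@Num.sqrt R) hAA E).
suff -> : mxfun (@Num.sqrt R \o (fun x => x * x)) A = mxfun id A by rewrite mxfun_id.
apply: eq_mxfun => i; rewrite [LHS]/=.
by rewrite -expr2 sqrtr_sqr ger0_norm// psdmx_evals.
Qed.

Lemma compress_herm Q S : Q^t* = Q -> S \is hermsymmx -> Q *m S *m Q \is hermsymmx.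
Proof.
by move=> hQ /hermsymmxP hS; apply/hermsymmxP; rewrite !trmxCM hS hQ mulmxA.
Qed.

Lemma compress_psd Q S : Q^t* = Q -> psdmx S -> psdmx (Q *m S *m Q).
Proof.
by move=> hQ pS v; have := pS (Q *m v); rewrite !mulmxA trmx_mul map_mxM hQ ?mulmxA.
Qed.

Lemma tr_compress Q S : Q *m Q = Q -> \tr (Q *m S *m Q) = \tr (Q *m S).
Proof. by move=> QQ; rewrite mxtrace_mulC mulmxA QQ. Qed.

Lemma calP_herm L A : A \is hermsymmx -> calP L A \is hermsymmx.
Proof.
move=> /hermsymmxP hA; apply/hermsymmxP.
by rewrite /calP trmxCB !trmxCM hA orthoproj_herm mulmxA.
Qed.

Lemma calP_rank0 L A : \rank L = 0%N -> calP L A = 0.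
Proof.
rewrite -rank_orthoproj_compl => /eqP; rewrite mxrank_eq0 subr_eq0 => /eqP E.
by rewrite /calP -E mul1mx mulmx1 subrr.
Qed.

(** Writes P_L A as W + W^* with the columns of W in the range of P; the coefficient 1/2 avoids
    counting P A P twice. *)
Lemma herm_compress_split (P A : 'M[R[i]]_m) : P^t* = P -> A^t* = A ->
  A - (1%:M - P) *m A *m (1%:M - P) =
  P *m (A *m (1%:M - (2^-1 : R)%:C%C *: P)) + (P *m (A *m (1%:M - (2^-1 : R)%:C%C *: P)))^t*.
Proof.
move=> hP hA.
have E X Y (Z := X *m Y *m X) : (1%:M - X) *m Y *m (1%:M - X) = Y - X *m Y - Y *m X + Z.
  by rewrite mulmxBl mul1mx mulmxBr mulmx1 mulmxBl opprB addrA addrAC.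
rewrite E; set H := (2^-1 : R)%:C%C.
have -> : P *m (A *m (1%:M - H *: P)) = P *m A - H *: (P *m A *m P).
  by rewrite mulmxBr mulmx1 mulmxBr -!scalemxAr mulmxA.
rewrite trmxCB trmxC_scale !trmxCM hP hA mulmxA.
move: (P *m A) (A *m P) (P *m A *m P) => X Y Z.
have -> : X - H *: Z + (Y - H *: Z) = X + Y - Z.
  rewrite addrACA -opprD -scalerDl; congr (_ - _).
  rewrite -[RHS]scale1r; congr (_ *: _); rewrite -rmorphD -[RHS](rmorph1 (real_complex R)).
  by congr (_%:C)%C; lra.
by rewrite !opprD !opprK !addrA subrr add0r.
Qed.

Let Pr L := 1%:M - orthoproj (orthocompl L).

(** W runs through a real basis of the matrices whose columns lie in the range of [Pr L], whence 2 m
    r real generators; [herm_compress_split] shows that they span every [calP L A] with A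
    Hermitian. *)
Definition calP_gen L (k : ('I_(\rank (Pr L)) * 'I_m) * bool) : 'M[R[i]]_m :=
  let W := (if k.2 then 'i%C else 1) *: (col_base (Pr L) *m delta_mx k.1.1 k.1.2) in
  W + W^t*.

Lemma calP_gen_herm L k : @calP_gen L k \is hermsymmx.
Proof. by apply/hermsymmxP; rewrite /calP_gen trmxCD trmxCK addrC. Qed.

Lemma trmxC_sum (I : finType) (F : I -> 'M[R[i]]_m) :
  (\sum_k F k)^t* = \sum_k (F k)^t*.
Proof. by rewrite !linear_sum /= raddf_sum. Qed.

Lemma calP_span L A : A \is hermsymmx ->
  exists c, calP L A = \sum_k (c k)%:C%C *: @calP_gen L k.
Proof.
move=> /hermsymmxP hA; set Q := orthoproj (orthocompl L).
have hP : (Pr L)^t* = Pr L by rewrite /Pr trmxCB trmx1 map_mx1 orthoproj_herm.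
have -> : calP L A = A - (1%:M - Pr L) *m A *m (1%:M - Pr L) by rewrite /calP /Pr subKr.
rewrite (herm_compress_split hP hA).
move: (A *m _) => W0.
have [W ->] : exists W, Pr L *m W0 = col_base (Pr L) *m W.
  by exists (row_base (Pr L) *m W0); rewrite mulmxA mulmx_base.
exists (fun k => if k.2 then complex.Im (W k.1.1 k.1.2) else complex.Re (W k.1.1 k.1.2)).
have E : col_base (Pr L) *m W = \sum_k (if k.2 then complex.Im (W k.1.1 k.1.2)
     else complex.Re (W k.1.1 k.1.2))%:C%C *:
   ((if k.2 then 'i%C else 1) *: (col_base (Pr L) *m delta_mx k.1.1 k.1.2)).
  rewrite -(pair_bigA _ (fun p b => (if b then complex.Im (W p.1 p.2)
     else complex.Re (W p.1 p.2))%:C%C *: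
   ((if b then 'i%C else 1) *: (col_base (Pr L) *m delta_mx p.1 p.2)))) /=.
  rewrite {1}[W]matrix_sum_delta mulmx_sumr -(pair_bigA _ (fun i j => \sum_b
   (if b then complex.Im (W i j) else complex.Re (W i j))%:C%C *:
   ((if b then 'i%C else 1) *: (col_base (Pr L) *m delta_mx i j)))) /=.
  apply: eq_bigr => i _; rewrite mulmx_sumr; apply: eq_bigr => j _.
  rewrite big_bool /= -scalemxAr !scalerA -scalerDl; congr (_ *: _).
  by case: (W i j) => a b; apply/eqP; rewrite eq_complex /=; apply/andP; split; apply/eqP; ring.
rewrite E trmxC_sum -big_split; apply: eq_bigr => k _ /=.
by rewrite trmxC_scale -scalerDr.
Qed.

Lemma card_calP_gen L : #|{: ('I_(\rank (Pr L)) * 'I_m) * bool}| = (2 * (m * \rank L))%N.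
Proof.
by rewrite !card_prod card_bool !card_ord rank_orthoproj_compl mulnC (mulnC m).
Qed.

End OrthoProj.

(** * Uniform deviation bounds *)

Section Whp.
Context d d' (T : measurableType d) (E : measurableType d') (R : realType)
  (P : probability T R).

(** Each conjunction costs 1 in the exponent, since 2 e^{-1} <= 1; this explains the levels t + 1, t
    + 2 and t + 3 below. *)
Lemma whp_conj u (Q1 Q2 : T -> Prop) : whp P (u + 1) Q1 -> whp P (u + 1) Q2 ->
  whp P u (fun w => Q1 w /\ Q2 w).
Proof.
move=> h1 h2; have [B [mB PB HB]] := whp_and h1 h2; exists B; split => //.
apply: (le_trans PB); rewrite lee_fin opprD expRD.
have e1 : 2 * expR (-1) <= 1 :> R.
  by rewrite expRN ler_pdivrMr ?expR_gt0// mul1r; apply: le_trans (expR_ge1Dx _).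
have := ler_wpM2l (expR_ge0 (- u)) e1; lra.
Qed.

Lemma whp_le u v (Q : T -> Prop) : u <= v -> whp P v Q -> whp P u Q.
Proof.
move=> uv [B [mB PB HB]]; exists B; split => //; apply: (le_trans PB).
by rewrite lee_fin ler_expR lerN2.
Qed.

Lemma whp_zero (U V : {RV P >-> E}) (g : E -> R) : identically_distributed U V ->
  measurable_fun setT g -> (\int[P]_w (g (V w) ^+ 2)%:E = 0)%E ->
  forall u, whp P u (fun w => g (U w) = 0).
Proof.
move=> UV mg g0 u.
have mg2 : measurable_fun setT (fun x => (g x ^+ 2)%:E).
  by apply/measurable_EFinP; exact: measurable_funX.
have gU : (\int[P]_w (g (U w) ^+ 2)%:E = 0)%E.
  by rewrite (integral_same_law UV mg2)// => x; rewrite lee_fin sqr_ge0.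
have mgU : measurable_fun setT (fun w => (g (U w) ^+ 2)%:E) by exact: measurableT_comp mg2 _.
have := (ae_eq_integral_abs P measurableT mgU).1; case.
  by rewrite -[RHS]gU; apply: eq_integral => w _; rewrite gee0_abs// lee_fin sqr_ge0.
move=> B [mB PB HB]; exists B; split => //; first by rewrite PB lee_fin expR_ge0.
move=> w nB; have := contra_not (HB w) nB => /= /contrapT /(_ Logic.I) [] /eqP.
by rewrite sqrf_eq0 => /eqP.
Qed.

End Whp.

Section FrameFunctionals.
Variables (R : realType) (m : nat) (f : 'M[R[i]]_m -> R) (M : R).
Hypothesis fD : forall A B, f (A + B) = f A + f B.
Hypothesis fZ : forall (t : R) A, f (t%:C%C *: A) = t * f A.
Hypothesis fM : forall k l, f (frame R k l) <= M.
Implicit Types A B S : 'M[R[i]]_m.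

Let cC : convexmx [set A | f A <= M].
Proof.
move=> t A B /andP[t0 t1] /= fA fB; rewrite mixmxE fD !fZ.
have h1 : 0 <= 1 - t by lra.
have := ler_wpM2l h1 fA; have := ler_wpM2l t0 fB; lra.
Qed.

Lemma frame_diff_le A B : density R m A -> density R m B -> f (A - B) <= 2 * M.
Proof.
move=> dA dB; have := density_diff_hull cC fM dA dB; rewrite /= fZ; lra.
Qed.

(** Every eigenprojection lies in the hull of the frames and the eigenvalues sum to the trace. It
    serves for compressions of densities, whose trace may be small. *)
Lemma frame_psd_le A : A \is hermsymmx -> psdmx A -> f A <= M * complex.Re (\tr A).
Proof.
move=> hA pA; rewrite [in leLHS](herm_rank1_sum hA) tr_evals//.
have -> : f (\sum_i (evals A i)%:C%C *: outer (row i (spectralmx A)) (row i (spectralmx A))) =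
    \sum_i evals A i * f (outer (row i (spectralmx A)) (row i (spectralmx A))).
  elim/big_rec2: _ => [|i y z _ <-]; last by rewrite fD fZ.
  by have := fZ 0 0; rewrite scaler0 mul0r.
rewrite mulr_sumr; apply: ler_sum => i _; rewrite mulrC ler_wpM2r ?psdmx_evals//.
exact: (eigen_outer_hull cC fM).
Qed.

End FrameFunctionals.

(** Two lattices in dimension 2 m with at most e^{12 m} points each; the source of every [24 * m%:R]
    in the deviation levels. *)
Lemma card_frame_pairs (R : realType) m :
  #|{: lattice_pt (m + m) * lattice_pt (m + m)}|%:R <= expR (24 * m%:R) :> R.
Proof.
have H := @card_lattice_pt R (m + m).
rewrite card_prod natrM (_ : 24 * m%:R = 6 * (m + m)%:R + 6 * (m + m)%:R); last first.
  by rewrite natrD; ring.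
by rewrite expRD; apply: ler_pM.
Qed.

Lemma density_sqfrob (R : realType) m (S : 'M[R[i]]_m) : density R m S -> sqfrob S <= 1.
Proof.
move=> dS; have [hS _ _] := dS; rewrite sqfrobE (hermsymmxP _ hS).
have -> : S *m S = mxfun (fun x => x * x) S by rewrite -mxfunM mxfun_id.
rewrite tr_mxfun -(density_sum_evals dS); apply: ler_sum => i _.
rewrite -[leRHS]mulr1 ler_wpM2l ?density_evals_ge0//.
rewrite -(density_sum_evals dS) (bigD1 i)//= lerDl sumr_ge0// => j _.
exact: density_evals_ge0.
Qed.

Section UniformEvents.
Context d (T : measurableType d) (R : realType) (P : probability T R) (m n : nat).
Variables (X : {RV P >-> mxspace R m}) (Xs : 'I_n -> {RV P >-> mxspace R m}).
Variables (xi : {RV P >-> R}) (xis : 'I_n -> {RV P >-> R}).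
Variables b0 b1 b2 : R.
Hypotheses (b0_gt0 : 0 < b0) (b1_gt0 : 0 < b1) (b2_gt0 : 0 < b2).
Hypothesis n_gt0 : (0 < n)%N.
Hypothesis m_gt0 : (0 < m)%N.
Hypothesis model : sampling_model X Xs xi xis.
Hypothesis subX : subgaussian X b0 b1 b2.
Implicit Types A B H : 'M[R[i]]_m.

Let hX : forall w, (X w : 'M[R[i]]_m) \is hermsymmx := design_hermitian model.
Let nR : 0 < n%:R :> R. Proof. by rewrite ltr0n. Qed.
Let m1 : 1 <= m%:R :> R. Proof. by rewrite ler1n. Qed.

Lemma frobnorm_sqfrob A : frobnorm A = Num.sqrt (sqfrob A).
Proof. by rewrite sqfrobE. Qed.

Lemma L2norm_frame k l : L2norm X (frame R k l) <= b2 * 4.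
Proof.
apply: (le_trans (L2norm_le subX _)); rewrite ler_wpM2l ?(ltW b2_gt0)//.
rewrite frobnorm_sqfrob (_ : 4 = Num.sqrt (4 ^+ 2)); last by rewrite sqrtr_sqr ger0_norm.
by rewrite ler_wsqrtr// (le_trans (sqfrob_frame _ _ _))//; lra.
Qed.

Lemma L2norm_density_diff A B : density R m A -> density R m B ->
  L2norm X (A - B) <= b2 * 2.
Proof.
move=> dA dB; apply: (le_trans (L2norm_le subX _)); rewrite ler_wpM2l ?(ltW b2_gt0)//.
rewrite frobnorm_sqfrob (_ : 2 = Num.sqrt (2 ^+ 2)); last by rewrite sqrtr_sqr ger0_norm.
rewrite ler_wsqrtr//; apply: (le_trans (sqfrobD_le _ _)).
have -> : sqfrob (- B) = sqfrob B.
  rewrite /sqfrob; apply: eq_bigr => i _; apply: eq_bigr => j _; rewrite mxE.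
  by case: (B i j) => a b; rewrite /sqnormc /= !sqrrN.
have := density_sqfrob dA; have := density_sqfrob dB; lra.
Qed.

Lemma density_diff_herm A B : density R m A -> density R m B -> A - B \is hermsymmx.
Proof.
by move=> [/hermsymmxP hA _ _] [/hermsymmxP hB _ _]; apply/hermsymmxP; rewrite trmxCB hA hB.
Qed.

Lemma whp_frames u (Q : lattice_pt (m + m) -> lattice_pt (m + m) -> T -> Prop) :
  (forall k l, whp P (u + 24 * m%:R) (Q k l)) -> whp P u (fun w => forall k l, Q k l w).
Proof.
move=> HQ; have := whp_forall (card_frame_pairs R m) (fun kl => HQ kl.1 kl.2).
by apply: whp_weaken => w H k l; exact: (H (k, l)).
Qed.

Lemma whp_frames_linear (u v : R) : 0 < v -> 0 < u ->
  whp P u (fun w => \sum_j xis j w ^+ 2 <= v -> forall k l,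
    \sum_j xis j w * ipR (frame R k l) (Xs j w) <=
      8 * b0 * b2 * Num.sqrt ((u + 24 * m%:R) * v)).
Proof.
move=> v0 u0.
have u'0 : 0 < u + 24 * m%:R by have := m1; lra.
suff : whp P u (fun w => forall k l, \sum_j xis j w ^+ 2 <= v ->
    \sum_j xis j w * ipR (frame R k l) (Xs j w) <=
      8 * b0 * b2 * Num.sqrt ((u + 24 * m%:R) * v)).
  by apply: whp_weaken => w H xv k l; exact: H.
apply: whp_frames => k l.
have := @whp_linear _ _ _ _ _ _ _ _ _ _ _ _ _ b0_gt0 model subX (frame R k l) (4 * b2) v _
  (frame_herm R k l) _ _ v0 u'0.
have l0 : 0 < 4 * b2 by have := b2_gt0; lra.
have cl : cov X (frame R k l) (frame R k l) <= (4 * b2) ^+ 2.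
  rewrite (cov_L2norm hX subX (frame_herm R k l)) ler_pXn2r ?nnegrE ?L2norm_ge0 ?(ltW l0)//.
  by rewrite mulrC L2norm_frame.
move=> /(_ cl l0); apply: whp_weaken => w /= H xv; apply: (le_trans (H xv)).
by rewrite le_eqVlt; apply/orP; left; apply/eqP; ring.
Qed.

Lemma whp_frames_bernstein H K1 u : H \is hermsymmx -> 0 < K1 -> b1 * L2norm X H < K1 ->
  0 < u ->
  whp P u (fun w => forall k l,
    \sum_j ipR H (Xs j w) * ipR (frame R k l) (Xs j w) - n%:R * cov X H (frame R k l) <=
    50 * (K1 * (b1 * b2)) * Num.sqrt ((u + 24 * m%:R) * (n%:R + (u + 24 * m%:R)))).
Proof.
move=> hH K10 HK u0; apply: whp_frames => k l.
have u'0 : 0 < u + 24 * m%:R by have := m1; lra.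
have bb : 0 < b1 * b2 by exact: mulr_gt0.
have K2 : b1 * L2norm X (frame R k l) < 5 * (b1 * b2).
  have := ler_wpM2l (ltW b1_gt0) (L2norm_frame k l); lra.
have K20 : 0 < 5 * (b1 * b2) by lra.
have := whp_bernstein model subX hH (frame_herm R k l) K10 K20 HK K2 n_gt0 u'0.
apply: whp_weaken => w /= Hw; apply: (le_trans Hw).
by rewrite le_eqVlt; apply/orP; left; apply/eqP; ring.
Qed.

End UniformEvents.

Section SubspaceEvent.
Context d (T : measurableType d) (R : realType) (P : probability T R) (m n : nat).
Variables (X : {RV P >-> mxspace R m}) (Xs : 'I_n -> {RV P >-> mxspace R m}).
Variables (xi : {RV P >-> R}) (xis : 'I_n -> {RV P >-> R}).
Variables b0 b1 b2 : R.
Hypotheses (b0_gt0 : 0 < b0) (b1_gt0 : 0 < b1) (b2_gt0 : 0 < b2).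
Hypothesis model : sampling_model X Xs xi xis.
Hypothesis subX : subgaussian X b0 b1 b2.
Implicit Types A B H : 'M[R[i]]_m.

Let hX : forall w, (X w : 'M[R[i]]_m) \is hermsymmx := design_hermitian model.

Lemma ler_natr_expR k : k%:R <= expR k%:R :> R.
Proof. by apply: le_trans (expR_ge1Dx _); rewrite lerDr. Qed.

Lemma whp_null A u : cov X A A = 0 -> whp P u (fun w => forall j, ipR A (Xs j w) = 0).
Proof.
move=> A0; apply: (@whp_forall _ _ _ _ 'I_n n%:R); first by rewrite card_ord ler_natr_expR.
move=> j; apply: (whp_zero (sample_law model j) (@measurable_ipR _ _ A)).
transitivity (cov X A A)%:E; last by rewrite A0.
by rewrite -(integral_ipRM subX).
Qed.

Lemma cov_sum (I : Type) (s : seq I) (c : I -> R) (F : I -> 'M[R[i]]_m) A :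
  cov X (\sum_(k <- s) (c k)%:C%C *: F k) A = \sum_(k <- s) c k * cov X (F k) A.
Proof.
elim: s => [|k s IH]; last by rewrite !big_cons (covD subX) (covZ subX) IH.
rewrite !big_nil -(scale0r (0 : 'M[R[i]]_m)) -(rmorph0 (real_complex R)) (covZ subX).
by rewrite mul0r.
Qed.

Lemma herm_lincomb (I : finType) (s : seq I) (c : I -> R) (F : I -> 'M[R[i]]_m) :
  (forall k, F k \is hermsymmx) -> \sum_(k <- s) (c k)%:C%C *: F k \is hermsymmx.
Proof.
move=> hF; apply/hermsymmxP; elim: s => [|k s IH].
  by rewrite big_nil trmx0 map_mx0.
by rewrite big_cons trmxCD IH trmxC_scale (hermsymmxP _ (hF k)).
Qed.

(* The coordinates are taken in a Gram-Schmidt basis for the covariance; the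
   part of G k it misses vanishes almost surely on the sample. *)
Lemma whp_subspace (I : finType) (G : I -> 'M[R[i]]_m) (u v : R) :
  (forall k, G k \is hermsymmx) -> 0 < v -> 0 < u ->
  whp P u (fun w => \sum_j xis j w ^+ 2 <= v -> forall c : I -> R,
    \sum_j xis j w * ipR (\sum_k (c k)%:C%C *: G k) (Xs j w) <=
    4 * b0 * Num.sqrt ((u + 1 + 6 * #|I|%:R) * v) *
      L2norm X (\sum_k (c k)%:C%C *: G k)).
Proof.
move=> hG v0 u0.
have [e [se eo eN eh]] := @gram_schmidt R 'M[R[i]]_m (fun t A => t%:C%C *: A) (cov X)
  (covC X) (covD subX) (covZ subX) (cov_ge0 X) [set A | A \is hermsymmx]
  ltac:(by apply/hermsymmxP; rewrite trmx0 map_mx0)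
  ltac:(by move=> A B /hermsymmxP hA /hermsymmxP hB; apply/hermsymmxP; rewrite trmxCB hA hB)
  ltac:(by move=> t A /hermsymmxP hA; apply/hermsymmxP; rewrite trmxC_scale hA)
  [seq G k | k <- enum I].
rewrite size_map -cardE in se.
have {}eh (i : 'I_(size e)) : e`_i \is hermsymmx.
  by apply: eh; [move=> _ /mapP[k _ ->]; exact: hG|exact: mem_nth].
pose lin (x : 'I_(size e) -> R) := \sum_i (x i)%:C%C *: e`_i.
have lin_h x : lin x \is hermsymmx by exact: herm_lincomb.
have cov_lin x : cov X (lin x) (lin x) = \sum_i x i ^+ 2.
  rewrite cov_sum; apply: eq_bigr => i _; rewrite (covC X) cov_sum (bigD1 i)//=.
  rewrite eo// eqxx mulr1 big1 ?addr0// => j ji.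
  by rewrite eo// (inj_eq val_inj) (negPf ji) mulr0.
pose w k := G k - lin (fun i => cov X (G k) e`_i).
have w0 k : cov X (w k) (w k) = 0.
  have := eN (G k) (map_f _ (mem_enum _ k)) => /=.
  by rewrite (big_nth 0) big_mkord.
have Enull : whp P (u + 1) (fun om => forall k j, ipR (w k) (Xs j om) = 0).
  apply: (whp_forall (ler_natr_expR #|I|)) => k; exact: whp_null.
have Elat : whp P (u + 1) (fun om => forall k : lattice_pt (size e),
    \sum_j xis j om ^+ 2 <= v -> \sum_j xis j om * ipR (lin (lattice_coord R k)) (Xs j om) <=
    4 * b0 * Num.sqrt ((u + 1 + 6 * #|I|%:R) * v)).
  apply: (whp_forall (card_lattice_pt R (size e))) => k.
  have u'0 : 0 < u + 1 + 6 * (size e)%:R by rewrite ltr_wpDr//; lra.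
  have c2 : cov X (lin (lattice_coord R k)) (lin (lattice_coord R k)) <= 2 ^+ 2.
    by rewrite cov_lin (le_trans (lattice_coord_sqr _ _))//; lra.
  have := whp_linear b0_gt0 model subX (lin_h _) c2 (ltr0Sn _ 1) v0 u'0.
  apply: whp_weaken => om H xv; apply: (le_trans (H xv)).
  rewrite (_ : 2 * b0 * 2 = 4 * b0); last by ring.
  rewrite ler_wpM2l ?mulr_ge0 ?(ltW b0_gt0)// ler_wsqrtr// ler_wpM2r ?(ltW v0)//.
  by rewrite lerD2l ler_wpM2l// ler_nat.
apply: whp_weaken (whp_conj Enull Elat) => om [Hnull Hlat] xv c.
set A := \sum_k (c k)%:C%C *: G k; set M := 4 * b0 * _ in Hlat *.
pose a (i : 'I_(size e)) := cov X A e`_i.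
have aE i : a i = \sum_k c k * cov X (G k) e`_i by rewrite /a /A cov_sum.
have AE : A = lin a + \sum_k (c k)%:C%C *: w k.
  rewrite /A /w; under [X in _ + X]eq_bigr do rewrite scalerBr.
  rewrite big_split /= sumrN addrCA -[LHS]addr0; congr (_ + _); apply/esym/eqP.
  rewrite subr_eq0; apply/eqP; rewrite /lin.
  under [RHS]eq_bigr do rewrite scaler_sumr.
  rewrite exchange_big; apply: eq_bigr => i _ /=; rewrite aE rmorph_sum scaler_suml.
  by apply: eq_bigr => k _; rewrite scalerA -rmorphM.
have wx k x : cov X (w k) x = 0.
  exact: (null_orth (covC X) (covD subX) (covZ subX) (cov_ge0 X)).
have covA : cov X A A = \sum_i a i ^+ 2.
  rewrite -cov_lin {1}AE (covD subX) [X in _ + X]cov_sum [X in _ + X]big1 ?addr0; last first.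
    by move=> k _; rewrite wx mulr0.
  rewrite (covC X) {1}AE (covD subX) [X in _ + X]cov_sum [X in _ + X]big1 ?addr0//.
  by move=> k _; rewrite wx mulr0.
have hA : A \is hermsymmx by exact: herm_lincomb.
rewrite (cov_L2norm hX subX hA) in covA.
have ipA j : ipR A (Xs j om) = ipR (lin a) (Xs j om).
  rewrite {1}AE ipRD [X in _ + X]ipR_sum [X in _ + X]big1 ?addr0// => k _.
  by rewrite ipRZ Hnull mulr0.
under eq_bigr do rewrite ipA.
(* A matrix of norm 0 cannot be normalized, but then its coordinates vanish and so does the sum. *)
have [l0|lN0] := eqVneq (L2norm X A) 0.
  have a0 i : a i = 0.
    apply/eqP; rewrite -sqrf_eq0; move: covA; rewrite l0 expr0n /= => /esym/eqP.
    by rewrite psumr_eq0 => [/allP/(_ i (mem_index_enum _))//|k _]; exact: sqr_ge0.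
  rewrite l0 mulr0 big1// => j _; rewrite /lin ipR_sum big1 ?mulr0// => i _.
  by rewrite ipRZ a0 mul0r.
have l_gt0 : 0 < L2norm X A by rewrite lt_neqAle eq_sym lN0 L2norm_ge0.
rewrite -ler_pdivrMr//.
(* The coordinate vectors satisfying the bound form a convex set containing the lattice points,
   hence the unit ball. *)
pose C : set ('I_(size e) -> R) := [set x | \sum_j xis j om * ipR (lin x) (Xs j om) <= M].
have linE x y s t j : ipR (lin (fun i => s * x i + t * y i)) (Xs j om) =
   s * ipR (lin x) (Xs j om) + t * ipR (lin y) (Xs j om).
  rewrite !ipR_sum !mulr_sumr -big_split; apply: eq_bigr => i _ /=.
  by rewrite !ipRZ; ring.
have cC : convexf C.
  move=> t x y /andP[t0 t1] /= Cx Cy; rewrite /C /=.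
  under eq_bigr do rewrite linE mulrDr mulrCA (mulrCA _ t).
  rewrite big_split /= -!mulr_sumr.
  have h1 : 0 <= 1 - t by lra.
  have := ler_wpM2l h1 Cx; have := ler_wpM2l t0 Cy; lra.
(* The coordinates of [A] divided by its norm form a unit vector; the summand [0 * 0] gives it the
   shape required by [linE]. *)
have := lattice_hull cC (fun k => Hlat k xv) (x := fun i => (L2norm X A)^-1 * a i + 0 * 0).
rewrite /C /=; under eq_bigr do rewrite mul0r addr0 exprMn.
rewrite -mulr_sumr -covA -exprMn mulVf// expr1n => /(_ (lexx _)).
under eq_bigr do rewrite linE mul0r addr0 mulrCA.
by rewrite -mulr_sumr mulrC.
Qed.

End SubspaceEvent.

Lemma quarter_lower (R : realType) (y M c : R) : 0 < c -> - M <= c * (2^-1 ^+ 2 * y) -> - (4 * M / c) <= y.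
Proof.
move=> c0 H; rewrite -mulNr ler_pdivrMr// mulrC.
move: H; rewrite (_ : c * (_ * y) = (c * y) / 4); last by field.
lra.
Qed.

Lemma lower_remainder_ge0 (R : realType) (k g x : R) : 0 <= k -> 0 <= g -> 0 <= x ->
  0 <= 4 * (28 * k) * (48 * g) * x.
Proof. by move=> k0 g0 x0; rewrite !mulr_ge0. Qed.

Lemma lower_trivial (R : realType) (N l b k c x : R) : N / 4 * l <= N / 4 * (4 * b) ->
  b * N <= b * (k * x) -> 0 <= c * x -> N / 4 * l - (b * k + c) * x <= 0.
Proof. by move=> h1 h2 h3; rewrite mulrDl; lra. Qed.

(** One half of N pays for 24 g m p, the other for the rest: 2 g (t + 3 + 48 m) <= 102 g (m + t)
    when m >= 1, which is the origin of 102. *)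
Lemma lower_count (R : realType) (g m t p N : R) : 0 <= g -> 1 <= m -> 0 <= t ->
  0 <= p -> p * (48 * g * (m + t)) <= N -> (102 * g + 1) * (m + t) <= N ->
  g * (t + 2 + 1 + 24 * m * (p + 1 + 1)) <= N.
Proof.
move=> g0 m1 t0 p0 pl xn.
have h1 : 0 <= g * p * t by rewrite !mulr_ge0.
have h2 : 0 <= g * (3 * (m - 1) + 50 * t) by rewrite mulr_ge0//; lra.
lra.
Qed.

(** * Lower bound for the empirical quadratic form *)

Section LowerIsometry.
Context d (T : measurableType d) (R : realType) (P : probability T R) (m n : nat).
Variables (X : {RV P >-> mxspace R m}) (Xs : 'I_n -> {RV P >-> mxspace R m}).
Variables (xi : {RV P >-> R}) (xis : 'I_n -> {RV P >-> R}).
Variables b0 b1 b2 : R.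
Hypotheses (b0_gt0 : 0 < b0) (b1_gt0 : 0 < b1) (b2_gt0 : 0 < b2).
Hypothesis n_gt0 : (0 < n)%N.
Hypothesis m_gt0 : (0 < m)%N.
Hypothesis model : sampling_model X Xs xi xis.
Hypothesis subX : subgaussian X b0 b1 b2.
Implicit Types A B H : 'M[R[i]]_m.

Let hX : forall w, (X w : 'M[R[i]]_m) \is hermsymmx := design_hermitian model.
Let J : finType := (lattice_pt (m + m) * lattice_pt (m + m))%type.
Let F (j : J) := frame R j.1 j.2.

Lemma scalerC_mix (a b c e : R) A :
  a%:C%C *: (c%:C%C *: A) + b%:C%C *: (e%:C%C *: A) = (a * c + b * e)%:C%C *: A.
Proof. by rewrite !scalerA -scalerDl rmorphD !rmorphM. Qed.

(** The hull property, applied to the set of convex combinations of frames, yields the explicit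
    weights from which Maurey's argument samples. *)
Lemma frames_weights A B : density R m A -> density R m B ->
  exists p : J -> R, [/\ forall j, 0 <= p j, \sum_j p j = 1 &
    (2^-1 : R)%:C%C *: (A - B) = \sum_j (p j)%:C%C *: F j].
Proof.
pose C : set 'M[R[i]]_m := [set A | exists p : J -> R,
  [/\ forall j, 0 <= p j, \sum_j p j = 1 & A = \sum_j (p j)%:C%C *: F j]].
apply: (@density_diff_hull R m C) => [t _ _ /andP[t0 t1] [p [p0 p1 ->]] [q [q0 q1 ->]]|k l].
  exists (fun j => (1 - t) * p j + t * q j); split.
  - by move=> j; rewrite addr_ge0// mulr_ge0// subr_ge0.
  - by rewrite big_split /= -!mulr_sumr p1 q1; ring.
  rewrite mixmxE !scaler_sumr -big_split; apply: eq_bigr => j _ /=.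
  exact: scalerC_mix.
exists (fun j => (j == (k, l))%:R); split.
- by move=> j; rewrite ler0n.
- by rewrite (bigD1 (k, l))//= eqxx big1 ?addr0// => j /negPf ->.
- rewrite (bigD1 (k, l))//= eqxx scale1r big1 ?addr0// => j /negPf ->.
  by rewrite scale0r.
Qed.

(** [q], the empirical form minus [a] times the covariance, may be indefinite; nonnegative on sums
    of N + 2 frames, it is bounded below at (A - B) / 2, and homogeneity brings the factor 4. *)
Lemma maurey_frames (x : 'I_n -> mxspace R m) (N : nat) (M a : R) :
  (forall s : seq J, size s = N.+2 ->
     a * cov X (\sum_(j <- s) F j) (\sum_(j <- s) F j) <=
     \sum_i ipR (\sum_(j <- s) F j) (x i) ^+ 2) ->
  0 <= a -> (forall j, \sum_i ipR (F j) (x i) ^+ 2 <= M) ->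
  forall A B, density R m A -> density R m B ->
  a * cov X (A - B) (A - B) - 4 * M / N.+1%:R <= \sum_i ipR (A - B) (x i) ^+ 2.
Proof.
move=> Hs a0 HM A B dA dB.
have [p [p0 p1 AE]] := frames_weights dA dB.
pose b C D := \sum_i ipR C (x i) * ipR D (x i) - a * cov X C D.
pose q C := \sum_i ipR C (x i) ^+ 2 - a * cov X C C.
have qD C D : q (C + D) = q C + 2 * b C D + q D.
  have -> : q (C + D) = \sum_i ipR C (x i) ^+ 2 + 2 * (\sum_i ipR C (x i) * ipR D (x i)) +
      \sum_i ipR D (x i) ^+ 2 - a * (cov X C C + 2 * cov X C D + cov X D D).
    rewrite /q; congr (_ - _ * _).
      rewrite mulr_sumr -!big_split; apply: eq_bigr => i _ /=.
      by rewrite ipRD; move: (ipR C _) (ipR D _) => y z; ring.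
    rewrite (covD subX) (covC X C) (covC X D) !(covD subX) (covC X D C).
    by move: (cov X C C) (cov X C D) (cov X D D) => y z y'; ring.
  rewrite /q /b; move: (cov X C C) (cov X C D) (cov X D D) => y1 y2 y3.
  by move: (\sum_i _) (\sum_i _) (\sum_i _) => z1 z2 z3; ring.
have qZ t C : q (t%:C%C *: C) = t ^+ 2 * q C.
  rewrite /q (covZ subX) (covC X C) (covZ subX).
  have -> : \sum_i ipR (t%:C%C *: C) (x i) ^+ 2 = t ^+ 2 * \sum_i ipR C (x i) ^+ 2.
    by rewrite mulr_sumr; apply: eq_bigr => i _; rewrite ipRZ exprMn.
  ring.
set A' := (2^-1 : R)%:C%C *: (A - B) in AE.
have bA C : \sum_j p j * b C (F j) = b C A'.
  rewrite AE /b (covC X C) (cov_sum subX) mulr_sumr.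
  under [in RHS]eq_bigr do rewrite ipR_sum mulr_sumr.
  rewrite exchange_big -sumrB; apply: eq_bigr => j _ /=.
  rewrite mulrBr mulr_sumr (covC X C); congr (_ - _); last by ring.
  by apply: eq_bigr => i _; rewrite (ipRZ (p j)) mulrCA.
have qn : q (A' *+ N.+2) = N.+2%:R ^+ 2 * q A'.
  by rewrite -qZ; congr q; rewrite rmorph_nat scaler_nat.
have Hq s : size s = N.+2 -> 0 <= q (\sum_(j <- s) F j).
  by move=> sN; rewrite /q subr_ge0 Hs.
have qM j : q (F j) <= M.
  by rewrite /q lerBlDr (le_trans (HM j))// lerDl mulr_ge0// cov_ge0.
have := maurey_lower p0 p1 qD bA qn Hq qM.
rewrite /A' qZ => H.
have N0 : 0 < N.+1%:R :> R by rewrite ltr0n.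
have {}H : - (4 * M / N.+1%:R) <= q (A - B).
  exact: quarter_lower.
move: H; rewrite /q; move: (a * _) (\sum_i _) (4 * M / _) => y1 y2 y3 H; move: {qM Hq qn bA qZ qD AE HM Hs p1 p0} H; lra.
Qed.

(** The first summand covers small n, where n / 4 times the covariance is at most b2^2 n; the second
    is Maurey's remainder. *)
Definition lower_const := b2 ^+ 2 * (102 * (256 * b1 ^+ 4) + 1) +
  4 * (28 * (5 * (b1 * b2)) ^+ 2) * (48 * (256 * b1 ^+ 4)).

(* The averages have p + 2 terms, with p the integer part of n / (48 g (m + t)) and
   g = 256 b1^4; for n < (102 g + 1) (m + t) the bound is trivial. *)
Lemma whp_lower (t : R) : 0 < t ->
  whp P (t + 2) (fun w => forall A B, density R m A -> density R m B ->
    n%:R / 4 * cov X (A - B) (A - B) - lower_const * (m%:R + t) <=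
    \sum_j ipR (A - B) (Xs j w) ^+ 2).
Proof.
move=> t0; have nR : 0 < n%:R :> R by rewrite ltr0n.
have m1 : 1 <= m%:R :> R by rewrite ler1n.
set x := m%:R + t; have x0 : 0 < x by rewrite /x; lra.
rewrite /lower_const; have := fun A u => whp_quadratic_lower b1_gt0 model subX (A := A) (u := u).
have g0 : 0 < 256 * b1 ^+ 4 by apply: mulr_gt0; [rewrite ltr0n|exact: exprn_gt0].
move: (256 * b1 ^+ 4) g0 => g g0 quadratic_lower.
have bb : 0 < b1 * b2 by rewrite mulr_gt0.
have K2 : 0 < (5 * (b1 * b2)) ^+ 2 by rewrite exprn_gt0// mulr_gt0.
have b22 : 0 < b2 ^+ 2 by rewrite exprn_gt0.
set K0 := 102 * g + 1.
set C2 := 4 * (28 * (5 * (b1 * b2)) ^+ 2) * (48 * g).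
have C20 : 0 <= C2 * x.
  exact: lower_remainder_ge0 (ltW K2) (ltW g0) (ltW x0).
have [nx|xn] := ltP n%:R (K0 * x).
  apply: whp_true => w A B dA dB.
  apply: (@le_trans _ _ 0); last by apply: sumr_ge0 => j _; exact: sqr_ge0.
  rewrite (cov_L2norm hX subX (density_diff_herm dA dB)).
  have l2 : L2norm X (A - B) ^+ 2 <= 4 * b2 ^+ 2.
    rewrite (_ : 4 * b2 ^+ 2 = (b2 * 2) ^+ 2); last by ring.
    rewrite ler_pXn2r ?nnegrE ?L2norm_ge0 ?(L2norm_density_diff b2_gt0 subX)//.
    by rewrite mulr_ge0// ltW.
  have h : 0 <= n%:R / 4 :> R by rewrite divr_ge0.
  have {h} h := ler_wpM2l h l2.
  exact: lower_trivial h (ler_wpM2l (ltW b22) (ltW nx)) C20.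
pose p := Num.truncn (n%:R / (48 * g * x)).
have D0 : 0 < 48 * g * x.
  by apply: mulr_gt0 => //; apply: mulr_gt0 => //; rewrite ltr0n.
have [pl pu] : p%:R <= n%:R / (48 * g * x) /\ n%:R / (48 * g * x) < p.+1%:R.
  by apply/andP/truncn_itv; rewrite divr_ge0 ?ltW.
(* Bounds the variance remainder in Maurey's argument; t + 3 + 24 m <= 27 (m + t). *)
have Eup : whp P (t + 2 + 1) (fun w => forall j, \sum_i ipR (F j) (Xs i w) ^+ 2 <=
    (5 * (b1 * b2)) ^+ 2 * (n%:R + 27 * x)).
  apply: (whp_forall (card_frame_pairs R m)) => j.
  have K20 : 0 < 5 * (b1 * b2) by rewrite mulr_gt0.
  have KF : b1 * L2norm X (F j) < 5 * (b1 * b2).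
    have := ler_wpM2l (ltW b1_gt0) (L2norm_frame b2_gt0 subX j.1 j.2); rewrite -/(F j).
    by move: (b1 * L2norm X (F j)) K20 => y K20; lra.
  have := whp_quadratic_upper model subX (t + 2 + 1 + 24 * m%:R) (frame_herm R j.1 j.2) K20 KF.
  apply: whp_weaken => w /le_trans; apply; rewrite ler_wpM2l ?(ltW K2)// lerD2l /x; lra.
have Elow : whp P (t + 2 + 1) (fun w => forall s : p.+2.-tuple J,
    n%:R / 4 * cov X (\sum_(j <- s) F j) (\sum_(j <- s) F j) <=
     \sum_i ipR (\sum_(j <- s) F j) (Xs i w) ^+ 2).
  apply: (@whp_forall _ _ _ _ _ (24 * m%:R * p.+2%:R)).
    rewrite card_tuple natrX expRM_natr lerXn2r ?nnegrE ?ler0n ?expR_ge0//.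
    exact: card_frame_pairs.
  move=> s; set A := \sum_(j <- s) F j.
  have hA : A \is hermsymmx.
    rewrite /A (_ : \sum_(j <- s) F j = \sum_(j <- s) (1 : R)%:C%C *: F j).
      by apply: herm_lincomb => j; exact: frame_herm.
    by apply: eq_bigr => j _; rewrite scale1r.
  have un : g * (t + 2 + 1 + 24 * m%:R * p.+2%:R) <= n%:R.
    move: pl; rewrite ler_pdivlMr// => pl.
    rewrite -[p.+2%:R]natr1 -[p.+1%:R]natr1.
    exact: lower_count (ltW g0) m1 (ltW t0) (ler0n _ _) pl xn.
  have := quadratic_lower A _ hA un.
  by apply: whp_weaken => w; rewrite mulrAC.
apply: whp_weaken (whp_conj Eup Elow) => w [HM Hs] A B dA dB.
have a0 : 0 <= n%:R / 4 :> R by rewrite divr_ge0.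
have Hs' (s : seq J) : size s = p.+2 -> n%:R / 4 * cov X (\sum_(j <- s) F j) (\sum_(j <- s) F j) <=
     \sum_i ipR (\sum_(j <- s) F j) (Xs i w) ^+ 2.
  by move=> /eqP sp; exact: (Hs (Tuple sp)).
apply: le_trans (maurey_frames Hs' a0 HM dA dB).
rewrite lerD2l lerN2 ler_pdivrMr ?ltr0n//.
move: pu; rewrite ltr_pdivrMr// => pu.
have nx : x <= n%:R.
  apply: le_trans xn; rewrite /K0 mulrDl mul1r lerDr mulr_ge0 ?(ltW x0)// mulr_ge0 ?(ltW g0)//.
have h1 : C2 * x * p.+1%:R <= (b2 ^+ 2 * K0 + C2) * x * p.+1%:R.
  rewrite ler_wpM2r ?ler0n// ler_wpM2r ?(ltW x0)// lerDr.
  rewrite mulr_ge0 ?(ltW b22)// /K0 addr_ge0// mulr_ge0// ltW//.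
apply: le_trans h1.
have h2 : 4 * (28 * (5 * (b1 * b2)) ^+ 2) * n%:R <= 4 * (28 * (5 * (b1 * b2)) ^+ 2) * (p.+1%:R * (48 * g * x)).
  by rewrite ler_wpM2l ?(ltW pu)//; lra.
have h3 : (5 * (b1 * b2)) ^+ 2 * (n%:R + 27 * x) <= (5 * (b1 * b2)) ^+ 2 * (28 * n%:R).
  by rewrite ler_wpM2l ?(ltW K2)//; lra.
rewrite /C2; lra.
Qed.

End LowerIsometry.

(** * Deterministic ingredients *)

Section Beta.
Context d (T : measurableType d) (R : realType) (P : probability T R) (m : nat).
Variable X : {RV P >-> mxspace R m}.
Variables b0 b1 b2 : R.
Hypothesis hX : forall w, (X w : 'M[R[i]]_m) \is hermsymmx.
Hypothesis subX : subgaussian X b0 b1 b2.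
Implicit Types A L : 'M[R[i]]_m.

Lemma L2normZ (s : R) A : 0 <= s -> A \is hermsymmx ->
  L2norm X (s%:C%C *: A) = s * L2norm X A.
Proof.
move=> s0 hA; apply/eqP; rewrite -(@eqrXn2 _ 2) ?mulr_ge0 ?L2norm_ge0//.
have hsA : s%:C%C *: A \is hermsymmx.
  by apply/hermsymmxP; rewrite trmxC_scale (hermsymmxP _ hA).
rewrite exprMn -(cov_L2norm hX subX hA) -(cov_L2norm hX subX hsA).
by rewrite (covZ subX) covC (covZ subX) mulrA -expr2.
Qed.

Lemma calPZ (s : R) L A : calP L (s%:C%C *: A) = s%:C%C *: calP L A.
Proof. by rewrite /calP -scalemxAr -scalemxAl scalerBr. Qed.

Lemma beta_ge0 L : (0 <= beta X L)%E.
Proof.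
have : (eL2norm X (calP L 0) <= beta X L)%E.
  apply: ereal_sup_ubound; exists 0 => //=.
  have [_ _ /(_ 0)] := subX; rewrite /frobnorm /mxip mul0mx mxtrace0 sqrtr0 mulr0.
  by move=> /le_trans; apply; rewrite lee_fin.
by apply: le_trans; exact: Lnorm_ge0.
Qed.

(** When A has norm 0, all its multiples compete in the supremum defining [beta], so a finite [beta]
    forces the image of A to have norm 0. *)
Lemma L2norm_calP_le L A (b : R) : beta X L = b%:E -> A \is hermsymmx ->
  L2norm X (calP L A) <= b * L2norm X A.
Proof.
move=> bE hA; have hP := calP_herm L hA.
have b0' : 0 <= b by rewrite -lee_fin -bE beta_ge0.
have H (s : R) : 0 <= s -> s * L2norm X A <= 1 -> s * L2norm X (calP L A) <= b.
  move=> s0 sA; rewrite -L2normZ// -calPZ -lee_fin -bE -(eL2normE subX).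
  apply: ereal_sup_ubound; exists (s%:C%C *: A) => //=.
  by rewrite (eL2normE subX) L2normZ// lee_fin.
have := L2norm_ge0 X A; rewrite le_eqVlt => /orP[/eqP A0|A0].
  rewrite -A0 mulr0 leNgt; apply/negP => P0.
  have := H ((b + 1) / L2norm X (calP L A)); rewrite -A0 mulr0 => /(_ _ ler01).
  rewrite divfK ?gt_eqF// => /(_ _)/wrap[|]; last by lra.
  by rewrite divr_ge0 ?(ltW P0)//; lra.
have := H (L2norm X A)^-1; rewrite mulVf ?gt_eqF// invr_ge0 (ltW A0) => /(_ isT (lexx _)).
by rewrite mulrC ler_pdivrMr.
Qed.

End Beta.

Lemma Re_tr_symdiff (R : realType) m (A B C D : 'M[R[i]]_m) :
  complex.Re (\tr ((A - B) *m (C - D))) =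
  - complex.Re (\tr ((B - A) *m C)) - complex.Re (\tr ((A - B) *m D)).
Proof. by rewrite mulmxBr mxtraceB ReB -(opprB A B) mulNmx linearN ReN opprK. Qed.

Lemma first_order_real (R : realType) (N E K k1 k2 c c' S y1 y2 y3 : R) : 0 < N ->
  K = - k1 - k2 -> c' = - c -> S = y1 - y2 + y3 ->
  0 <= N^-1 * (2 * S) + E * k1 -> 0 <= 2 * c + E * k2 ->
  N * (E * K) + 2 * y2 <= 2 * y1 + 2 * (y3 - N * c').
Proof.
move=> N0 -> -> ->; set w := 2 * _ => h1 h2.
have e : N * (N^-1 * w) = w by rewrite mulrA divff ?mul1r// gt_eqF.
have {h1} := ler_wpM2l (ltW N0) h1; have {h2} := ler_wpM2l (ltW N0) h2.
rewrite !mulr0 mulrDr (mulrDr N (N^-1 * w)) e /w; lra.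
Qed.

(** * Combination of the two first-order conditions *)

Section FirstOrder.
Context d (T : measurableType d) (R : realType) (P : probability T R) (m n : nat).
Variables (X : {RV P >-> mxspace R m}).
Variables b0 b1 b2 : R.
Hypothesis subX : subgaussian X b0 b1 b2.
Hypothesis n_gt0 : (0 < n)%N.
Variables (x : 'I_n -> mxspace R m) (e : 'I_n -> R) (rho S1 S2 : 'M[R[i]]_m) (eps : R).
Hypothesis hx : forall j, (x j : 'M[R[i]]_m) \is hermsymmx.
Hypothesis eps0 : 0 < eps.
Hypothesis argS1 : is_argmin (density R m)
  (empirical_risk (fun j => x j : 'M[R[i]]_m) (fun j => response rho (x j) (e j)) eps) S1.
Hypothesis argS2 : is_argmin (density R m) (population_risk X rho eps) S2.

Let q1 S := n%:R^-1 * (\sum_j (ipR (rho - S) (x j) + e j) ^+ 2).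
Let q2 S := cov X (S - rho) (S - rho).

Let q1E S : empirical_risk (fun j => x j : 'M[R[i]]_m) (fun j => response rho (x j) (e j)) eps S =
  q1 S + eps * negentropy S.
Proof.
rewrite /empirical_risk /q1; congr (_ * _ + _); apply: eq_bigr => j _.
by rewrite /response ipRB !ipR_tr// addrAC.
Qed.

Let q2E S : population_risk X rho eps S = q2 S + eps * negentropy S.
Proof.
by rewrite /population_risk /q2 /cov unlock.
Qed.

Let q1mix A B (t : R) : q1 (mixmx t A B) = q1 A +
  t * (n%:R^-1 * (2 * \sum_j (ipR (rho - A) (x j) + e j) * ipR (A - B) (x j))) +
  t ^+ 2 * (n%:R^-1 * \sum_j ipR (A - B) (x j) ^+ 2).
Proof.
rewrite /q1 mulrCA (mulrCA _ n%:R^-1) -!mulrDr; congr (_ * _).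
rewrite !mulr_sumr -!big_split; apply: eq_bigr => j _ /=.
rewrite /mixmx ipRB ipRD ipRZ !ipRB.
move: (ipR rho _) (ipR A _) (ipR B _) (e j) => a b c y; ring.
Qed.

Let q2mix A B (t : R) : q2 (mixmx t A B) = q2 A +
  t * (2 * cov X (A - rho) (B - A)) + t ^+ 2 * cov X (B - A) (B - A).
Proof.
rewrite /q2 /mixmx addrAC; move: (A - rho) (B - A) => A' D.
have h E : cov X E (A' + t%:C%C *: D) = cov X A' E + t * cov X D E.
  by rewrite covC (covD subX) (covZ subX).
rewrite (covD subX) (covZ subX) !h (covC X D A').
by move: (cov X A' A') (cov X A' D) (cov X D D) => y1 y2 y3; ring.
Qed.

Let argq1 : is_argmin (density R m) (fun S => q1 S + eps * negentropy S) S1.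
Proof.
by have := argS1; rewrite (funext q1E).
Qed.

Let argq2 : is_argmin (density R m) (fun S => q2 S + eps * negentropy S) S2.
Proof.
by have := argS2; rewrite (funext q2E).
Qed.

Let quad1 A B : exists a b : R, forall t, q1 (mixmx t A B) = q1 A + t * a + t ^+ 2 * b.
Proof. by eexists; eexists => t; exact: q1mix. Qed.

Let quad2 A B : exists a b : R, forall t, q2 (mixmx t A B) = q2 A + t * a + t ^+ 2 * b.
Proof. by eexists; eexists => t; exact: q2mix. Qed.

Lemma empirical_argmin_posdef i : 0 < evals S1 i.
Proof. exact: (argmin_posdef eps0 quad1 argq1). Qed.

Lemma population_argmin_posdef i : 0 < evals S2 i.
Proof. exact: (argmin_posdef eps0 quad2 argq2). Qed.

Let covN A B : cov X (- A) B = - cov X A B.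
Proof.
have c0 : cov X 0 B = 0.
  by have := covD subX 0 0 B; rewrite addr0 => /eqP; rewrite eq_sym -subr_eq0 addrK => /eqP.
by apply/eqP; rewrite -addr_eq0 -(covD subX) addNr c0.
Qed.

(** Each condition is tested at the other minimizer and the two are added. Writing rho - S1 = - (S1
    - S2) - (S2 - rho) in the empirical residual produces the quadratic term and the cross term. *)
Lemma first_order : n%:R * (eps * symKL S1 S2) + 2 * \sum_j ipR (S1 - S2) (x j) ^+ 2 <=
  2 * \sum_j e j * ipR (S1 - S2) (x j) +
  2 * (\sum_j ipR (S2 - rho) (x j) * ipR (S2 - S1) (x j) - n%:R * cov X (S2 - rho) (S2 - S1)).
Proof.
have [d1 _] := argS1; have [d2 _] := argS2.
have nR : 0 < n%:R :> R by rewrite ltr0n.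
have h2 := argmin_first_order eps0 quad2 (q2mix S2 S1) argq2 d1.
have h1 := argmin_first_order eps0 quad1 (q1mix S1 S2) argq1 d2.
have KE : symKL S1 S2 = _ := Re_tr_symdiff S1 S2 (mxlog S1) (mxlog S2).
have cE : cov X (S2 - rho) (S2 - S1) = - cov X (S2 - rho) (S1 - S2).
  by rewrite -(opprB S1 S2) covC covN covC.
have H := fun y1 y2 y3 p => @first_order_real R _ _ _ _ _ _ _ _ y1 y2 y3 nR KE cE p h1 h2.
apply: H.
rewrite -sumrB -big_split; apply: eq_bigr => j _ /=; rewrite !ipRB.
move: (ipR rho _) (ipR S1 _) (ipR S2 _) (e j) => a b y z; ring.
Qed.

End FirstOrder.

(** * Noise level *)

Section NoiseReal.
Variable R : realType.

Lemma sixfifths_le (s : R) : 0 <= s -> 1 + s + s ^+ 2 / 4 <= 2 -> s <= 5 / 6.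
Proof. by move=> s0 h; nra. Qed.

(** The tangent line at y = c; integrating it gives Jensen's inequality for this parabola. *)
Lemma tangent_quadratic (c y : R) :
  1 - c ^+ 2 / 4 + (1 + c / 2) * y <= 1 + y + y ^+ 2 / 4.
Proof. by have := sqr_ge0 (y - c); rewrite sqrrB; lra. Qed.

Lemma le_sqr_of_gt (a b : R) : 0 <= b -> 0 <= a ->
  (forall K, b < K -> a <= 5 / 6 * K ^+ 2) -> a <= 5 / 6 * b ^+ 2.
Proof.
move=> b0 a0 H; rewrite leNgt; apply/negP => ab.
pose e := Num.min 1 ((a - 5 / 6 * b ^+ 2) / (2 * b + 2)).
have d0 : 0 < 2 * b + 2 by lra.
have e0 : 0 < e by rewrite lt_min ltr01/= divr_gt0// subr_gt0.
have e1 : e <= 1 by rewrite ge_min lexx.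
have e2 : e * (2 * b + 2) <= a - 5 / 6 * b ^+ 2.
  by rewrite -ler_pdivlMr// ge_min lexx orbT.
have := H (b + e); rewrite ltrDl => /(_ e0).
have : e ^+ 2 <= e by rewrite expr2 ger_pMr.
have : 0 <= e * b by rewrite mulr_ge0// ltW.
rewrite sqrrD; lra.
Qed.

Lemma ln_ge_1B (x : R) : 0 < x -> 1 - x^-1 <= ln x.
Proof.
move=> x0; have := @ln_le_subr1 _ x^-1; rewrite invr_gt0 x0 lnV ?posrE// => /(_ isT).
by lra.
Qed.

(** Keeps the logarithm in [c_noise] away from 0, as otherwise [c_noise] could be much smaller than
    the psi_2 norm; 1/12 is half of 1 - 5/6. *)
Lemma ln_ratio_ge (s V : R) : 0 < s -> 0 < V -> s ^+ 2 <= 5 / 6 * V ^+ 2 ->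
  12^-1 <= ln (V / s).
Proof.
move=> s0 V0 sV; have r0 : 0 < V / s by exact: divr_gt0.
have := ln_ge_1B (exprn_gt0 2 r0); rewrite lnXn// -mulr_natl.
have : ((V / s) ^+ 2)^-1 <= 5 / 6.
  by rewrite -exprVn invf_div expr_div_n ler_pdivrMr ?exprn_gt0.
lra.
Qed.

(** 1 + l <= 156 l^2 holds with equality at l = 1/12. *)
Lemma sqr_psi_le (V l : R) : 12^-1 <= l -> V ^+ 2 * (1 + l) <= 156 * (V * l) ^+ 2.
Proof.
move=> l12; rewrite exprMn mulrCA ler_wpM2l ?sqr_ge0//.
nra.
Qed.

End NoiseReal.

Section Noise.
Context d (T : measurableType d) (R : realType) (P : probability T R).
Variable xi : {RV P >-> R}.
Hypothesis psi_fin : (psi2norm P xi < +oo)%E.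
Let V := fine (psi2norm P xi).
Let s := noise_sd P xi.

Lemma psi2norm_ge0 : (0 <= psi2norm P xi)%E.
Proof. by apply: le_ereal_inf_tmp => _ [C [C0 _] <-]; rewrite lee_fin ltW. Qed.

Let VE : psi2norm P xi = V%:E.
Proof. by rewrite /V fineK// ge0_fin_numE ?psi2norm_ge0. Qed.

Let V0 : 0 <= V. Proof. by rewrite fine_ge0// psi2norm_ge0. Qed.

Lemma noise_mgf (K : R) : V < K -> (\int[P]_w (expR (xi w ^+ 2 / K ^+ 2))%:E <= 2%:E)%E.
Proof. by move=> VK; apply: psi2norm_lt_mgf => //; rewrite VE lte_fin. Qed.

Lemma noise_sqr_lty : (\int[P]_w (xi w ^+ 2)%:E < +oo)%E.
Proof.
have K0 : 0 < V + 1 by have := V0; lra.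
have VK : V < V + 1 by lra.
have m1 : measurable_fun setT (fun w => expR (xi w ^+ 2 / (V + 1) ^+ 2)).
  by apply: measurableT_comp => //; apply: measurable_funM => //; exact: measurable_funX.
have mx : measurable_fun setT (fun w => xi w ^+ 2) by exact: measurable_funX.
have mz : measurable_fun setT (cst 0 : T -> R) by [].
have K20 : 0 <= (V + 1) ^+ 2 by exact: sqr_ge0.
have := @le_integral_linear _ _ _ P _ _ _ _ 0 0 ((V + 1) ^+ 2) 0 mx mz m1 mz
  (fun=> sqr_ge0 _) (fun=> lexx _) (fun=> expR_ge0 _) (fun=> lexx _)
  (lexx _) (lexx _) K20 (lexx _).
rewrite !mul0e !adde0 add0e => Hle; apply: (le_lt_trans (Hle _)).
  move=> w /=; rewrite !mulr0 !addr0 add0r.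
  rewrite -ler_pdivrMl ?exprn_gt0// mulrC.
  by apply: le_trans (expR_ge1Dx _); rewrite lerDr.
apply: (@le_lt_trans _ _ (((V + 1) ^+ 2)%:E * 2%:E)%E); last exact: ltry.
by apply: lee_wpmul2l; [rewrite lee_fin|exact: noise_mgf].
Qed.

Lemma noise_sdE : (\int[P]_w (xi w ^+ 2)%:E = (s ^+ 2)%:E)%E.
Proof.
have i0 : (0 <= \int[P]_w (xi w ^+ 2)%:E)%E.
  by apply: integral_ge0 => w _; rewrite lee_fin sqr_ge0.
rewrite /s /noise_sd unlock sqr_sqrtr ?fine_ge0// fineK// ge0_fin_numE//.
exact: noise_sqr_lty.
Qed.

(* Integrate e^y >= 1 + y + y^2 / 4 and use E y^2 >= (E y)^2, y = (xi / K)^2. *)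
Lemma noise_sd_le (K : R) : V < K -> s ^+ 2 <= 5 / 6 * K ^+ 2.
Proof.
move=> VK; have K0 : 0 < K by exact: le_lt_trans VK.
have K2 : 0 < K ^+ 2 by exact: exprn_gt0.
pose r := s ^+ 2 / K ^+ 2; have r0 : 0 <= r by rewrite divr_ge0// sqr_ge0.
have m1 : measurable_fun setT (fun w => expR (xi w ^+ 2 / K ^+ 2)).
  by apply: measurableT_comp => //; apply: measurable_funM => //; exact: measurable_funX.
have mx : measurable_fun setT (fun w => xi w ^+ 2) by exact: measurable_funX.
have mz : measurable_fun setT (cst 0 : T -> R) by [].
have key (c : R) : 0 <= c -> c <= 1 -> (1 - c ^+ 2 / 4) + (1 + c / 2) * r <= 2.
  move=> c0 c1; have h0 : 0 <= 1 - c ^+ 2 / 4 by nra.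
  have mc : measurable_fun setT (cst (1 - c ^+ 2 / 4) : T -> R) by [].
  have b0 : 0 <= (1 + c / 2) / K ^+ 2 by rewrite divr_ge0 ?(ltW K2)//; lra.
  have := @le_integral_linear _ _ _ P _ _ _ _ 0 ((1 + c / 2) / K ^+ 2) 1 0 mc mx m1 mz
    (fun=> h0) (fun=> sqr_ge0 _) (fun=> expR_ge0 _) (fun=> lexx _)
    (lexx _) b0 ler01 (lexx _).
  rewrite mul0e adde0 add0e mul1e => Hle.
  have := le_trans (Hle _) (noise_mgf VK).
  have ic : (\int[P]_w ((cst (1 - c ^+ 2 / 4) : T -> R) w)%:E = (1 - c ^+ 2 / 4)%:E)%E.
    rewrite -[LHS]/(\int[P]_w (cst (1 - c ^+ 2 / 4)%:E w))%E integral_cst//.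
    by rewrite -[RHS]mule1; congr (_ * _)%E; exact: probability_setT.
  rewrite ic noise_sdE -EFinM -EFinD lee_fin => H.
  apply: le_trans (H _).
    by rewrite /r mulrACA mulrC; lra.
  move=> w /=; rewrite mulr0 addr0 add0r mul1r.
  have y0 : 0 <= xi w ^+ 2 / K ^+ 2 by rewrite divr_ge0 ?sqr_ge0// ltW.
  rewrite (_ : (1 + c / 2) / K ^+ 2 * _ = (1 + c / 2) * (xi w ^+ 2 / K ^+ 2)).
    exact: le_trans (tangent_quadratic _ _) (expR_ge1DxDx2 y0).
  by rewrite mulrAC mulrA.
(* The tangent at 0 gives r <= 1, which admits the tangent at r itself: 1 + r + r^2 / 4 <= 2, hence
   r <= 5/6. *)
have r1 : r <= 1 by have := key 0 (lexx _) ler01; rewrite expr0n /=; lra.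
have : r <= 5 / 6 by apply: sixfifths_le => //; have := key r r0 r1; lra.
by rewrite /r ler_pdivrMr.
Qed.

Lemma noise_sd_psi : s ^+ 2 <= 5 / 6 * V ^+ 2.
Proof. by apply: le_sqr_of_gt => //; [exact: sqr_ge0|exact: noise_sd_le]. Qed.

Hypothesis s0 : 0 < s.

Lemma psi_gt0 : 0 < V.
Proof.
rewrite lt_neqAle V0 andbT; apply/eqP => V00; have := noise_sd_psi.
by rewrite -V00 expr0n /= mulr0 leNgt exprn_gt0.
Qed.

Lemma ln_noise : 12^-1 <= ln (V / s).
Proof. exact: ln_ratio_ge s0 psi_gt0 noise_sd_psi. Qed.

Lemma c_noise_gt0 : 0 < c_noise P xi.
Proof. by rewrite mulr_gt0 ?psi_gt0// (lt_le_trans _ ln_noise)// invr_gt0. Qed.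

(** V is doubled to lie strictly above the psi_2 norm. With ln 2 <= 1, k = (2 V)^2 ln (2 V / s) is
    at most 4 V^2 (1 + ln (V / s)), and 624 = 4 * 156. *)
Lemma noise_mgf_upper : exists k : R, [/\ 0 < k, k <= 624 * c_noise P xi ^+ 2 &
  (\int[P]_w (expR (xi w ^+ 2 / (16 * k)))%:E <= (expR (18 * s ^+ 2 / (16 * k)))%:E)%E].
Proof.
have V2 : V < 2 * V by have := psi_gt0; lra.
have V20 : 0 < 2 * V by have := psi_gt0; lra.
have lE : ln (2 * V / s) = ln 2 + ln (V / s).
  by rewrite -lnM ?posrE// ?mulrA// divr_gt0// psi_gt0.
have l2 : 2^-1 <= ln 2 :> R by have := @ln_ge_1B R 2 ltac:(by []); lra.
have l2' : ln 2 <= 1 :> R by have := @ln_le_subr1 R 2 ltac:(by []); lra.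
have L8 : 8^-1 <= ln (2 * V / s) by rewrite lE; have := ln_noise; lra.
exists ((2 * V) ^+ 2 * ln (2 * V / s)); split.
- by rewrite mulr_gt0 ?exprn_gt0// (lt_le_trans _ L8)// invr_gt0.
- rewrite exprMn lE; have := sqr_psi_le V ln_noise; rewrite -/(c_noise P xi).
  have := ler_wpM2l (sqr_ge0 V) l2'; rewrite /c_noise -/V -/s; lra.
- rewrite mulrA; have mx : measurable_fun setT xi by [].
  exact: (mgf_sqr_upper mx V20 s0 erefl L8 noise_sdE (noise_mgf V2)).
Qed.

End Noise.

(** * Rates *)

Section Rates.
Variable R : realType.
Implicit Types (x N u l B t m s b : R).

(** The minimum is a slack added to [l]. For x <= N its product with sqrt (x N) is at most x; for x
    > N the root on the left is at most 28 x and the other factor at most B + 1. *)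
Lemma bernstein_rate l B x N u : 0 <= l -> l <= B -> 0 < x -> 0 < N -> 0 < u ->
  u <= 27 * x ->
  (l + Num.min 1 (Num.sqrt (x / N))) * Num.sqrt (u * (N + u)) <=
  28 * (B + 1) * (l * Num.sqrt (x * N) + x).
Proof.
move=> l0 lB x0 N0 u0 ux; set dl := Num.min _ _.
have dl0 : 0 <= dl by rewrite le_min ler01 sqrtr_ge0.
have s0 := sqrtr_ge0 (x * N).
have ls0 : 0 <= l * Num.sqrt (x * N) by exact: mulr_ge0.
have [xN|Nx] := leP x N.
  have h : Num.sqrt (u * (N + u)) <= 28 * Num.sqrt (x * N).
    have -> : 28 = Num.sqrt (28 ^+ 2) :> R by rewrite sqrtr_sqr ger0_norm.
    rewrite -sqrtrM ?sqr_ge0// ler_wsqrtr//.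
    apply: (@le_trans _ _ (27 * x * (28 * N))); last by have := mulr_gt0 x0 N0; nra.
    by apply: ler_pM; lra.
  have hd : dl * Num.sqrt (x * N) <= x.
    apply: (@le_trans _ _ (Num.sqrt (x / N) * Num.sqrt (x * N))).
      by apply: ler_wpM2r => //; rewrite ge_min; apply/orP; right.
    have xN0 : 0 <= x / N by exact: divr_ge0 (ltW x0) (ltW N0).
    have e : x / N * (x * N) = x ^+ 2 by field; rewrite gt_eqF.
    by rewrite -(sqrtrM _ xN0) e sqrtr_sqr (ger0_norm (ltW x0)).
  apply: (@le_trans _ _ ((l + dl) * (28 * Num.sqrt (x * N)))).
    by rewrite ler_wpM2l// addr_ge0.
  apply: (@le_trans _ _ (28 * (l * Num.sqrt (x * N) + x))); first by lra.
  have : 0 <= B * (l * Num.sqrt (x * N) + x) by rewrite mulr_ge0 ?addr_ge0 ?(ltW x0)//; lra.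
  lra.
have h : Num.sqrt (u * (N + u)) <= 28 * x.
  rewrite -[leRHS]ger0_norm ?mulr_ge0 ?(ltW x0)// -sqrtr_sqr ler_wsqrtr// exprMn.
  apply: (@le_trans _ _ (27 * x * (28 * x))); last by have := mulr_gt0 x0 x0; nra.
  by apply: ler_pM; lra.
have hd : l + dl <= B + 1 by rewrite lerD// ge_min lexx.
apply: (@le_trans _ _ ((B + 1) * (28 * x))).
  by apply: ler_pM => //; rewrite ?addr_ge0 ?sqrtr_ge0.
have : 0 <= (B + 1) * (l * Num.sqrt (x * N)) by rewrite mulr_ge0//; lra.
lra.
Qed.

Lemma sqrt_rate x N y : 0 < x -> 0 < N -> x <= 2 * y ->
  Num.sqrt (x * N) <= 2 * N * Num.sqrt (y / N).
Proof.
move=> x0 N0 xy; rewrite -[X in _ <= X * _]ger0_norm ?mulr_ge0 ?(ltW N0)// -sqrtr_sqr.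
rewrite -sqrtrM ?sqr_ge0// ler_wsqrtr//.
rewrite (_ : (2 * N) ^+ 2 * (y / N) = 2 * y * N * 2); last by field; rewrite gt_eqF.
have := ler_wpM2r (ltW N0) xy; have := mulr_gt0 x0 N0; lra.
Qed.

Lemma ln_2m_ge (k : nat) : (0 < k)%N -> 2^-1 <= ln (2 * k%:R) :> R.
Proof.
move=> k0; have k1 : 1 <= k%:R :> R by rewrite ler1n.
have h := @ln_ge_1B R (2 * k%:R) ltac:(by lra).
apply: le_trans h; rewrite invfM.
have : (k%:R)^-1 <= 1 :> R by rewrite invf_le1// (lt_le_trans ltr01).
lra.
Qed.

(** [lg] stands for log (2 m): being at least 1/2, it turns m + t into a multiple of m t_m and
    absorbs additive constants into t_m. *)
Lemma dim_rate m t lg : 1 <= m -> 0 < t -> 2^-1 <= lg ->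
  [/\ 0 < t + lg, m + t <= 2 * (m * (t + lg)) & t + 3 <= 6 * (t + lg)].
Proof.
move=> m1 t0 l2; split; [lra| |lra].
have h1 : 0 <= (m - 1) * t by rewrite mulr_ge0//; lra.
have h2 : 0 <= m * (lg - 2^-1) by rewrite mulr_ge0//; lra.
lra.
Qed.

Lemma noise_rate_large x N s v u :
  0 < x -> 0 < N -> 0 <= s -> u <= 27 * x -> v = 34 * (N * s ^+ 2) ->
  Num.sqrt (u * v) <= Num.sqrt (27 * 34) * s * Num.sqrt (x * N).
Proof.
move=> x0 N0 s0 ux ->; rewrite -[X in _ * X * _](ger0_norm s0) -sqrtr_sqr.
rewrite -!sqrtrM ?mulr_ge0 ?sqr_ge0// ler_wsqrtr//.
rewrite (_ : 27 * 34 * s ^+ 2 * (x * N) = 27 * x * (34 * (N * s ^+ 2))); last by ring.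
by rewrite ler_wpM2r ?mulr_ge0 ?(ltW N0) ?sqr_ge0.
Qed.

Lemma noise_rate_small x m u v tm t c a k : 0 < x -> 0 < m -> 0 < tm -> 0 <= c ->
  x <= 2 * (m * tm) -> 0 < t + 3 -> t + 3 <= 6 * tm -> u <= 27 * x ->
  0 <= a -> 0 <= k -> v = a * (k * (c ^+ 2 * (t + 3))) ->
  Num.sqrt (u * v) <= Num.sqrt (27 * (a * k)) * (4 * (c * (Num.sqrt m * tm))).
Proof.
move=> x0 m0 tm0 c0 xm t3 ttm ux a0 k0 ->; have c2 := sqr_ge0 c.
have h0 : 0 <= 4 * (c * (Num.sqrt m * tm)).
  by rewrite mulr_ge0// mulr_ge0// mulr_ge0 ?sqrtr_ge0// ltW.
have k1 : 0 <= 27 * (a * k) by rewrite mulr_ge0// mulr_ge0.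
rewrite -(ger0_norm h0) -sqrtr_sqr -(sqrtrM _ k1) ler_wsqrtr//.
have -> : (4 * (c * (Num.sqrt m * tm))) ^+ 2 = c ^+ 2 * (16 * (m * tm ^+ 2)).
  by rewrite !exprMn (sqr_sqrtr (ltW m0)); ring.
have v0 : 0 <= a * (k * (c ^+ 2 * (t + 3))).
  by apply: (mulr_ge0 a0); apply: (mulr_ge0 k0); apply: (mulr_ge0 c2); exact: ltW.
apply: (le_trans (ler_wpM2r v0 ux)).
have h : x * (t + 3) <= 2 * (m * tm) * (6 * tm) by apply: ler_pM => //; exact: ltW.
have {h} h : x * (t + 3) <= 16 * (m * tm ^+ 2).
  apply: (le_trans h); have := mulr_gt0 m0 (mulr_gt0 tm0 tm0); rewrite expr2; lra.
rewrite (_ : 27 * x * _ = 27 * (a * k) * (c ^+ 2 * (x * (t + 3)))); last by ring.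
by apply: (ler_wpM2l k1); apply: (ler_wpM2l c2).
Qed.

(** Completes a square so that the noise on the range of P_L uses only half of the available N q^2 /
    2. *)
Lemma subspace_rate b0 N s b y q u v : 0 < b0 -> 0 < N -> 0 <= s -> 0 <= b -> 0 <= y ->
  u <= 15 * y -> v = 34 * (N * s ^+ 2) ->
  2 * (4 * b0 * Num.sqrt (u * v) * (b * q)) <=
  N / 4 * q ^+ 2 + (8 * b0) ^+ 2 * (15 * 34) * (s ^+ 2 * b ^+ 2 * y).
Proof.
move=> b00 N0 s0 bb0 y0 uy ->.
have q2 := sqr_ge0 q.
set z := Num.sqrt _; have z0 : 0 <= z by exact: sqrtr_ge0.
have z2 : z ^+ 2 <= 15 * y * (34 * (N * s ^+ 2)).
  have v0 : 0 <= 34 * (N * s ^+ 2) by rewrite !mulr_ge0 ?(ltW N0) ?sqr_ge0.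
  have [u0|u0] := leP 0 u; first by rewrite (sqr_sqrtr (mulr_ge0 u0 v0)); exact: (ler_wpM2r v0 uy).
  rewrite /z (ler0_sqrtr (mulr_le0_ge0 (ltW u0) v0)) expr0n /=.
  by rewrite mulr_ge0// mulr_ge0.
have : 0 <= (q * N / 2 - 8 * b0 * b * z) ^+ 2 by exact: sqr_ge0.
have -> : (q * N / 2 - 8 * b0 * b * z) ^+ 2 =
  N * (N / 4 * q ^+ 2 - 2 * (4 * b0 * z * (b * q))) + (8 * b0) ^+ 2 * b ^+ 2 * z ^+ 2 by field.
have h : (8 * b0) ^+ 2 * b ^+ 2 * z ^+ 2 <= (8 * b0) ^+ 2 * b ^+ 2 * (15 * y * (34 * (N * s ^+ 2))).
  by rewrite ler_wpM2l// mulr_ge0// sqr_ge0.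
move=> h'; have {h h'} : 0 <= N * (N / 4 * q ^+ 2 - 2 * (4 * b0 * z * (b * q)) +
    (8 * b0) ^+ 2 * (15 * 34) * (s ^+ 2 * b ^+ 2 * y)).
  apply: (le_trans h'); rewrite [leRHS]mulrDr lerD2l; apply: (le_trans h).
  by rewrite le_eqVlt; apply/orP; left; apply/eqP; ring.
by rewrite pmulr_rge0//; lra.
Qed.

Lemma risk_bound N E q W S Z l sx x rt T4 C4 C5 : 0 < N -> 0 <= l -> 0 <= C4 -> 0 <= C5 ->
  N * E + 2 * W <= 2 * S + 2 * Z -> N / 4 * q ^+ 2 - C5 * x <= W ->
  Z <= C4 * (l * sx + x) -> sx <= 2 * N * rt -> x <= 2 * N * T4 ->
  N * E + N / 2 * q ^+ 2 <= 2 * S + N * (4 * C4 * (l * rt) + 4 * (C4 + C5) * T4).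
Proof.
move=> N0 l0 C40 C50 h1 h2 h3 h4 h5.
have h6 := ler_wpM2l C40 h5; have h7 := ler_wpM2l C50 h5.
have h8 := ler_wpM2l (mulr_ge0 C40 l0) h4.
lra.
Qed.

End Rates.

(** * The oracle inequality *)

Section OracleEvents.
Context d (T : measurableType d) (R : realType) (P : probability T R) (m n : nat).
Variables (X : {RV P >-> mxspace R m}) (Xs : 'I_n -> {RV P >-> mxspace R m}).
Variables (xi : {RV P >-> R}) (xis : 'I_n -> {RV P >-> R}).
Variables b0 b1 b2 : R.
Hypotheses (b0_gt0 : 0 < b0) (b1_gt0 : 0 < b1) (b2_gt0 : 0 < b2).
Hypothesis n_gt0 : (0 < n)%N.
Hypothesis m_gt0 : (0 < m)%N.
Hypothesis model : sampling_model X Xs xi xis.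
Hypothesis subX : subgaussian X b0 b1 b2.
Implicit Types A B H L : 'M[R[i]]_m.

Let hX : forall w, (X w : 'M[R[i]]_m) \is hermsymmx := design_hermitian model.
Let nR : 0 < n%:R :> R. Proof. by rewrite ltr0n. Qed.
Let m1 : 1 <= m%:R :> R. Proof. by rewrite ler1n. Qed.

(** 100 doubles the 50 of [whp_frames_bernstein], for differences of densities; the last factor is
    that of [bernstein_rate] with B = 2 b2. *)
Definition bern_const := 100 * (b1 * (b1 * b2)) * (28 * (b2 * 2 + 1)).

Lemma whp_bernstein_diff H t : H \is hermsymmx -> L2norm X H <= b2 * 2 -> 0 < t ->
  whp P (t + 2) (fun w => forall A B, density R m A -> density R m B ->
    \sum_j ipR H (Xs j w) * ipR (A - B) (Xs j w) - n%:R * cov X H (A - B) <=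
    bern_const * (L2norm X H * Num.sqrt ((m%:R + t) * n%:R) + (m%:R + t))).
Proof.
move=> hH lH t0; set l := L2norm X H in lH *; have l0 : 0 <= l := L2norm_ge0 X H.
have x0 : 0 < m%:R + t by have := m1; lra.
have u0 : 0 < t + 2 by lra.
(* The norm of [H] may be 0, while the Bernstein bound needs a parameter strictly above it; this
   slack does not change the rate. *)
have dl0 : 0 < Num.min 1 (Num.sqrt ((m%:R + t) / n%:R)).
  by rewrite lt_min ltr01 sqrtr_gt0 divr_gt0.
have ldl : 0 < l + Num.min 1 (Num.sqrt ((m%:R + t) / n%:R)) by lra.
have K0 : 0 < b1 * (l + Num.min 1 (Num.sqrt ((m%:R + t) / n%:R))) by rewrite mulr_gt0.
have lK : b1 * l < b1 * (l + Num.min 1 (Num.sqrt ((m%:R + t) / n%:R))).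
  by rewrite ltr_pM2l// ltrDl.
have := whp_frames_bernstein b1_gt0 b2_gt0 n_gt0 m_gt0 model subX hH K0 lK u0.
apply: whp_weaken => w Hw A B dA dB.
have u'0 : 0 < t + 2 + 24 * m%:R by have := m1; lra.
have ux : t + 2 + 24 * m%:R <= 27 * (m%:R + t) by have := m1; lra.
have rate := bernstein_rate l0 lH x0 nR u'0 ux.
pose f C := \sum_j ipR H (Xs j w) * ipR C (Xs j w) - n%:R * cov X H C.
have fD C D : f (C + D) = f C + f D.
  rewrite /f (covC X H) (covD subX) (covC X C) (covC X D) mulrDr opprD addrACA.
  rewrite -big_split; congr (_ + _); apply: eq_bigr => j _ /=.
  by rewrite ipRD mulrDr.
have fZ s C : f (s%:C%C *: C) = s * f C.
  rewrite /f (covC X H) (covZ subX) (covC X C) mulrBr mulr_sumr (mulrCA s); congr (_ - _).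
  by apply: eq_bigr => j _; rewrite ipRZ mulrCA.
apply: le_trans (frame_diff_le fD fZ Hw dA dB) _.
have c0 : 0 <= 100 * (b1 * (b1 * b2)).
  by rewrite mulr_ge0// mulr_ge0 ?(ltW b1_gt0)// mulr_ge0 ?(ltW b1_gt0)// ltW.
rewrite /bern_const -[leRHS]mulrA; apply: le_trans (ler_wpM2l c0 rate).
by rewrite le_eqVlt; apply/orP; left; apply/eqP; ring.
Qed.

Lemma whp_design H t : H \is hermsymmx -> L2norm X H <= b2 * 2 -> 0 < t ->
  whp P (t + 1) (fun w => forall A B, density R m A -> density R m B ->
    n%:R / 4 * cov X (A - B) (A - B) - lower_const b1 b2 * (m%:R + t) <=
      \sum_j ipR (A - B) (Xs j w) ^+ 2 /\
    \sum_j ipR H (Xs j w) * ipR (B - A) (Xs j w) - n%:R * cov X H (B - A) <=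
    bern_const * (L2norm X H * Num.sqrt ((m%:R + t) * n%:R) + (m%:R + t))).
Proof.
move=> hH lH t0; have e : t + 1 + 1 <= t + 2 by lra.
have E1 := whp_le e (whp_lower b1_gt0 b2_gt0 n_gt0 m_gt0 model subX t0).
have E2 := whp_le e (whp_bernstein_diff hH lH t0).
apply: whp_weaken (whp_conj E1 E2) => w [h1 h2] A B dA dB.
by split; [exact: h1|exact: h2].
Qed.

(** Bounds 18 n sigma_xi^2 + 16 k (t + 3), with k from [noise_mgf_upper]; 34 = 18 + 16. The maximum
    separates the variance regime from the tail regime. *)
Definition noise_level (t : R) :=
  34 * Num.max (n%:R * noise_sd P xi ^+ 2) (624 * (c_noise P xi ^+ 2 * (t + 3))).

Lemma whp_noise_level t : (psi2norm P xi < +oo)%E -> 0 < noise_sd P xi -> 0 < t ->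
  whp P (t + 3) (fun w => \sum_j xis j w ^+ 2 <= noise_level t).
Proof.
move=> psi s0 t0; have [k [k0 kc mgf]] := noise_mgf_upper psi s0.
have k16 : 0 < 16 * k by rewrite mulr_gt0.
have := whp_sum_xi model (t + 3) (g := fun y => y ^+ 2 / (16 * k)) _ mgf.
move=> /(_ _)/wrap[|].
  by apply: measurable_funM => //; exact: measurable_funX.
apply: whp_weaken => w; rewrite -mulr_suml ler_pdivrMr// => /le_trans; apply.
rewrite /noise_level; set M := Num.max _ _.
have h1 : n%:R * noise_sd P xi ^+ 2 <= M by rewrite le_max lexx.
have h2 : k * (t + 3) <= M.
  rewrite le_max; apply/orP; right; rewrite mulrA ler_wpM2r//; lra.
have -> : (n%:R * (18 * noise_sd P xi ^+ 2 / (16 * k)) + (t + 3)) * (16 * k) =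
    18 * (n%:R * noise_sd P xi ^+ 2) + 16 * (k * (t + 3)).
  by field; rewrite gt_eqF.
lra.
Qed.

Lemma whp_noise_events L t : (psi2norm P xi < +oo)%E -> 0 < noise_sd P xi -> 0 < t ->
  whp P (t + 1) (fun w =>
    (forall k l, \sum_j xis j w * ipR (frame R k l) (Xs j w) <=
      8 * b0 * b2 * Num.sqrt ((t + 3 + 24 * m%:R) * noise_level t)) /\
    forall A, A \is hermsymmx ->
      \sum_j xis j w * ipR (calP L A) (Xs j w) <=
      4 * b0 * Num.sqrt ((t + 3 + 12 * (m%:R * (\rank L)%:R)) * noise_level t) *
        L2norm X (calP L A)).
Proof.
move=> psi s0 t0.
have v0 : 0 < noise_level t.
  apply: mulr_gt0; first by rewrite ltr0n.
  by rewrite lt_max; apply/orP; left; exact: mulr_gt0 nR (exprn_gt0 2 s0).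
have t3 : 0 < t + 3 by lra.
have t2 : 0 < t + 2 by lra.
have e3 : t + 1 + 1 + 1 <= t + 3 by lra.
have e2 : t + 1 + 1 <= t + 2 by lra.
have E1 := whp_le e3 (whp_noise_level psi s0 t0).
have E2 := whp_le e3 (whp_frames_linear b0_gt0 b2_gt0 m_gt0 model subX v0 t3).
have E3 := whp_le e2 (whp_subspace b0_gt0 model subX (@calP_gen_herm _ _ L) v0 t2).
apply: whp_weaken (whp_conj (whp_conj E1 E2) E3) => w [[h1 h2] h3]; split.
  by move=> k l; exact: h2.
move=> A hA; have [c ->] := calP_span L hA.
apply: (le_trans (h3 h1 c)); rewrite card_calP_gen.
rewrite (_ : t + 2 + 1 + 6 * _ = t + 3 + 12 * (m%:R * (\rank L)%:R))//.
by rewrite !natrM; ring.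
Qed.

(** Off the range of P_L the two compressed densities are bounded separately as positive matrices,
    so that their traces appear; symmetry of the frames handles the one with the minus sign. *)
Lemma noise_split (x : 'I_n -> mxspace R m) (e : 'I_n -> R) L A B (M : R) :
  (forall k l, \sum_j e j * ipR (frame R k l) (x j) <= M) ->
  density R m A -> density R m B ->
  let Q := orthoproj (orthocompl L) in
  \sum_j e j * ipR (A - B) (x j) <=
  \sum_j e j * ipR (calP L (A - B)) (x j) +
    M * (complex.Re (\tr (Q *m A)) + complex.Re (\tr (Q *m B))).
Proof.
move=> HM dA dB /=; set Q := orthoproj _; have hQ : Q^t* = Q := orthoproj_herm _.
have QQ : Q *m Q = Q := orthoproj_idem _.
pose f C := \sum_j e j * ipR C (x j).
have fD C D : f (C + D) = f C + f D.
  by rewrite -big_split; apply: eq_bigr => j _ /=; rewrite ipRD mulrDr.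
have fZ s C : f (s%:C%C *: C) = s * f C.
  by rewrite mulr_sumr; apply: eq_bigr => j _; rewrite ipRZ mulrCA.
have fN C : f (- C) = - f C.
  by rewrite -scaleN1r -(rmorphN1 (real_complex R)) fZ mulN1r.
have HMN k l : - f (frame R k l) <= M.
  by rewrite -fN; have [k' ->] := frameN R k l; exact: HM.
have gD C D : - f (C + D) = - f C + - f D by rewrite fD opprD.
have gZ s C : - f (s%:C%C *: C) = s * - f C by rewrite fZ mulrN.
have [hA pA _] := dA; have [hB pB _] := dB.
have fA := frame_psd_le fD fZ HM (compress_herm hQ hA) (compress_psd hQ pA).
have fB := frame_psd_le (f := fun C => - f C) gD gZ HMN (compress_herm hQ hB) (compress_psd hQ pB).
rewrite tr_compress// in fA; rewrite tr_compress// in fB.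
have -> : \sum_j e j * ipR (A - B) (x j) = f (calP L (A - B)) + (f (Q *m A *m Q) - f (Q *m B *m Q)).
  by rewrite -fN -fD -mulmxBl -mulmxBr -fD /calP subrK.
rewrite -/(f _) lerD2l mulrDr; exact: lerD.
Qed.

End OracleEvents.

Section OracleReal.
Variable R : realType.

(** 2 M K <= 4 N C6 s rt K, which [8 * C6 * (s * rt) <= eps] bounds by half of N EK: hence the 8 in
    the lower bound on eps. What is left, N EK / 2 + N q^2 / 4, explains the outer factor 4. *)
Lemma oracle_large (N EK K q S Sp M a b s rt sx eps C6 c3 c4 Ca T1 T3 T4 : R) :
  0 < N -> 0 <= K -> 0 <= b -> 0 <= M -> 0 <= C6 -> 0 <= s ->
  N * EK + N / 2 * q ^+ 2 <= 2 * S + N * (c3 * T3 + c4 * T4) ->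
  S <= Sp + M * (a + b) -> a <= 2 * b + K -> M <= C6 * s * sx -> sx <= 2 * N * rt ->
  EK = eps * K -> 0 <= EK -> 8 * C6 * (s * rt) <= eps ->
  2 * Sp <= N / 4 * q ^+ 2 + N * (Ca * T1) ->
  EK + q ^+ 2 <= 4 * (Ca * T1 + 12 * C6 * (s * b * rt) + c3 * T3 + c4 * T4).
Proof.
move=> N0 K0 b0 M0 C60 s0 h0 hS ha hM hsx EKE EK0 he hSp.
have h1 : M * (a + b) <= M * (3 * b + K) by apply: ler_wpM2l => //; lra.
have bK : 0 <= 3 * b + K by lra.
have {}hM : M <= C6 * s * (2 * N * rt).
  by apply: (le_trans hM); apply: ler_wpM2l => //; exact: mulr_ge0.
have h2 := ler_wpM2r bK hM.
have h3 : 8 * C6 * (s * rt) * K <= EK by rewrite EKE; exact: ler_wpM2r.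
have h4 := ler_wpM2l (ltW N0) h3.
have h5 : N * (EK + q ^+ 2) <= N * (4 * (Ca * T1 + 12 * C6 * (s * b * rt) + c3 * T3 + c4 * T4)).
  have := mulr_ge0 (ltW N0) EK0; lra.
by rewrite ler_pM2l in h5.
Qed.

Lemma oracle_small (N EK q S c3 c4 c5 T3 T4 : R) : 0 < N -> 0 <= EK ->
  N * EK + N / 2 * q ^+ 2 <= 2 * S + N * (c3 * T3 + c4 * T4) ->
  2 * S <= N * (c5 * T4) -> EK + q ^+ 2 <= 4 * (c3 * T3 + (c4 + c5) * T4).
Proof.
move=> N0 EK0 h0 hS.
have h5 : N * (EK + q ^+ 2) <= N * (4 * (c3 * T3 + (c4 + c5) * T4)).
  have := mulr_ge0 (ltW N0) EK0; have := mulr_ge0 (ltW N0) (sqr_ge0 q); lra.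
by rewrite ler_pM2l in h5.
Qed.

Lemma sum4_le_max (a1 a2 a3 a4 t1 t2 t3 t4 : R) :
  0 <= a1 -> 0 <= a2 -> 0 <= a3 -> 0 <= a4 ->
  a1 * t1 + a2 * t2 + a3 * t3 + a4 * t4 <=
  (a1 + a2 + a3 + a4) * Num.max t1 (Num.max t2 (Num.max t3 t4)).
Proof.
move=> h1 h2 h3 h4; set M := Num.max _ _.
have m1 : t1 <= M by rewrite le_max lexx.
have m2 : t2 <= M by rewrite !le_max lexx orbT.
have m3 : t3 <= M by rewrite !le_max lexx !orbT.
have m4 : t4 <= M by rewrite !le_max lexx !orbT.
by rewrite !mulrDl !lerD// ler_wpM2l.
Qed.

Lemma EFin_le_max4 (x C t1 t2 t3 t4 : R) (T1 : \bar R) : 0 <= C ->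
  x <= C * Num.max t1 (Num.max t2 (Num.max t3 t4)) -> (t1%:E <= T1)%E ->
  (x%:E <= C%:E * maxe T1 (maxe t2%:E (maxe t3%:E t4%:E)))%E.
Proof.
move=> C0 xC tT; apply: (@le_trans _ _ (C%:E * (Num.max t1 (Num.max t2 (Num.max t3 t4)))%:E)%E).
  by rewrite -EFinM lee_fin.
apply: lee_wpmul2l; rewrite ?lee_fin// !EFin_max.
by rewrite ge_max; apply/andP; split; rewrite le_max ?tT// lexx orbT.
Qed.

Lemma subspace_dim_rate (t tau k : R) : 0 < t -> t <= tau -> 1 <= k ->
  t + 3 + 12 * k <= 15 * (k + tau).
Proof. lra. Qed.

Lemma tau_n_ge (t : R) (n : nat) : (0 < n)%N -> t <= tau_n t n.
Proof.
move=> n0; rewrite /tau_n lerDl ln_ge0// /log2.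
have n1 : 1 <= n%:R :> R by rewrite ler1n.
have l2 : 0 < ln 2 :> R by rewrite ln_gt0// ltr1n.
by rewrite ler_pdivlMr// mul1r ler_ln ?posrE//; lra.
Qed.

End OracleReal.

Lemma whp_event d (T : measurableType d) (R : realType) (P : probability T R)
    (t : R) (Q : T -> Prop) : whp P t Q ->
  exists E : set T, [/\ measurable E, ((1 - expR (- t))%:E <= P E)%E & forall w, E w -> Q w].
Proof.
move=> [B [mB PB HB]]; exists (~` B); split => //; first exact: measurableC.
rewrite probability_setC// EFinB; exact: leeB.
Qed.

Section Constants.
Variables (R : realType) (b0 b1 b2 : R).
Definition large_noise_const := 8 * b0 * b2 * Num.sqrt (27 * 34).
Definition small_noise_const := 4 * (8 * b0 * b2) * (Num.sqrt (27 * (34 * 624)) * 4).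
(** The inner summands are the coefficients of the four terms of the maximum, in order. *)
Definition oracle_const := 4 * ((8 * b0) ^+ 2 * (15 * 34) + 12 * large_noise_const +
  4 * bern_const b1 b2 + (4 * (bern_const b1 b2 + lower_const b1 b2) + small_noise_const)).
Hypotheses (b0_gt0 : 0 < b0) (b1_gt0 : 0 < b1) (b2_gt0 : 0 < b2).

Lemma bern_const_ge0 : 0 <= bern_const b1 b2.
Proof.
rewrite /bern_const; have bb := mulr_gt0 b1_gt0 (mulr_gt0 b1_gt0 b2_gt0).
have h : 0 <= 28 * (b2 * 2 + 1) by have := b2_gt0; lra.
by apply: mulr_ge0 h; have := bb; lra.
Qed.

Lemma lower_const_ge0 : 0 <= lower_const b1 b2.
Proof.
rewrite /lower_const.
have g0 : 0 <= 256 * b1 ^+ 4 by rewrite mulr_ge0 ?ler0n// (exprnP b1 4) exprn_even_ge0.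
move: (256 * b1 ^+ 4) g0 => g g0; have := sqr_ge0 (5 * (b1 * b2)).
move: (_ ^+ 2) => k k0; have := sqr_ge0 b2; move: (b2 ^+ 2) => b b_ge0.
have h1 : 0 <= b * (102 * g + 1) by apply: mulr_ge0 => //; lra.
have h2 : 0 <= 4 * (28 * k) * (48 * g) by apply: mulr_ge0; lra.
by apply: addr_ge0.
Qed.

Lemma large_noise_const_gt0 : 0 < large_noise_const.
Proof. by rewrite /large_noise_const mulr_gt0 ?sqrtr_gt0// !mulr_gt0. Qed.

Lemma small_noise_const_ge0 : 0 <= small_noise_const.
Proof.
have h := mulr_gt0 b0_gt0 b2_gt0.
rewrite /small_noise_const; apply: mulr_ge0; first by lra.
by apply: mulr_ge0; [exact: sqrtr_ge0|rewrite ler0n].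
Qed.

Lemma oracle_const_gt0 : 0 < oracle_const.
Proof.
have := bern_const_ge0; have := lower_const_ge0; have := large_noise_const_gt0.
have := small_noise_const_ge0; rewrite /oracle_const.
have := sqr_ge0 (8 * b0); move: (_ ^+ 2) => z1.
by move: small_noise_const large_noise_const (bern_const _ _) (lower_const _ _) => *; lra.
Qed.

End Constants.

Section OracleInequality.
Context d (T : measurableType d) (R : realType) (P : probability T R) (m n : nat).
Variables (X : {RV P >-> mxspace R m}) (Xs : 'I_n -> {RV P >-> mxspace R m}).
Variables (xi : {RV P >-> R}) (xis : 'I_n -> {RV P >-> R}).
Variables b0 b1 b2 : R.
Hypotheses (b0_gt0 : 0 < b0) (b1_gt0 : 0 < b1) (b2_gt0 : 0 < b2).
Hypothesis n_gt0 : (0 < n)%N.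
Hypothesis model : sampling_model X Xs xi xis.
Hypothesis subX : subgaussian X b0 b1 b2.
Hypothesis psi_fin : (psi2norm P xi < +oo)%E.
Variables (t eps : R) (rho rhoeps L : 'M[R[i]]_m) (rhohat : T -> 'M[R[i]]_m).
Hypotheses (t_gt0 : 0 < t) (eps_gt0 : 0 < eps).
Hypothesis drho : density R m rho.
Hypothesis arghat : forall w, is_argmin (density R m)
  (empirical_risk (fun j => Xs j w) (fun j => response rho (Xs j w) (xis j w)) eps) (rhohat w).
Hypothesis argeps : is_argmin (density R m) (population_risk X rho eps) rhoeps.

Let C4 := bern_const b1 b2.
Let C5 := lower_const b1 b2.
Let C6 := large_noise_const b0 b2.
Let C7 := small_noise_const b0 b2.
Hypothesis eps_ge : 8 * C6 * eps_nm P xi t n m <= eps.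

Let s := noise_sd P xi.
Let rt := Num.sqrt (m%:R * t_m t m / n%:R).
Let l := L2norm X (rhoeps - rho).
Let nuc := nucnorm (orthoproj (orthocompl L) *m rhoeps *m orthoproj (orthocompl L)).
Let T4 := Num.max (c_noise P xi) (Num.sqrt m%:R) * (Num.sqrt m%:R * t_nm t n m / n%:R).

Let m_gt0 : (0 < m)%N. Proof. exact: density_dim_gt0 drho. Qed.
Let nR : 0 < n%:R :> R. Proof. by rewrite ltr0n. Qed.
Let m1 : 1 <= m%:R :> R. Proof. by rewrite ler1n. Qed.
Let deps : density R m rhoeps. Proof. by case: argeps. Qed.
Let dhat w : density R m (rhohat w). Proof. by case: (arghat w). Qed.
Let hX : forall w, (X w : 'M[R[i]]_m) \is hermsymmx := design_hermitian model.
Let rates := dim_rate m1 t_gt0 (ln_2m_ge R m_gt0).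
Let x0 : 0 < m%:R + t. Proof. by have := m1; have := t_gt0; lra. Qed.
Let t3_gt0 : 0 < t + 3. Proof. by have := t_gt0; lra. Qed.
Let frame_rate : t + 3 + 24 * m%:R <= 27 * (m%:R + t).
Proof. by have := m1; have := t_gt0; lra. Qed.
Let C4_ge0 : 0 <= C4 := bern_const_ge0 b1_gt0 b2_gt0.
Let C5_ge0 : 0 <= C5 := lower_const_ge0 b1 b2.
Let C6_gt0 : 0 < C6 := large_noise_const_gt0 b0_gt0 b2_gt0.
Let C7_ge0 : 0 <= C7 := small_noise_const_ge0 b0_gt0 b2_gt0.

Let tm_le : t_m t m <= t_nm t n m. Proof. by rewrite le_max lexx orbT. Qed.

Let T4_ge (c : R) : c <= Num.max (c_noise P xi) (Num.sqrt m%:R) ->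
  c * (Num.sqrt m%:R * t_m t m) <= n%:R * T4.
Proof.
move=> cM; have [tm0 _ _] := rates.
have M0 : 0 <= Num.max (c_noise P xi) (Num.sqrt m%:R).
  by rewrite le_max sqrtr_ge0 orbT.
have -> : n%:R * T4 = Num.max (c_noise P xi) (Num.sqrt m%:R) * (Num.sqrt m%:R * t_nm t n m).
  have h (y z : R) : n%:R * (y * (z / n%:R)) = y * z by field; rewrite gt_eqF.
  exact: h.
apply: (@le_trans _ _ (Num.max (c_noise P xi) (Num.sqrt m%:R) * (Num.sqrt m%:R * t_m t m))).
  by rewrite ler_wpM2r// mulr_ge0 ?sqrtr_ge0// ltW.
by rewrite ler_wpM2l// ler_wpM2l// sqrtr_ge0.
Qed.

Let x_le_T4 : m%:R + t <= 2 * n%:R * T4.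
Proof.
have [tm0 xm _] := rates; apply: (le_trans xm); rewrite -mulrA ler_wpM2l//.
have := @T4_ge (Num.sqrt m%:R); rewrite le_max lexx orbT => /(_ isT).
by rewrite mulrA -expr2 sqr_sqrtr ?ler0n.
Qed.

Lemma design_bound : whp P (t + 1) (fun w =>
  n%:R * (eps * symKL (rhohat w) rhoeps) + n%:R / 2 * L2norm X (rhohat w - rhoeps) ^+ 2 <=
  2 * \sum_j xis j w * ipR (rhohat w - rhoeps) (Xs j w) +
    n%:R * (4 * C4 * (l * rt) + 4 * (C4 + C5) * T4)).
Proof.
have := whp_design b1_gt0 b2_gt0 n_gt0 m_gt0 model subX
  (density_diff_herm deps drho) (L2norm_density_diff b2_gt0 subX deps drho) t_gt0.
apply: whp_weaken => w Hw.
have [h1 h2] := Hw _ _ (dhat w) deps.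
have h0 := first_order subX n_gt0 (fun j => sample_hermitian model j w) eps_gt0 (arghat w) argeps.
rewrite (cov_L2norm hX subX (density_diff_herm (dhat w) deps)) in h1.
have [_ xm _] := rates.
exact: risk_bound nR (L2norm_ge0 _ _) C4_ge0 C5_ge0 h0 h1 h2 (sqrt_rate x0 nR xm) x_le_T4.
Qed.

Let Q := orthoproj (orthocompl L).

Let nucE : nuc = complex.Re (\tr (Q *m rhoeps)).
Proof.
have [hS pS _] := deps; have hQ : Q^t* = Q := orthoproj_herm _.
apply: etrans (nucnorm_psd (compress_herm hQ hS) (compress_psd hQ pS)) _.
by congr (complex.Re _); exact: tr_compress (orthoproj_idem _).
Qed.

Let nuc_ge0 : 0 <= nuc.
Proof. by rewrite /nuc /nucnorm tr_mxfun; apply: sumr_ge0 => i _; exact: sqrtr_ge0. Qed.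

Let K_ge0 w : 0 <= symKL (rhohat w) rhoeps.
Proof.
have [h1 _ _] := dhat w; have [h2 _ _] := deps.
apply: le_trans (sqrt_sub_le_symKL h1 h2 _ _).
- by rewrite mulr_ge0// sqfrob_ge0.
- exact: (empirical_argmin_posdef (fun j => sample_hermitian model j w) eps_gt0 (arghat w)).
- exact: (population_argmin_posdef subX eps_gt0 argeps).
Qed.

Let EK_ge0 w : 0 <= eps * symKL (rhohat w) rhoeps.
Proof. by rewrite mulr_ge0 ?(ltW eps_gt0). Qed.

Let s_ge0 : 0 <= s. Proof. exact: sqrtr_ge0. Qed.

Let oracle_max (t1 : R) : 0 <= t1 -> forall y : R,
  y <= 4 * ((8 * b0) ^+ 2 * (15 * 34) * t1 + 12 * C6 * (s * nuc * rt) + 4 * C4 * (l * rt) +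
    (4 * (C4 + C5) + C7) * T4) ->
  y <= oracle_const b0 b1 b2 * Num.max t1 (Num.max (s * nuc * rt) (Num.max (l * rt) T4)).
Proof.
move=> t10 y /le_trans; apply; rewrite /oracle_const -[leRHS]mulrA ler_wpM2l//.
apply: sum4_le_max.
- by rewrite mulr_ge0 ?sqr_ge0// mulr_ge0// ler0n.
- by rewrite mulr_ge0 ?ler0n// (ltW C6_gt0).
- by rewrite mulr_ge0 ?ler0n// C4_ge0.
- by rewrite addr_ge0 ?C7_ge0// mulr_ge0 ?ler0n// addr_ge0 ?C4_ge0 ?C5_ge0.
Qed.

Let T4_ge0 : 0 <= T4.
Proof.
have n2 : 0 < 2 * n%:R :> R by apply: mulr_gt0 nR; rewrite ltr0n.
by have := le_trans (ltW x0) x_le_T4; rewrite (pmulr_rge0 _ n2).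
Qed.

(** The noise vanishes almost surely and only design terms remain. The first entry of the maximum is
    put to 0, below its counterpart in the theorem whatever the value of [beta X L]. *)
Lemma whp_oracle_noiseless : s = 0 -> whp P t (fun w =>
  L2norm X (rhohat w - rhoeps) ^+ 2 + eps * symKL (rhohat w) rhoeps <=
  oracle_const b0 b1 b2 * Num.max 0 (Num.max (s * nuc * rt) (Num.max (l * rt) T4))).
Proof.
move=> sz; have E1 : whp P (t + 1) (fun w => forall j, xis j w = 0).
  apply: (@whp_forall _ _ _ _ 'I_n n%:R); first by rewrite card_ord ler_natr_expR.
  move=> j; apply: (whp_zero (noise_law model j) (g := id)) => //.
  by rewrite /= noise_sdE// -/s sz expr0n.
apply: whp_weaken (whp_conj E1 design_bound) => w [xi0 h0].
apply: (oracle_max (lexx _)).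
rewrite big1 ?mulr0 in h0; last by move=> j _; rewrite xi0 mul0r.
have hS : 2 * 0 <= n%:R * (C7 * T4).
  by rewrite mulr0; apply: mulr_ge0 (ltW nR) _; apply: mulr_ge0 C7_ge0 T4_ge0.
rewrite [leLHS]addrC mulr0 sz !mul0r mulr0 addr0 add0r.
by apply: (oracle_small nR (EK_ge0 w) _ hS); rewrite mulr0.
Qed.

Lemma whp_oracle (b : R) : 0 < s -> beta X L = b%:E -> whp P t (fun w =>
  L2norm X (rhohat w - rhoeps) ^+ 2 + eps * symKL (rhohat w) rhoeps <=
  oracle_const b0 b1 b2 * Num.max (s ^+ 2 * b ^+ 2 * ((m%:R * (\rank L)%:R + tau_n t n) / n%:R))
    (Num.max (s * nuc * rt) (Num.max (l * rt) T4))).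
Proof.
move=> s0 bE; have b_ge0 : 0 <= b by rewrite -lee_fin -bE (beta_ge0 subX).
set y := m%:R * _ + _; have [tm0 xm ttm] := rates.
have tau := tau_n_ge t n_gt0.
have y0 : 0 < y by rewrite ltr_wpDl ?mulr_ge0// (lt_le_trans t_gt0).
have noise := whp_noise_events b0_gt0 b2_gt0 n_gt0 m_gt0 model subX L psi_fin s0 t_gt0.
apply: whp_weaken (whp_conj noise design_bound) => w [[hfr hcal] h0].
have t1_ge0 : 0 <= s ^+ 2 * b ^+ 2 * (y / n%:R).
  apply: mulr_ge0; first by apply: mulr_ge0; exact: sqr_ge0.
  exact: divr_ge0 (ltW y0) (ltW nR).
apply: (oracle_max t1_ge0); rewrite [leLHS]addrC.
set D := rhohat w - rhoeps in h0 *.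
have hD : D \is hermsymmx := density_diff_herm (dhat w) deps.
set M := 8 * b0 * b2 * _ in hfr.
have bb : 0 <= 8 * b0 * b2.
  by apply: mulr_ge0 (ltW b2_gt0); apply: mulr_ge0 (ltW b0_gt0); rewrite ler0n.
have M0 : 0 <= M by apply: mulr_ge0 bb _; exact: sqrtr_ge0.
have sx := sqrt_rate x0 nR xm.
(* When the tail part of the noise level dominates, 2 <Delta, Xi> is already of
   the order of the last term, without splitting by L. *)
have [small|large] := leP (624 * (c_noise P xi ^+ 2 * (t + 3))) (n%:R * s ^+ 2).
  have vE : noise_level n xi t = 34 * (n%:R * s ^+ 2).
    by rewrite /noise_level (max_idPl small).
  have hM : M <= C6 * s * Num.sqrt ((m%:R + t) * n%:R).
    have gen (a k s' z : R) : a * (k * s' * z) = a * k * s' * z by ring.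
    by have := ler_wpM2l bb (noise_rate_large x0 nR s_ge0 frame_rate vE); rewrite gen.
  have split := noise_split L hfr (dhat w) deps.
  have ha : complex.Re (\tr (Q *m rhohat w)) <= 2 * nuc + symKL (rhohat w) rhoeps.
    have [h1 _ _] := dhat w; have [h2 _ _] := deps.
    rewrite nucE; apply: (tr_proj_le_symKL (orthoproj_herm _) (orthoproj_idem _) h1 h2).
    - exact: (empirical_argmin_posdef (fun j => sample_hermitian model j w) eps_gt0 (arghat w)).
    - exact: (population_argmin_posdef subX eps_gt0 argeps).
  have he : 8 * C6 * (s * rt) <= eps.
    apply: le_trans eps_ge; apply: ler_wpM2l; first by apply: mulr_ge0 (ltW C6_gt0); rewrite ler0n.
    by rewrite le_max lexx.
  have hSp : 2 * \sum_j xis j w * ipR (calP L D) (Xs j w) <= n%:R / 4 * L2norm X D ^+ 2 +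
      n%:R * ((8 * b0) ^+ 2 * (15 * 34) * (s ^+ 2 * b ^+ 2 * (y / n%:R))).
    (* The additive 3 fits into 15 (m r + tau_n) because m r >= 1; for r = 0 the operator is
       zero. *)
    have [r0|r0] := posnP (\rank L).
      rewrite (calP_rank0 D r0) big1 ?mulr0; last by move=> j _; rewrite ipR0 mulr0.
      apply: addr_ge0.
        by apply: mulr_ge0 (sqr_ge0 _); apply: divr_ge0 (ltW nR) _.
      apply: mulr_ge0 (ltW nR) _; apply: mulr_ge0 t1_ge0.
      by rewrite mulr_ge0 ?sqr_ge0// mulr_ge0// ler0n.
    have uy : t + 3 + 12 * (m%:R * (\rank L)%:R) <= 15 * y.
      have mr : 1 <= m%:R * (\rank L)%:R :> R.
        by rewrite -natrM ler1n muln_gt0 m_gt0.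
      exact: subspace_dim_rate t_gt0 tau mr.
    have h1 : 2 * (4 * b0 * Num.sqrt ((t + 3 + 12 * (m%:R * (\rank L)%:R)) * noise_level n xi t) *
        (b * L2norm X D)) <= n%:R / 4 * L2norm X D ^+ 2 +
        (8 * b0) ^+ 2 * (15 * 34) * (s ^+ 2 * b ^+ 2 * y).
      exact: subspace_rate b0_gt0 nR s_ge0 b_ge0 (ltW y0) uy vE.
    have h2 : n%:R * ((8 * b0) ^+ 2 * (15 * 34) * (s ^+ 2 * b ^+ 2 * (y / n%:R))) =
        (8 * b0) ^+ 2 * (15 * 34) * (s ^+ 2 * b ^+ 2 * y).
      by field; rewrite gt_eqF.
    rewrite h2; apply: le_trans h1; rewrite ler_wpM2l//.
    apply: (le_trans (hcal D hD)); apply: ler_wpM2l.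
      by apply: mulr_ge0 (sqrtr_ge0 _); apply: mulr_ge0 (ltW b0_gt0); rewrite ler0n.
    exact: (L2norm_calP_le hX subX bE hD).
  have := oracle_large nR (K_ge0 w) nuc_ge0 M0 (ltW C6_gt0) s_ge0 h0 _ ha hM sx erefl (EK_ge0 w) he hSp.
  rewrite nucE => /(_ split) /le_trans; apply; rewrite ler_wpM2l// lerD2l.
  by rewrite ler_wpM2r ?T4_ge0// lerDl C7_ge0.
have vE : noise_level n xi t = 34 * (624 * (c_noise P xi ^+ 2 * (t + 3))).
  by rewrite /noise_level (max_idPr (ltW large)).
have c0 : 0 <= c_noise P xi by exact: ltW (c_noise_gt0 psi_fin s0).
have hM : M <= 8 * b0 * b2 * (Num.sqrt (27 * (34 * 624)) * (4 * (c_noise P xi * (Num.sqrt m%:R * t_m t m)))).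
  apply: (ler_wpM2l bb).
  apply: (noise_rate_small x0 _ tm0 c0 xm t3_gt0 ttm frame_rate (ler0n _ _) (ler0n _ _) vE).
  exact: lt_le_trans m1.
have cT := @T4_ge (c_noise P xi); rewrite le_max lexx in cT.
have hS : 2 * \sum_j xis j w * ipR D (Xs j w) <= n%:R * (C7 * T4).
  pose f C := \sum_j xis j w * ipR C (Xs j w).
  have fD A B : f (A + B) = f A + f B.
    by rewrite -big_split; apply: eq_bigr => j _ /=; rewrite ipRD mulrDr.
  have fZ a A : f (a%:C%C *: A) = a * f A.
    by rewrite mulr_sumr; apply: eq_bigr => j _; rewrite ipRZ mulrCA.
  have h1 : f D <= 2 * M := frame_diff_le fD fZ hfr (dhat w) deps.
  rewrite -/(f D).
  have k0 : 0 <= 4 * (8 * b0 * b2) * (Num.sqrt (27 * (34 * 624)) * 4).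
    exact: C7_ge0.
  have h2 := ler_wpM2l k0 (cT isT).
  rewrite /C7 /small_noise_const; apply: (@le_trans _ _ (4 * M)).
    by rewrite (_ : 4 * M = 2 * (2 * M)) ?ler_wpM2l//; ring.
  have h4 : 0 <= 4 :> R by rewrite ler0n.
  apply: (le_trans (ler_wpM2l h4 hM)).
  rewrite [leRHS]mulrCA; apply: le_trans h2.
  by rewrite le_eqVlt; apply/orP; left; apply/eqP; ring.
apply: (le_trans (oracle_small nR (EK_ge0 w) h0 hS)).
rewrite ler_wpM2l// addrA lerD2r lerDr addr_ge0// mulr_ge0//.
  by rewrite mulr_ge0 ?sqr_ge0// mulr_ge0// ler0n.
by rewrite mulr_ge0 ?ler0n// (ltW C6_gt0).
by rewrite !mulr_ge0// sqrtr_ge0.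
Qed.

End OracleInequality.

Theorem theorem9 (R : realType) (b0 b1 b2 : R) :
  0 < b0 -> 0 < b1 -> 0 < b2 ->
  exists C D c : R, [/\ 0 < C, 0 < D, 0 < c &
  forall (d : measure_display) (T : measurableType d) (P : probability T R)
    (m n : nat) (X : {RV P >-> mxspace R m})
    (Xs : 'I_n -> {RV P >-> mxspace R m})
    (xi : {RV P >-> R}) (xis : 'I_n -> {RV P >-> R}) (rho : 'M[R[i]]_m),
  (0 < n)%N ->
  density R m rho ->
  sampling_model X Xs xi xis ->
  subgaussian X b0 b1 b2 ->
  (psi2norm P xi < +oo)%E ->
  forall t : R, 0 < t -> tau_n t n <= c * n%:R ->
  forall eps : R, 0 < eps -> D * eps_nm P xi t n m <= eps ->
  forall (rhohat : T -> 'M[R[i]]_m) (rhoeps : 'M[R[i]]_m),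
  (forall w, is_argmin (density R m)
     (empirical_risk (fun j => Xs j w)
        (fun j => response rho (Xs j w) (xis j w)) eps) (rhohat w)) ->
  is_argmin (density R m) (population_risk X rho eps) rhoeps ->
  forall (r : nat) (L : 'M[R[i]]_m), \rank L = r ->
  exists E : set T, [/\ measurable E, ((1 - expR (- t))%:E <= P E)%E &
  forall w, E w ->
  ((L2norm X (rhohat w - rhoeps) ^+ 2 + eps * symKL (rhohat w) rhoeps)%:E <=
   C%:E *
   maxe ((noise_sd P xi ^+ 2)%:E * beta X L ^+ 2
           * ((m%:R * r%:R + tau_n t n) / n%:R)%:E)
  (maxe (noise_sd P xi
           * nucnorm (orthoproj (orthocompl L) *m rhoeps
                        *m orthoproj (orthocompl L))
           * Num.sqrt (m%:R * t_m t m / n%:R))%:E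
  (maxe (L2norm X (rhoeps - rho) * Num.sqrt (m%:R * t_m t m / n%:R))%:E
        (Num.max (c_noise P xi) (Num.sqrt m%:R)
           * (Num.sqrt m%:R * t_nm t n m / n%:R))%:E)))%E]].

Proof.
move=> b0_gt0 b1_gt0 b2_gt0.
have D0 : 0 < 8 * large_noise_const b0 b2.
  by apply: mulr_gt0 (large_noise_const_gt0 b0_gt0 b2_gt0); rewrite ltr0n.
have C0 := oracle_const_gt0 b0_gt0 b1_gt0 b2_gt0.
exists (oracle_const b0 b1 b2), (8 * large_noise_const b0 b2), 1; split=> //.
move=> d T P m n X Xs xi xis rho n_gt0 drho model subX psi_fin t t_gt0 _ eps eps_gt0 eps_ge.
move=> rhohat rhoeps arghat argeps r L <-.
have y0 : 0 < (m%:R * (\rank L)%:R + tau_n t n) / n%:R.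
  by rewrite divr_gt0 ?ltr0n// ltr_wpDl ?mulr_ge0// (lt_le_trans t_gt0)// tau_n_ge.
have beta0 := beta_ge0 subX L.
have [s0|s0] := eqVneq (noise_sd P xi) 0.
  have [E [mE PE EQ]] := whp_event (whp_oracle_noiseless b0_gt0 b1_gt0 b2_gt0 n_gt0 model
    subX psi_fin L t_gt0 eps_gt0 drho arghat argeps s0).
  exists E; split => // w /EQ Hw; apply: EFin_le_max4 (ltW C0) Hw _.
  apply: mule_ge0; last by rewrite lee_fin ltW.
  by apply: mule_ge0; [rewrite lee_fin sqr_ge0|exact: expe_ge0].
have {}s0 : 0 < noise_sd P xi by rewrite lt_neqAle eq_sym s0 sqrtr_ge0.
case bE : (beta X L) beta0 => [b| |] beta0 //.
  have [E [mE PE EQ]] := whp_event (whp_oracle b0_gt0 b1_gt0 b2_gt0 n_gt0 model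
    subX psi_fin t_gt0 eps_gt0 drho arghat argeps eps_ge s0 bE).
  by exists E; split => // w /EQ Hw; apply: EFin_le_max4 (ltW C0) Hw _; rewrite -EFin_expe -!EFinM.
(* With an infinite [beta] and a positive noise variance the right-hand side is infinite. *)
exists setT; split => //.
  by rewrite probability_setT lee_fin gerBl expR_ge0.
move=> w _; rewrite expr2 /= mulyy gt0_muley ?lte_fin ?exprn_gt0//.
by rewrite gt0_mulye ?lte_fin// maxye gt0_muley ?lte_fin// leey.
Qed.
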